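(* Let $\gamma=\gamma(n) \in (0,1)$ be such that $\max\{\gamma^{-1}, (1-\gamma)^{-1}\} = n^{o(1)}$. Then, as $n\to\infty$, $$\operatorname{bp}(n,\gamma) \sim \frac{h_2(\gamma)}{2}\cdot\frac{n^2}{\lg n}.$$ Furthermore, given an $n$-vertex graph with edge density $\gamma$ and $m$ edges, represented as an adjacency list, a biclique partition realizing the upper bound (i.e. of weight at most $(1+o(1))\frac{h_2(\gamma)}{2}\cdot\frac{n^2}{\lg n}$) can be constructed deterministically in time $O(m)$.
   Context: All graphs are finite, simple and undirected; $\lg$ is the base-2 logarithm; $h_2(x) = -x\lg x-(1-x)\lg(1-x)$ is the binary entropy function. The edge density of an $n$-vertex graph $G$ is $|E(G)|/\binom n2$. A biclique of a graph $G$ is a (not necessarily induced) complete bipartite subgraph of $G$. A biclique partition of $G$ is a family $\{B_1,\dots,B_k\}$ of bicliques of $G$ whose edge sets partition $E(G)$; its weight is $\sum_{i=1}^k|V(B_i)|$. $\operatorname{bp}(G)$ is the minimum weight of a biclique partition of $G$, and $\operatorname{bp}(n,\gamma)$ is the maximum of $\operatorname{bp}(G)$ over all $n$-vertex graphs $G$ with $|E(G)|=\gamma\binom n2$. Running times are in the standard word-RAM model with words of $\Theta(\lg n)$ bits. *)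

(* Defs.v *)
From HB Require Import structures.
From mathcomp Require Import all_boot all_order all_algebra.
From mathcomp Require Import boolp reals exp.

Set Implicit Arguments.
Unset Strict Implicit.
Unset Printing Implicit Defensive.

Import Order.TTheory GRing.Theory Num.Theory.

Local Open Scope ring_scope.
Local Open Scope nat_scope.

(** * Graphs and biclique partitions *)

(* A finite simple graph on the vertex set {0, ..., n-1}, given by its edges,
   which are 2-element sets of vertices. *)
Record sgraph (n : nat) := SGraph {
  edges : {set {set 'I_n}};
  edges_card2 : [forall e in edges, #|e| == 2] }.

HB.instance Definition _ n := [isSub for @edges n].
HB.instance Definition _ n := [Finite of sgraph n by <:].

(* A complete bipartite graph is given by its two sides. *)
Definition sides n := ({set 'I_n} * {set 'I_n})%type.

Definition bedges n (b : sides n) : {set {set 'I_n}} :=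
  [set [set x; y] | x in b.1, y in b.2].

Definition bverts n (b : sides n) : {set 'I_n} := b.1 :|: b.2.

Definition biclique n (G : sgraph n) (b : sides n) : bool :=
  [&& b.1 != set0, b.2 != set0, [disjoint b.1 & b.2]
    & bedges b \subset edges G].

(* The members of P are bicliques of G, and every edge of G is an edge of
   exactly one of them. *)
Definition biclique_partition n (G : sgraph n) (P : seq (sides n)) : bool :=
  all (biclique G) P &&
  [forall e in edges G, count (fun b => e \in bedges b) P == 1].

Definition weight n (P : seq (sides n)) : nat := \sum_(b <- P) #|bverts b|.

Lemma biclique_partition_exists n (G : sgraph n) :
  exists w, `[< exists2 P, biclique_partition G P & weight P = w >].
Proof.
pose Q := [set p : 'I_n * 'I_n | (p.1 < p.2) && ([set p.1; p.2] \in edges G)].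
pose s (p : 'I_n * 'I_n) : sides n := ([set p.1], [set p.2]).
have bs p e : (e \in bedges (s p)) = (e == [set p.1; p.2]).
  apply/imset2P/eqP => [[x y /set1P-> /set1P->] //|->].
  by exists p.1 p.2; rewrite ?inE.
exists (weight (map s (enum Q))); apply/asboolP.
exists (map s (enum Q)) => //; apply/andP; split.
  apply/allP => b /mapP[p]; rewrite mem_enum inE => /andP[lt_p Gp] ->.
  apply/and4P; split; try by apply/set0Pn; eexists; exact: set11.
    by rewrite disjoints1 inE /= -val_eqE neq_ltn lt_p.
  by apply/fintype.subsetP => e; rewrite bs => /eqP->.
apply/'forall_implyP => e Ge; rewrite count_map -size_filter.
have /fintype.forall_inP/(_ e Ge)/cards2P[x [y [nxy De]]] := edges_card2 G.
wlog lt_xy : x y nxy De / x < y => [W|].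
  have := nxy; rewrite -val_eqE neq_ltn => /orP[|lt_yx]; first exact: W.
  by apply: (W y x) => //; rewrite 1?eq_sym // setUC.
suff /perm_size-> :
  perm_eq [seq p <- enum Q | e \in bedges (s p)] [:: (x, y)] by [].
apply: uniq_perm => [|//|[u v]]; first exact/filter_uniq/enum_uniq.
rewrite mem_filter mem_enum !inE /= bs /=.
apply/and3P/eqP => [[/eqP Euv lt_uv _]|[-> ->]]; last first.
  by rewrite -De Ge lt_xy eqxx.
have: u \in e by rewrite Euv set21.
have: v \in e by rewrite Euv set22.
rewrite De !inE => /orP[]/eqP Dv /orP[]/eqP Du; subst u v => //.
- by rewrite ltnn in lt_uv.
- by rewrite ltnNge ltnW in lt_uv.
- by rewrite ltnn in lt_uv.
Qed.

Definition bp n (G : sgraph n) : nat := ex_minn (biclique_partition_exists G).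

Definition has_density (R : realType) n (g : R) (G : sgraph n) : bool :=
  (#|edges G|%:R == g * 'C(n, 2)%:R :> R)%R.

(* This is 0 when [g * 'C(n, 2)] is not an integer between 0 and 'C(n, 2). *)
Definition bp_max (R : realType) (n : nat) (g : R) : nat :=
  \max_(G : sgraph n | has_density g G) bp G.

Definition lg (R : realType) (x : R) : R := (ln x / ln 2)%R.

Definition h2 (R : realType) (x : R) : R :=
  (- x * lg x - (1 - x) * lg (1 - x))%R.

(** * Word-RAM *)

(* A machine with [w]-bit words: finitely many registers (those named in the
   program) and a memory addressed by words.  Every word produced is reduced
   modulo [2 ^ w].  A program is a structured three-address program; each
   instruction and each test of a condition takes one unit of time. *)

Inductive binop :=
  | Add | Sub | Mul | Div | Mod | And | Or | Xor | Shl | Shr | Ltn | Eqn.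

Definition wrap (w x : nat) : nat := x %% 2 ^ w.

Definition binop_val (w : nat) (o : binop) (x y : nat) : nat :=
  wrap w match o with
  | Add => x + y
  | Sub => x + 2 ^ w - y
  | Mul => x * y
  | Div => x %/ y
  | Mod => x %% y
  | And => Corelib.Init.Nat.land x y
  | Or => Corelib.Init.Nat.lor x y
  | Xor => Corelib.Init.Nat.lxor x y
  | Shl => x * 2 ^ y
  | Shr => x %/ 2 ^ y
  | Ltn => x < y
  | Eqn => x == y
  end.

Inductive cmd :=
  | Skip
  | Const (r k : nat)                  (* r := k *)
  | Binop (o : binop) (r r1 r2 : nat)  (* r := r1 o r2 *)
  | Read (r ra : nat)                  (* r := memory[ra] *)
  | Write (ra r : nat)                 (* memory[ra] := r *)
  | Seq (c1 c2 : cmd)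
  | If (r : nat) (c1 c2 : cmd)         (* c1 if r <> 0, else c2 *)
  | While (r : nat) (c : cmd).         (* repeat c as long as r <> 0 *)

Record state := State { reg : nat -> nat; mem : nat -> nat }.

Definition set_reg (s : state) (r x : nat) : state :=
  State [eta reg s with r |-> x] (mem s).

Definition set_mem (s : state) (a x : nat) : state :=
  State (reg s) [eta mem s with a |-> x].

(* [exec w c s t s']: with [w]-bit words, [c] started in [s] halts in [s']
   after [t] steps. *)
Inductive exec (w : nat) : cmd -> state -> nat -> state -> Prop :=
  | ExecSkip s : exec w Skip s 1 s
  | ExecConst r k s : exec w (Const r k) s 1 (set_reg s r (wrap w k))
  | ExecBinop o r r1 r2 s :
      exec w (Binop o r r1 r2) s 1
        (set_reg s r (binop_val w o (reg s r1) (reg s r2)))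
  | ExecRead r ra s : exec w (Read r ra) s 1 (set_reg s r (mem s (reg s ra)))
  | ExecWrite ra r s : exec w (Write ra r) s 1 (set_mem s (reg s ra) (reg s r))
  | ExecSeq c1 c2 s1 s2 s3 t1 t2 :
      exec w c1 s1 t1 s2 -> exec w c2 s2 t2 s3 ->
      exec w (Seq c1 c2) s1 (t1 + t2) s3
  | ExecIfTrue r c1 c2 s s' t :
      reg s r != 0 -> exec w c1 s t s' -> exec w (If r c1 c2) s t.+1 s'
  | ExecIfFalse r c1 c2 s s' t :
      reg s r == 0 -> exec w c2 s t s' -> exec w (If r c1 c2) s t.+1 s'
  | ExecWhileTrue r c s1 s2 s3 t1 t2 :
      reg s1 r != 0 -> exec w c s1 t1 s2 -> exec w (While r c) s2 t2 s3 ->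
      exec w (While r c) s1 (t1 + t2).+1 s3
  | ExecWhileFalse r c s : reg s r == 0 -> exec w (While r c) s 1 s.

(* The input is placed at the start of the memory; everything else is 0. *)
Definition init_state (w : nat) (input : seq nat) : state :=
  State (fun=> 0) (fun a => wrap w (nth 0 input a)).

(* The words of [l] are in memory from the address [a] on. *)
Definition stored (w : nat) (s : state) (a : nat) (l : seq nat) : Prop :=
  a + size l <= 2 ^ w /\ forall i, i < size l -> mem s (a + i) = nth 0 l i.

(** * Encoding of the input and of the output *)

(* The neighbours of a vertex may be listed in any order. *)
Definition adjacency_list n (G : sgraph n) (adj : 'I_n -> seq 'I_n) : Prop :=
  forall v, uniq (adj v) /\ adj v =i [pred u | [set v; u] \in edges G].

(* The word n, then n + 1 addresses, then the n lists one after the other: the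
   list of the vertex v lies between the v-th address (included) and the next
   one (excluded). *)
Definition adj_words n (adj : 'I_n -> seq 'I_n) : seq nat :=
  n :: [seq n.+2 + \sum_(u < n | u < v) size (adj u) | v <- iota 0 n.+1]
    ++ flatten [seq map val (adj v) | v <- enum 'I_n].

(* The output lists the vertices of both sides of each biclique. *)
Definition side_lists n := seq (seq 'I_n * seq 'I_n).

Definition decode n (L : side_lists n) : seq (sides n) :=
  [seq ([set x in b.1], [set y in b.2]) | b <- L].

Definition uniq_sides n (L : side_lists n) : bool :=
  all (fun b => uniq b.1 && uniq b.2) L.

(* The number of bicliques, then for each biclique and each of its two sides,
   the size of the side followed by its vertices. *)
Definition side_words n (L : side_lists n) : seq nat :=
  size L :: flatten [seq (size b.1 :: map val b.1) ++ (size b.2 :: map val b.2)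
                    | b <- L].

(* On the adjacency list [adj], the program [p] with [w]-bit words halts after
   [t] steps, register 0 then being the address of an explicit description of
   the biclique partition [P] of [G]. *)
Definition computes_partition (p : cmd) (w : nat) n (G : sgraph n)
    (adj : 'I_n -> seq 'I_n) (t : nat) (P : seq (sides n)) : Prop :=
  exists (s : state) (L : side_lists n),
    [/\ exec w p (init_state w (adj_words adj)) t s,
        uniq_sides L, P = decode L, stored w s (reg s 0) (side_words L)
      & biclique_partition G P].

(* Main.v *)
Require Import Defs.
From HB Require Import structures.
From mathcomp Require Import all_boot all_order all_algebra.
From mathcomp Require Import zify.

Set Implicit Arguments.
Unset Strict Implicit.
Unset Printing Implicit Defensive.

Import Order.TTheory GRing.Theory Num.Theory.

Local Open Scope nat_scope.

(** Upper bound.  Let N = C(n, 2), and let m be the number of edges.  The list of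
    the smaller neighbours of each vertex, in increasing order, is cut greedily
    into groups: a group is extended as long as it lies in an interval of length
    at most L and at most M sets have the same size in that interval.  The
    bicliques are the pairs made of a group and of all the vertices that have
    this group; they partition the edges ([blist_partition]).  The total size of
    the second sides is the number of all groups, counted with repetitions.  At
    most N / L groups end because of their length.  A group that ends because of
    M accounts for at least M / L choices of its elements; the product of the
    numbers of choices is at most C(N, m), by C(a, b) C(c, d) <= C(a + c, b + d),
    so that there are at most lg C(N, m) / lg (M / L) such groups, where
    lg C(N, m) <= N h2(m / N) ([weight_bound]).  The different groups are at most
    n L L M in number, and contribute at most L each.  With M about n / L^4 and
    L = n^{o(1)} at least lg^2 n / (g (1 - g)), where g is the density, only the
    entropy term matters ([upper_bound]).

    Lower bound.  A partition of weight W is described by a word of W letters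
    over the 4 n pairs made of a vertex and two flags, so that
    C(N, m) <= (4 n)^W for the largest minimum weight W ([bin_le_bp]); and
    C(N, m) >= 2^{N h2(m / N)} / (N + 1) ([bin_type_ge]).

    Algorithm.  The groups are the nodes of a trie: the node of a group is found
    in constant time in a table indexed by the node of the group without its
    last element and by this element.  Words of O(lg n) bits address tables of
    polynomial size, and the memory beyond the input is 0 at the start, so that
    no initialisation is needed.  Whether a group can be extended is read in
    Pascal's triangle, computed up to the row L with values capped at M + 1.  The
    time is O(n + L^2 + m), which is O(m) since L = n^{o(1)} and n <= 4 m for n
    large ([program_correct], [linear_time]).  The program is written in a small
    language of expressions, loops and arrays that is compiled to machine
    instructions; [wp] is its timed total correctness. *)

(** * Products and type classes of binomial coefficients *)

Lemma leq_mul_bin a b c d : 'C(a, b) * 'C(c, d) <= 'C(a + c, b + d).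
Proof.
rewrite -binomial.Vandermonde.
have lt_b : b < (b + d).+1 by lia.
by rewrite (bigD1 (Ordinal lt_b)) //= addKn leq_addr.
Qed.

Section TypeClass.

Variables N m : nat.
Hypotheses (m_gt0 : 0 < m) (ltmN : m < N).

(* By the binomial theorem N ^ N is the sum of all the t k; the ratio of two
   consecutive terms shows that the greatest one is t m. *)
Let t k := 'C(N, k) * (m ^ k * (N - m) ^ (N - k)).

Let t_step k : k < N -> k.+1 * (N - m) * t k.+1 = (N - k) * m * t k.
Proof.
move=> lt_kN; rewrite /t.
have -> : (N - m) ^ (N - k) = (N - m) * (N - m) ^ (N - k.+1).
  by rewrite -expnS; congr (_ ^ _); lia.
rewrite expnS.
have := mul_bin_left N k; set C1 := 'C(_, _); set C0 := 'C(_, _) => E.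
transitivity (k.+1 * C1 * ((N - m) * (m * m ^ k * (N - m) ^ (N - k.+1)))).
  by lia.
by rewrite E; lia.
Qed.

Let t_up k : k < m -> t k <= t k.+1.
Proof.
move=> lt_km; have lt_kN : k < N by lia.
have pos : 0 < k.+1 * (N - m) by rewrite muln_gt0; lia.
by rewrite -(leq_pmul2l pos) t_step // leq_mul2r; apply/orP; right; nia.
Qed.

Let t_down k : m <= k -> k < N -> t k.+1 <= t k.
Proof.
move=> le_mk lt_kN; have pos : 0 < k.+1 * (N - m) by rewrite muln_gt0; lia.
by rewrite -(leq_pmul2l pos) t_step // leq_mul2r; apply/orP; right; nia.
Qed.

Let t_max k : k <= N -> t k <= t m.
Proof.
move=> le_kN; have [le_km|/ltnW le_mk] := leqP k m.
  rewrite -(subKn le_km); elim: (m - k) (leq_subr k m) => [|i IH] lei.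
    by rewrite subn0.
  apply: leq_trans (IH _); last by lia.
  by rewrite (_ : m - i = (m - i.+1).+1) ?t_up; lia.
rewrite -(subnKC le_mk) in le_kN *; elim: (k - m) le_kN => [|i IH] le_iN.
  by rewrite addn0.
by apply: leq_trans (IH _); rewrite ?addnS ?t_down //; lia.
Qed.

Let expN : N ^ N = \sum_(k < N.+1) t k.
Proof.
rewrite -{1}(subnK (ltnW ltmN)) expnDn; apply: eq_bigr => k _.
by rewrite /t [m ^ k * _]mulnC.
Qed.

Lemma bin_type_le : 'C(N, m) * (m ^ m * (N - m) ^ (N - m)) <= N ^ N.
Proof.
have lt_m : m < N.+1 by lia.
by rewrite expN (bigD1 (Ordinal lt_m)) //= leq_addr.
Qed.

(** The number of successes that has the largest probability among N trials of
    success rate m/N is m, so that it has probability at least 1/(N+1). *)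
Lemma bin_type_ge : N ^ N <= N.+1 * ('C(N, m) * (m ^ m * (N - m) ^ (N - m))).
Proof.
rewrite expN; apply: (@leq_trans (\sum_(k < N.+1) t m)).
  by apply: leq_sum => k _; rewrite t_max // -ltnS.
by rewrite sum_nat_const card_ord.
Qed.

End TypeClass.

(** * Cutting an increasing list into groups *)

Lemma sorted_ltn_rcons us u :
  sorted ltn (rcons us u) = all (ltn^~ u) us && sorted ltn us.
Proof. by rewrite !(sorted_pairwise ltn_trans) pairwise_rcons. Qed.

Section Groups.

Variables L M : nat.

Definition width (g : seq nat) : nat := (head 0 g - last 0 g).+1.

(** A group is listed in decreasing order: its head is its greatest element. *)
Definition fits (g : seq nat) (u : nat) : bool :=
  (width (u :: g) <= L) && ('C(width (u :: g), (size g).+1) <= M).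

(** The state consists of the closed groups, the latest one first, and of the
    group under construction, which is empty only before the first element. *)
Definition place (st : seq (seq nat) * seq nat) (u : nat) :=
  if (st.2 == [::]) || fits st.2 u then (st.1, u :: st.2)
  else (st.2 :: st.1, [:: u]).

Definition cut (us : seq nat) := foldl place ([::], [::]) us.

Definition groups (us : seq nat) := (cut us).2 :: (cut us).1.

Lemma cut_rcons us u : cut (rcons us u) = place (cut us) u.
Proof. by rewrite /cut foldl_rcons. Qed.

Lemma flatten_groups us : flatten (groups us) = rev us.
Proof.
elim/last_ind: us => [|us u IH] //.
rewrite rev_rcons -IH /groups cut_rcons /place.
by case: (cut us) => cl g /=; case: ifP.
Qed.

Lemma closed_groups_neq0 us : [::] \notin (cut us).1.
Proof.
elim/last_ind: us => [|us u IH] //; rewrite cut_rcons /place.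
case: eqP => //= g0; case: fits => //=; rewrite inE negb_or eq_sym IH.
by apply/andP; split => //; apply/eqP.
Qed.

(** The groups of one list are pairwise different: they are disjoint, and only
    the last one can be empty. *)
Lemma uniq_groups us : uniq us -> uniq (groups us).
Proof.
rewrite -rev_uniq -flatten_groups /groups => U.
have : all (fun g => g != [::]) (cut us).1.
  by apply/allP => g gP; apply: contraNneq (closed_groups_neq0 us) => <-.
have cat_uniq_flat (s : seq (seq nat)) :
  all (fun g => g != [::]) s -> uniq (flatten s) -> uniq s.
  elim: s => [|g s IH] //= /andP[g0 s0]; rewrite cat_uniq.
  case/and3P=> _ /hasPn dis Us; rewrite IH // andbT.
  apply/negP => gs; case: g g0 gs dis => // x g _ gs dis.
  have xs : x \in flatten s by apply/flattenP; exists (x :: g); rewrite ?mem_head.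
  by case/negP: (dis x xs); exact: mem_head.
move=> a0 /=; move: U => /=; rewrite cat_uniq => /and3P[_ /hasPn dis Us].
rewrite cat_uniq_flat // andbT; apply/negP => gs.
case: (cut us).2 gs dis => [|x g] gs dis.
  by have := closed_groups_neq0 us; rewrite gs.
have xs : x \in flatten (cut us).1.
  by apply/flattenP; exists (x :: g); rewrite ?mem_head.
by case/negP: (dis x xs); exact: mem_head.
Qed.

(** The second condition says that few sets have the width and the size of g
    and the same smallest element. *)
Definition admissible (g : seq nat) : bool :=
  [&& sorted gtn g, width g <= L & 'C(width g, size g) <= M].

Lemma groups_admissible us g : 0 < L -> 0 < M ->
  sorted ltn us -> g \in groups us -> g != [::] -> admissible g.
Proof.
move=> L0 M0.
elim/last_ind: us g => [|us u IH] g; first by rewrite inE => _ /eqP->.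
move=> sus; have sus' : sorted ltn us.
  by move: sus; rewrite sorted_ltn_rcons => /andP[].
have := flatten_groups us.
rewrite /groups cut_rcons /place.
have := IH _ sus'; rewrite /groups.
case: (cut us) => cl h /= {}IH fl.
have lt_u : all (ltn^~ u) us.
  by move: sus; rewrite sorted_ltn_rcons => /andP[].
have adm1 : admissible [:: u].
  by rewrite /admissible /= /width /= subnn bin1 L0 M0.
case: ifP => [/orP[/eqP h0|fit]|_]; rewrite !inE /=.
- subst h; case/orP=> [/eqP-> _|gcl g0] //.
  by apply: IH => //; rewrite inE gcl orbT.
- case/orP=> [/eqP-> _|gcl g0]; last by apply: IH => //; rewrite inE gcl orbT.
  case: (h =P [::]) => [->|/eqP h0] //.
  have := IH h (mem_head _ _) h0 => /and3P[sh _ _].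
  move: fit; rewrite /fits /admissible /= => /andP[-> ->]; rewrite !andbT.
  case: h {IH} h0 sh fl => [|x h] //= _ -> fl; rewrite andbT.
  by apply: (allP lt_u); rewrite -mem_rev -fl mem_head.
- case/orP=> [/eqP-> _|gcl g0] //.
  by apply: IH => //; rewrite inE.
Qed.

(** When the group starting at p is closed by the element u, either u - p >= L,
    or the number of ways to choose the elements of the group among the
    integers of [p, u) is at least M / L.  The coefficients multiply into a
    single binomial coefficient by Vandermonde. *)
Lemma closed_groups_count us v : 0 < M -> sorted ltn us -> all (ltn^~ v) us ->
  exists a b, [/\ size (cut us).1 = a + b, a * L <= v
    & M ^ b <= L ^ b * 'C(v, size us)].
Proof.
move=> M0 sus lt_v.
(* p is the smallest element of the current group, so that the closed groups
   are subsets of [0, p), and the sizes of the intervals that they use add up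
   to at most p. *)
suff: exists a b, let p := last 0 (cut us).2 in
  let k := size (flatten (cut us).1) in
  [/\ size (cut us).1 = a + b, a * L <= p, p <= v, k <= p
    & M ^ b <= L ^ b * 'C(p, k)] /\ size (cut us).2 <= v - p.
  case=> a [b [[sz aL pv kp Mb] le2]]; exists a, b; split => //.
    exact: leq_trans aL pv.
  apply: leq_trans Mb _; rewrite leq_mul2l; apply/orP; right.
  have -> : size us = size (flatten (cut us).1) + size (cut us).2.
    by rewrite -(size_rev us) -flatten_groups /= size_cat addnC.
  rewrite -{1}(subnKC pv); apply: leq_trans (leq_mul_bin _ _ _ _).
  by rewrite leq_pmulr // bin_gt0.
elim/last_ind: us v sus lt_v => [|us u IH] v sus lt_v.
  by exists 0, 0; rewrite /= !mul0n !expn0 bin0; split.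
have sus' : sorted ltn us.
  by move: sus; rewrite sorted_ltn_rcons => /andP[].
have lt_uv : u < v by apply: (allP lt_v); rewrite mem_rcons mem_head.
have lt_u : all (ltn^~ u) us.
  by move: sus; rewrite sorted_ltn_rcons => /andP[].
have [a [b]] := IH u sus' lt_u; rewrite cut_rcons /place.
have := flatten_groups us; rewrite /groups.
case: (cut us) => cl h /= fl [[sz aL pu kp Mb] le2].
case: eqP => [h0|h0] /=.
  subst h; move: aL kp Mb fl => /=; rewrite !leqn0 => /eqP aL /eqP kp Mb fl.
  exists a, b; split; last by rewrite subn_gt0.
  move: Mb; rewrite kp !bin0 sz aL.
  by move=> ?; split => //; exact: ltnW.
case: ifP => [fit|/negbT] /=.
  have -> : last u h = last 0 h by case: (h) h0.
  by exists a, b; split; [split => //; lia | lia].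
rewrite /fits negb_and -!ltnNge /width /=.
set p := last 0 h in aL pu kp Mb le2 *.
have -> : last u h = p by rewrite /p; case: (h) h0.
have binS : 'C(p, size (flatten cl)) * 'C(u - p, size h)
   <= 'C(u, size (flatten cl) + size h).
  by rewrite -{2}(subnKC pu); exact: leq_mul_bin.
rewrite size_cat [size h + _]addnC.
have [big|small] /= := ltnP L (u - p).+1.
  move=> _; exists a.+1, b; split; last by lia.
  split => //; [lia|lia|lia|lia|].
  apply: leq_trans Mb _; rewrite leq_mul2l; apply/orP; right.
  by apply: leq_trans binS; rewrite leq_pmulr // bin_gt0.
move=> lt_M; exists a, b.+1; split; last by lia.
split => //; [lia|lia|lia|lia|].
(* C(l, k + 1) <= l C(l - 1, k), where l <= L is the width that u would give to
   the group; this moves the count to the interval [p, u), which is disjoint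
   from the following groups *)
have ltML : M <= L * 'C(u - p, size h).
  apply: (@leq_trans ((u - p).+1 * 'C(u - p, size h))).
    by rewrite mul_bin_diag; apply: leq_trans (ltnW lt_M) _; rewrite leq_pmull.
  by rewrite leq_mul2r small orbT.
apply: (@leq_trans (L ^ b * 'C(p, size (flatten cl)) * (L * 'C(u - p, size h)))).
  by rewrite expnSr leq_mul.
by rewrite expnSr -!mulnA leq_mul2l mulnCA leq_mul2l binS !orbT.
Qed.

Fixpoint ksubs (k : nat) (s : seq nat) : seq (seq nat) :=
  match k, s with
  | 0, _ => [:: [::]]
  | _, [::] => [::]
  | k'.+1, x :: s' => map (cons x) (ksubs k' s') ++ ksubs k s'
  end.

Lemma size_ksubs k s : size (ksubs k s) = 'C(size s, k).
Proof.
elim: s k => [|x s IH] [|k] //=; rewrite ?bin0 ?bin0n //.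
by rewrite size_cat size_map !IH binS addnC.
Qed.

Lemma mem_ksubs g s : subseq g s -> g \in ksubs (size g) s.
Proof.
elim: s g => [|x s IH] [|y g] //=; rewrite mem_cat.
case: eqP => [->|_] sub; last by rewrite (IH (y :: g)) ?orbT.
by apply/orP; left; apply: map_f; exact: IH.
Qed.

Lemma admissible_subseq g : admissible g -> g != [::] ->
  subseq g (rev (iota (last 0 g) (width g))).
Proof.
case/and3P=> sg _ _ g0.
pose s := rev (iota (last 0 g) (width g)).
have gtr : transitive gtn by move=> a b c h1 h2; exact: ltn_trans h2 h1.
have bnd x : x \in g -> last 0 g <= x <= head 0 g.
  case: g g0 sg @s => [|y g] // _ sg _ xg /=; apply/andP; split; last first.
    move: sg xg; rewrite /= path_sortedE // => /andP[/allP al _].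
    by rewrite inE => /orP[/eqP->|/al /ltnW].
  move: sg xg; rewrite lastI (sorted_pairwise gtr) pairwise_rcons mem_rcons inE.
  by case/andP=> /allP al _ /orP[/eqP->|/al /ltnW].
suff -> : subseq g s = subseq (filter (mem g) s) s by exact: filter_subseq.
congr (subseq _ _).
apply: (irr_sorted_eq gtr) => [x|//||x]; first by rewrite /= ltnn.
  apply: (sorted_filter gtr); rewrite rev_sorted.
  exact: iota_ltn_sorted.
rewrite mem_filter mem_rev mem_iota /= /width.
have [/bnd xb|//] := boolP (x \in g).
by apply/esym; rewrite andTb; lia.
Qed.

Lemma admissible_size g : admissible g -> size g <= L.
Proof.
case: (g =P [::]) => [->|/eqP g0 adm] //.
have /size_subseq := admissible_subseq adm g0.
by rewrite size_rev size_iota; case/and3P: adm => _ + _ => /[swap]; exact: leq_trans.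
Qed.

(** A group is determined by its smallest element, its width, its size and its
    rank among the at most M sets that share these data. *)
Lemma admissible_count n (s : seq (seq nat)) : uniq s ->
  all (fun g => [&& admissible g, g != [::] & all (ltn^~ n) g]) s ->
  size s <= n * (L * (L * M)).
Proof.
move=> Us /allP adm.
pose cand f l k :=
  if 'C(l.+1, k.+1) <= M then ksubs k.+1 (rev (iota f l.+1)) else [::].
pose T := flatten [seq flatten [seq flatten [seq cand f l k | k <- iota 0 L]
   | l <- iota 0 L] | f <- iota 0 n].
have sz_flat (A : Type) (h : nat -> seq A) (b c : nat) :
    (forall i, size (h i) <= c) ->
  size (flatten [seq h i | i <- iota 0 b]) <= b * c.
  move=> hc; rewrite size_flatten /shape -map_comp sumnE big_map.
  apply: (@leq_trans (\sum_(i <- iota 0 b) c)).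
    by apply: leq_sum => i _ /=; exact: hc.
  by rewrite big_const_seq count_predT size_iota iter_addn_0 mulnC.
apply: (@leq_trans (size T)); last first.
  apply: (sz_flat) => f; apply: (sz_flat) => l; apply: (sz_flat) => k.
  by rewrite /cand; case: ifP => // le_M; rewrite size_ksubs size_rev size_iota.
apply: uniq_leq_size => // g gs.
have /and3P[ag g0 /allP ltg] := adm _ gs.
have := admissible_size ag; have := admissible_subseq ag g0.
case/and3P: (ag) => _ wL CM sub szL.
have lastg : last 0 g \in g by case: (g) g0 => // x h _; exact: mem_last.
have sg : size g = (size g).-1.+1 by case: (g) g0.
apply/flattenP; exists (flatten [seq flatten [seq cand (last 0 g) l k
  | k <- iota 0 L] | l <- iota 0 L]).
  by apply/mapP; exists (last 0 g) => //; rewrite mem_iota; exact: ltg.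
apply/flattenP; exists (flatten [seq cand (last 0 g) (width g).-1 k | k <- iota 0 L]).
  by apply/mapP; exists (width g).-1 => //; rewrite mem_iota.
apply/flattenP; exists (cand (last 0 g) (width g).-1 (size g).-1).
  by apply/mapP; exists (size g).-1 => //; rewrite mem_iota /= add0n -sg.
rewrite /cand -sg (_ : (width g).-1.+1 = width g) // CM.
exact: mem_ksubs.
Qed.

End Groups.

(** * Graphs and their biclique partitions *)

Section Graph.

Variables (n : nat) (G : sgraph n).

Lemma edge2P e : e \in edges G -> exists x y, x != y /\ e = [set x; y].
Proof.
move=> eG; have /fintype.forall_inP/(_ e eG)/cards2P[x [y [nxy ->]]] := edges_card2 G.
by exists x, y.
Qed.

Lemma eq_set2_lt (x y u v : 'I_n) : x < y -> u < v ->
  [set x; y] = [set u; v] -> x = u /\ y = v.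
Proof.
move=> xy uv E.
have := set21 x y; rewrite E !inE => /orP[]/eqP xE; last first.
  have := set22 x y; rewrite E !inE => /orP[]/eqP yE; subst.
    by have := ltn_trans xy uv; rewrite ltnn.
  by move: xy; rewrite ltnn.
have := set22 x y; rewrite E !inE => /orP[]/eqP yE; subst => //.
by move: xy; rewrite ltnn.
Qed.

(** Each edge is listed at its greater end only. *)
Definition nbrs (v : 'I_n) : seq nat :=
  [seq val u | u : 'I_n <- enum 'I_n & (u < v) && ([set u; v] \in edges G)].

Lemma nbrs_sorted v : sorted ltn (nbrs v).
Proof.
apply: (@subseq_sorted _ _ ltn_trans _ (iota 0 n)); last exact: iota_ltn_sorted.
by rewrite -val_enum_ord; apply: map_subseq; exact: filter_subseq.
Qed.

Lemma mem_nbrs (u v : 'I_n) :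
  (val u \in nbrs v) = (u < v) && ([set u; v] \in edges G).
Proof.
rewrite mem_map; last exact: val_inj.
by rewrite mem_filter mem_enum andbT.
Qed.

Lemma nbrs_lt v x : x \in nbrs v -> x < v.
Proof. by case/mapP=> u; rewrite mem_filter => /andP[/andP[uv _] _] ->. Qed.

Let Q := [set p : 'I_n * 'I_n | (p.1 < p.2) && ([set p.1; p.2] \in edges G)].

Let card_Q : #|edges G| = #|Q|.
Proof.
have -> : edges G = [set [set p.1; p.2] | p in Q].
  apply/setP => e; apply/idP/imsetP => [eG|[[x y]]]; last first.
    by rewrite inE => /andP[_ ?] ->.
  have [x [y [nxy De]]] := edge2P eG.
  have := nxy; rewrite -val_eqE neq_ltn => /orP[lt|lt].
    by exists (x, y) => //; rewrite inE /= lt -De.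
  by exists (y, x); rewrite ?inE /= ?lt setUC -?De.
rewrite card_in_imset // => -[x y] [u v]; rewrite !inE /=.
by move=> /andP[xy _] /andP[uv _] /(eq_set2_lt xy uv)[-> ->].
Qed.

Lemma sum_size_nbrs : \sum_v size (nbrs v) = #|edges G|.
Proof.
rewrite card_Q -sum1_card (eq_bigr (fun v : 'I_n => \sum_(u : 'I_n | (u, v) \in Q) 1)).
  rewrite pair_big_dep /= (reindex (fun p : 'I_n * 'I_n => (p.2, p.1))) /=.
    by apply: eq_bigl => -[x y].
  by exists (fun p => (p.2, p.1)) => -[].
move=> v _; rewrite size_map -sum1_size big_filter big_enum_cond /=.
by apply: eq_bigl => u; rewrite inE.
Qed.

Lemma sum_val_ord : \sum_(v < n) v = 'C(n, 2).
Proof. by rewrite -bin2_sum big_mkord. Qed.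

Lemma card_bedges (b : sides n) : [disjoint b.1 & b.2] ->
  #|bedges b| = #|b.1| * #|b.2|.
Proof.
move=> dis; rewrite /bedges curry_imset2X card_in_imset ?cardsX //.
move=> [x y] [u v]; rewrite !inE /= => /andP[xb yb] /andP[ub vb] E.
have nmem z : z \in b.1 -> z \in b.2 -> False.
  by move=> z1 z2; have := disjointFr dis z1; rewrite z2.
have : x \in [set u; v] by rewrite -E set21.
rewrite !inE => /orP[]/eqP xE; last by case: (nmem x) => //; rewrite xE.
have : y \in [set u; v] by rewrite -E set22.
rewrite !inE => /orP[]/eqP yE; first by case: (nmem y) => //; rewrite yE.
by rewrite xE yE.
Qed.

(** Two nonempty sides of sizes a and b satisfy a + b <= 2 a b. *)
Lemma weight_le P : biclique_partition G P -> weight P <= 2 * #|edges G|.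
Proof.
case/andP=> /allP bcl /fintype.forall_inP cnt.
have -> : #|edges G| = \sum_(b <- P) #|bedges b|.
  transitivity (\sum_(e in edges G) \sum_(b <- P) (e \in bedges b)).
    rewrite -sum1_card; apply: eq_bigr => e eG.
    by have /eqP := cnt e eG; rewrite -sum1_count big_mkcond /= => <-.
  rewrite exchange_big /=; apply: eq_big_seq => b bP.
  have /and4P[_ _ _ sub] := bcl b bP.
  rewrite -sum1_card (big_setID (bedges b)) /= (setIidPr sub).
  rewrite [X in _ + X]big1 ?addn0; last by move=> e; rewrite inE => /andP[/negPf->].
  by apply: eq_bigr => e ->.
rewrite /weight big_distrr /= big_seq [X in _ <= X]big_seq.
apply: leq_sum => b bP; have /and4P[b1 b2 dis _] := bcl b bP.
rewrite card_bedges //; apply: leq_trans (leq_card_setU _ _) _.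
by move: b1 b2; rewrite -!card_gt0; nia.
Qed.

Definition ords (g : seq nat) : seq 'I_n := pmap insub g.

Lemma val_ords g : all (ltn^~ n) g -> map val (ords g) = g.
Proof.
elim: g => [|x g IH] //= /andP[ltx ltg]; rewrite /ords /= /oapp.
by rewrite insubT /= IH.
Qed.

Lemma mem_ords g x : (x \in ords g) = (val x \in g).
Proof. by rewrite mem_pmap_sub. Qed.

Lemma uniq_ords g : uniq g -> uniq (ords g).
Proof. exact: pmap_sub_uniq. Qed.

(** The list keys contains all the groups of the vertices, possibly among other
    sets, and rows g lists the vertices that have the group g. *)
Section Family.

Variables (L M : nat) (keys : seq (seq nat)) (rows : seq nat -> seq nat).
Hypotheses (L_gt0 : 0 < L) (M_gt0 : 0 < M).
Hypothesis keys_uniq : uniq keys.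
Hypothesis keys_groups :
  forall v g, g \in groups L M (nbrs v) -> g \in keys.
Hypothesis rows_uniq : forall g, g \in keys -> uniq (rows g).
Hypothesis mem_rows : forall g x, g \in keys ->
  reflect (exists2 v : 'I_n, x = v :> nat & g \in groups L M (nbrs v)) (x \in rows g).

Definition used := [seq g <- keys | (g != [::]) && (rows g != [::])].

(** A group is joined to all the vertices which have it among the groups of
    their smaller neighbours. *)
Definition blist : side_lists n := [seq (ords g, ords (rows g)) | g <- used].

Let mem_group v g x : g \in groups L M (nbrs v) -> x \in g -> x \in nbrs v.
Proof.
move=> gv xg; rewrite -mem_rev -(flatten_groups L M).
by apply/flattenP; exists g.
Qed.

Let usedP g : g \in used ->
  [/\ g \in keys, g != [::] & exists v, g \in groups L M (nbrs v)].
Proof.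
rewrite mem_filter => /andP[/andP[g0 r0] gk]; split => //.
case rE : (rows g) r0 => [|x s] // _.
have /(mem_rows _ gk)[v _ gv] : x \in rows g by rewrite rE mem_head.
by exists v.
Qed.

Lemma used_uniq g : g \in used -> uniq g.
Proof.
case/usedP=> _ _ [v gv].
have : uniq (flatten (groups L M (nbrs v))).
  by rewrite flatten_groups rev_uniq (sorted_uniq ltn_trans ltnn) ?nbrs_sorted.
elim: (groups L M (nbrs v)) gv => [|h s IH] //; rewrite inE /= cat_uniq.
by case/orP=> [/eqP->|gs] /and3P[] // _ _; exact: IH.
Qed.

Lemma used_lt g : g \in used -> all (ltn^~ n) g.
Proof.
case/usedP=> _ _ [v gv]; apply/allP => x /(mem_group gv)/nbrs_lt lt.
exact: ltn_trans lt (ltn_ord v).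
Qed.

Lemma rows_lt g : g \in keys -> all (ltn^~ n) (rows g).
Proof. by move=> gk; apply/allP => x /(mem_rows _ gk)[v -> _] /=. Qed.

Let used_sub g : g \in used -> g \in keys. Proof. by case/usedP. Qed.

Lemma blist_uniq_sides : uniq_sides blist.
Proof.
apply/allP => b /mapP[g gu ->] /=.
by rewrite (uniq_ords (used_uniq gu)) uniq_ords //; apply/rows_uniq/used_sub.
Qed.

Let side (g : seq nat) : sides n := ([set x in ords g], [set y in ords (rows g)]).

Let decode_blist : decode blist = map side used.
Proof. by rewrite /decode /blist -map_comp. Qed.

Let side_disjoint g : g \in used -> [disjoint (side g).1 & (side g).2].
Proof.
move=> gu; have gk := used_sub gu; rewrite disjoint_subset; apply/fintype.subsetP => x.
rewrite !inE !mem_ords => xg; apply/negP => /(mem_rows _ gk)[v /val_inj<- gv].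
by have := nbrs_lt (mem_group gv xg); rewrite ltnn.
Qed.

Let side_edge g e : g \in keys ->
  reflect (exists u v : 'I_n, [/\ val u \in g, g \in groups L M (nbrs v)
    & e = [set u; v]]) (e \in bedges (side g)).
Proof.
move=> gk; apply: (iffP imset2P) => [[u v]|[u [v [ug gv ->]]]].
  rewrite !inE !mem_ords => ug /(mem_rows _ gk)[w /val_inj -> gw] ->.
  by exists u, w.
exists u v => //; rewrite !inE !mem_ords //.
by apply/(mem_rows _ gk); exists v.
Qed.

(** The edge with ends u < v belongs only to the biclique of the group of v that
    contains u. *)
Lemma blist_partition : biclique_partition G (decode blist).
Proof.
rewrite decode_blist; apply/andP; split.
  apply/allP => b /mapP[g gu ->]; have gk := used_sub gu; apply/and4P; split.
  - have [_ g0 _] := usedP gu.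
    have hg : head 0 g \in g by case: (g) g0 => //= *; exact: mem_head.
    have lt_n := allP (used_lt gu) _ hg.
    by apply/set0Pn; exists (Ordinal lt_n); rewrite /side /= inE mem_ords.
  - have [_ _ [v gv]] := usedP gu.
    apply/set0Pn; exists v; rewrite /side /= inE mem_ords.
    by apply/(mem_rows _ gk); exists v.
  - exact: side_disjoint.
  - apply/fintype.subsetP => e /(side_edge _ gk)[u [v [ug gv ->]]].
    by have := mem_group gv ug; rewrite mem_nbrs => /andP[].
apply/fintype.forall_inP => e eG; rewrite count_map.
have [x [y [nxy De]]] := edge2P eG.
wlog lt_xy : x y nxy De / x < y => [W|].
  have := nxy; rewrite -val_eqE neq_ltn => /orP[|lt_yx]; first exact: W.
  by apply: (W y x) => //; rewrite 1?eq_sym // setUC.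
have : val x \in nbrs y by rewrite mem_nbrs lt_xy -De.
rewrite -mem_rev -(flatten_groups L M) => /flattenP[g gy xg].
have gk := keys_groups gy.
have gu : g \in used.
  rewrite mem_filter gk andbT; apply/andP; split; first by case: (g) xg.
  have: val y \in rows g by apply/(mem_rows _ gk); exists y.
  by case: (rows g).
rewrite -(eq_in_count (a1 := pred1 g)); last first.
  move=> h hu /=; have hk := used_sub hu; apply/eqP/(side_edge _ hk) => [->|].
    by exists x, y.
  case=> u [v [uh hv]]; rewrite De => E.
  have uv := nbrs_lt (mem_group hv uh).
  have [xu yv] := eq_set2_lt lt_xy uv E; subst u v.
  have : uniq (flatten (groups L M (nbrs y))).
    by rewrite flatten_groups rev_uniq (sorted_uniq ltn_trans ltnn) ?nbrs_sorted.
  elim: (groups L M (nbrs y)) gy hv => [|k s IH] //=.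
  rewrite !inE cat_uniq => /orP[/eqP gE|gs] /orP[/eqP hE|hs] /and3P[_ dis us].
  - by rewrite gE hE.
  - case/hasP: dis; exists (val x); last by rewrite -gE.
    by apply/flattenP; exists h.
  - case/hasP: dis; exists (val x); last by rewrite -hE.
    by apply/flattenP; exists g.
  - exact: IH.
by rewrite count_uniq_mem ?filter_uniq // gu.
Qed.

Lemma weight_blist :
  weight (decode blist) = \sum_(g <- used) (size g + size (rows g)).
Proof.
rewrite decode_blist /weight big_map; apply: eq_big_seq => g gu.
have gk := used_sub gu.
rewrite /bverts cardsU; have /eqP -> : (side g).1 :&: (side g).2 == set0.
  by rewrite setI_eq0 side_disjoint.
rewrite cards0 subn0 !cardsE; congr (_ + _).
  by rewrite (card_uniqP _) ?uniq_ords ?used_uniq // -{2}(val_ords (used_lt gu)) size_map.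
by rewrite (card_uniqP _) ?uniq_ords ?rows_uniq // -{2}(val_ords (rows_lt gk)) size_map.
Qed.

Let size_rows g : g \in keys ->
  size (rows g) = \sum_(v < n) (g \in groups L M (nbrs v)).
Proof.
move=> gk.
transitivity (size [seq val v | v : 'I_n <- enum 'I_n & g \in groups L M (nbrs v)]).
  apply/perm_size/uniq_perm => [||x].
  - exact: rows_uniq.
  - by rewrite (map_inj_uniq val_inj) filter_uniq ?enum_uniq.
  apply/(mem_rows _ gk)/mapP => [[v -> gv]|[v]].
    by exists v => //; rewrite mem_filter gv mem_enum.
  by rewrite mem_filter => /andP[gv _] ->; exists v.
rewrite size_map size_filter -sum1_count big_enum_cond /= big_mkcond /=.
by apply: eq_bigr => v _; case: (_ \in _).
Qed.

(** The second sides have one element for each group of each vertex: those are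
    counted by [closed_groups_count], where the products of the binomial
    coefficients of the vertices v < n merge into C(C(n, 2), m).  The first sides
    have at most L elements, and [admissible_count] bounds their number. *)
Lemma weight_bound : exists a b : nat,
  [/\ weight (decode blist) <= n + (a + b) + L * (n * (L * (L * M))),
      a * L <= 'C(n, 2) & M ^ b <= L ^ b * 'C('C(n, 2), #|edges G|)].
Proof.
have lt_nbrs (v : 'I_n) : all (ltn^~ v) (nbrs v) by apply/allP => x /nbrs_lt.
have [a [b [sab aN Mb]]] : exists a b : nat,
    [/\ \sum_v size (cut L M (nbrs v)).1 = a + b, a * L <= 'C(n, 2)
      & M ^ b <= L ^ b * 'C('C(n, 2), #|edges G|)].
  rewrite -sum_val_ord -sum_size_nbrs.
  elim: (index_enum _) => [|v s [a [b [IH1 IH2 IH3]]]].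
    by exists 0, 0; rewrite !big_nil bin0.
  have [a' [b' [H1 H2 H3]]] := closed_groups_count L M_gt0 (nbrs_sorted v) (lt_nbrs v).
  exists (a' + a), (b' + b); rewrite !big_cons H1 IH1.
  split; [by rewrite addnACA|by rewrite mulnDl leq_add|].
  apply: leq_trans (leq_mul (leqnn _) (leq_mul_bin _ _ _ _)).
  rewrite !expnD; apply: leq_trans (leq_mul H3 IH3) _.
  by rewrite mulnACA.
exists a, b; split => //; rewrite weight_blist big_split /= addnC.
have used_U : uniq used by exact: filter_uniq.
apply: leq_add; last first.
  apply: (@leq_trans (\sum_(g <- used) L)).
    rewrite [X in X <= _]big_seq [X in _ <= X]big_seq; apply: leq_sum => g gu.
    have [_ g0 [v gv]] := usedP gu.
    exact: admissible_size (groups_admissible L_gt0 M_gt0 (nbrs_sorted v) gv g0).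
  rewrite big_const_seq count_predT iter_addn_0 leq_mul2l; apply/orP; right.
  apply: admissible_count => //; apply/allP => g gu.
  have [_ g0 [v gv]] := usedP gu.
  rewrite (groups_admissible L_gt0 M_gt0 (nbrs_sorted v) gv g0) g0.
  exact: used_lt.
rewrite (eq_big_seq (fun g => \sum_(v < n) (g \in groups L M (nbrs v)))); last first.
  by move=> g /used_sub; exact: size_rows.
rewrite exchange_big /= -sab -[X in X + _](card_ord n) -sum1_card -big_split /=.
apply: leq_sum => v _.
have -> : \sum_(g <- used) (g \in groups L M (nbrs v)) =
    size [seq g <- used | g \in groups L M (nbrs v)].
  by rewrite size_filter -sum1_count [RHS]big_mkcond /=; apply: eq_bigr => g _; case: (_ \in _).
rewrite add1n; apply: (@uniq_leq_size _ _ (groups L M (nbrs v))).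
  by rewrite filter_uniq.
by move=> g; rewrite mem_filter => /andP[].
Qed.

End Family.

End Graph.

(** * Few graphs have light biclique partitions *)

Section Code.

Variable n : nat.

(** A letter is a vertex with two flags: the first one distinguishes the second
    side of a biclique from its first side, the second one marks the first
    vertex of a biclique. *)
Definition letter := ('I_n * (bool * bool))%type.

(** The state consists of the first side of the current biclique and of the
    edges read so far. *)
Definition read_letter (st : {set 'I_n} * {set {set 'I_n}}) (l : letter) :=
  let: (x, (second, new)) := l in
  if new then ([set x], st.2)
  else if second then (st.1, st.2 :|: [set [set a; x] | a in st.1])
  else (x |: st.1, st.2).

Definition read_word (w : seq letter) := (foldl read_letter (set0, set0) w).2.

Definition write_sides (b : sides n) : seq letter :=
  [seq (x, (false, x == head x (enum b.1))) | x <- enum b.1]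
    ++ [seq (y, (true, false)) | y <- enum b.2].

Lemma read_write_sides st b : b.1 != set0 ->
  foldl read_letter st (write_sides b) = (b.1, st.2 :|: bedges b).
Proof.
case: b => A B /= A0; rewrite /write_sides foldl_cat /=.
have -> : foldl read_letter st
    [seq (x, (false, x == head x (enum A))) | x <- enum A] = (A, st.2).
  have [x xA] := set0Pn _ A0.
  case EA : (enum A) => [|y s]; first by have := mem_enum A x; rewrite EA xA.
  have Us : uniq (y :: s) by rewrite -EA enum_uniq.
  have -> : A = [set z in y :: s] by apply/setP => z; rewrite inE -EA mem_enum.
  rewrite /= eqxx /=; have -> : [set z in y :: s] = [set y] :|: [set z in s].
    by apply/setP => z; rewrite !inE.
  elim: s {EA} [set y] Us => [|z s IH] C /=.
    by move=> _; congr pair; apply/setP => t; rewrite !inE orbF.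
  rewrite inE negb_or eq_sym -andbA => /and4P[yz ys zs Us].
  rewrite (negPf yz) /= IH /= ?ys //; congr pair; apply/setP => t.
  by rewrite !inE; do ![case: (_ == _) | case: (_ \in _)].
rewrite /bedges /=.
have EB : B = [set z in enum B] by apply/setP => z; rewrite inE mem_enum.
rewrite [in RHS]EB; clear EB.
elim: (enum B) (st.2) => [|y s IH] E /=.
  congr pair; apply/setP => e; rewrite !inE; case: (e \in E) => //=.
  by apply/esym/imset2P => -[x z _]; rewrite inE.
rewrite IH; congr pair; rewrite -setUA; congr (_ :|: _).
apply/setP => e; rewrite inE; apply/orP/imset2P.
  case=> [/imsetP[x xA ->]|/imset2P[x z xA]].
    by exists x y; rewrite ?inE ?eqxx.
  by rewrite inE => zs ->; exists x z; rewrite ?inE ?zs ?orbT.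
case=> x z xA; rewrite !inE => /orP[/eqP->|zs] ->; [left|right].
  by apply/imsetP; exists x.
by apply/imset2P; exists x z; rewrite ?inE.
Qed.

(** The word is brought to the length W by initial letters of a second side,
    which add no edge as long as the first side is empty. *)
Lemma write_partition (G : sgraph n) P W : 0 < n ->
  biclique_partition G P -> weight P <= W ->
  exists w : W.-tuple letter, read_word w = edges G.
Proof.
move=> n0 /andP[/allP bcl /fintype.forall_inP cnt] wP.
pose x0 : letter := (Ordinal n0, (true, false)).
pose w := nseq (W - weight P) x0 ++ flatten (map write_sides P).
have size_w : size w == W.
  rewrite size_cat size_nseq size_flatten /shape -map_comp sumnE big_map.
  rewrite (eq_big_seq (fun b => #|bverts b|)) ?subnK // => b bP /=.
  have /and4P[_ _ dis _] := bcl b bP.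
  rewrite size_cat !size_map -!cardE /bverts cardsU.
  by move: dis; rewrite -setI_eq0 => /eqP->; rewrite cards0 subn0.
exists (Tuple size_w) => /=; rewrite /read_word foldl_cat.
have -> : forall k, foldl read_letter (set0, set0) (nseq k x0) = (set0, set0).
  by elim=> //= k IH; rewrite imset0 setU0.
have rd A E : all (biclique G) P ->
    (foldl read_letter (A, E) (flatten (map write_sides P))).2 =
    E :|: \bigcup_(b <- P) bedges b.
  elim: {bcl cnt wP w size_w} P A E => [|b P IH] A E /=.
    by rewrite big_nil setU0.
  case/andP=> /and4P[b0 _ _ _] bcl.
  by rewrite foldl_cat read_write_sides // IH // big_cons setUA.
rewrite rd ?set0U; last exact/allP.
apply/setP => e; apply/idP/idP.
  rewrite bigcup_seq => /bigcupP[b bP]; have /and4P[_ _ _ /fintype.subsetP sub] := bcl b bP.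
  exact: sub.
move=> eG; have /eqP := cnt e eG; rewrite bigcup_seq => cnt1.
have : has (fun b => e \in bedges b) P by rewrite has_count cnt1.
by case/hasP=> b bP eb; apply/bigcupP; exists b.
Qed.

Lemma bpP (G : sgraph n) : exists2 P, biclique_partition G P & weight P = bp G.
Proof. by rewrite /bp; case: ex_minnP => k /boolp.asboolP. Qed.

Lemma bp_le (G : sgraph n) P : biclique_partition G P -> bp G <= weight P.
Proof.
move=> PG; rewrite /bp; case: ex_minnP => k _; apply.
by apply/boolp.asboolP; exists P.
Qed.

(** A graph can be read from any word that writes one of its biclique
    partitions, and there are (4 n)^W words. *)
Lemma bin_le_bp m W : 0 < n ->
  (forall G : sgraph n, #|edges G| = m -> bp G <= W) ->
  'C('C(n, 2), m) <= (4 * n) ^ W.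
Proof.
move=> n0 bpW; pose B := [set e : {set 'I_n} | #|e| == 2].
have cB : #|B| = 'C(n, 2) by rewrite card_draws card_ord.
rewrite -cB -cards_draws.
pose D := [set read_word (val w) | w : W.-tuple letter].
have /subset_leq_card sub : [set A : {set {set 'I_n}} | A \subset B & #|A| == m] \subset D.
  apply/fintype.subsetP => E; rewrite !inE => /andP[EB /eqP cE].
  have G2 : [forall e in E, #|e| == 2].
    by apply/fintype.forall_inP => e /(fintype.subsetP EB); rewrite inE.
  have [P PG wP] := bpP (SGraph G2).
  have lePW : weight P <= W by rewrite wP bpW.
  have [w wE] := write_partition n0 PG lePW.
  by apply/imsetP; exists w.
apply: leq_trans sub _; apply: leq_trans (leq_imset_card _ _) _.
rewrite card_tuple !card_prod card_ord !card_bool.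
by rewrite mulnC.
Qed.

End Code.

(** * A structured language over the word-RAM *)

Inductive arith := Plus | Minus | Times | Quot | Less.

Definition opcode (o : arith) : binop :=
  match o with
  | Plus => Add | Minus => Defs.Sub | Times => Mul | Quot => Div | Less => Ltn
  end.

Definition arith_val (o : arith) (x y : nat) : nat :=
  match o with
  | Plus => x + y | Minus => x - y | Times => x * y | Quot => x %/ y
  | Less => x < y
  end.

(** [Get a i j] is the entry (i, j) of the array number a. *)
Inductive expr :=
  | Num (k : nat)
  | Var (x : nat)
  | Bop (o : arith) (e1 e2 : expr)
  | Get (a : nat) (e1 e2 : expr).

Record store := Store { vr : nat -> nat; ar : nat -> nat -> nat -> nat }.

Definition setv (s : store) (x v : nat) : store :=
  Store (fun y => if y == x then v else vr s y) (ar s).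

(* The outer test makes an array other than a reduce by computation. *)
Definition upd (h : nat -> nat -> nat -> nat) (a i j v : nat) :=
  fun a' i' j' =>
    if a' == a then if (i' == i) && (j' == j) then v else h a i' j'
    else h a' i' j'.

Definition seta (s : store) (a i j v : nat) : store :=
  Store (vr s) (upd (ar s) a i j v).

Fixpoint eval (e : expr) (s : store) : nat :=
  match e with
  | Num k => k
  | Var x => vr s x
  | Bop o e1 e2 => arith_val o (eval e1 s) (eval e2 s)
  | Get a e1 e2 => ar s a (eval e1 s) (eval e2 s)
  end.

(** The variables are the registers 0, ..., 39; the register 1 holds the number
    X of rows and of columns of the arrays; the registers from 40 on are used
    to evaluate expressions. *)
Fixpoint comp (e : expr) (d : nat) : cmd :=
  match e with
  | Num k => Const d k
  | Var x => Seq (Const d 0) (Binop Add d d x)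
  | Bop o e1 e2 =>
      Seq (comp e1 d) (Seq (comp e2 d.+1) (Binop (opcode o) d d d.+1))
  | Get a e1 e2 =>
      Seq (comp e1 d) (Seq (comp e2 d.+1)
        (Seq (Const d.+2 a) (Seq (Binop Mul d.+2 d.+2 1)
        (Seq (Binop Add d.+2 d.+2 d) (Seq (Binop Mul d.+2 d.+2 1)
        (Seq (Binop Add d.+2 d.+2 d.+1) (Read d d.+2)))))))
  end.

Fixpoint cost (e : expr) : nat :=
  match e with
  | Num _ => 1
  | Var _ => 2
  | Bop _ e1 e2 => (cost e1 + cost e2).+1
  | Get _ e1 e2 => cost e1 + cost e2 + 6
  end.

Definition asg (x : nat) (e : expr) : cmd :=
  Seq (comp e 40) (Seq (Const x 0) (Binop Add x x 40)).

Definition put (a : nat) (e1 e2 e3 : expr) : cmd :=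
  Seq (comp e1 40) (Seq (comp e2 41) (Seq (comp e3 42)
    (Seq (Const 43 a) (Seq (Binop Mul 43 43 1) (Seq (Binop Add 43 43 40)
    (Seq (Binop Mul 43 43 1) (Seq (Binop Add 43 43 41) (Write 43 42)))))))).

Definition ifc (e : expr) (c1 c2 : cmd) : cmd := Seq (comp e 40) (If 40 c1 c2).

(** The bound e is evaluated again before each iteration. *)
Definition forc (x : nat) (e : expr) (c : cmd) : cmd :=
  let test := comp (Bop Less (Var x) e) 40 in
  Seq (asg x (Num 0)) (Seq test
    (While 40 (Seq c (Seq (asg x (Bop Plus (Var x) (Num 1))) test)))).

Section Semantics.

Variables w X : nat.
Hypotheses (X_ge16 : 16 <= X) (leXw : 16 * X * X <= 2 ^ w).

Definition addr (a i j : nat) : nat := (a * X + i) * X + j.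

(** Every value that occurs is smaller than X, so that neither the values nor
    the addresses are reduced modulo the size of the words. *)
Fixpoint safe (e : expr) (s : store) : Prop :=
  eval e s < X /\
  match e with
  | Num _ => True
  | Var x => x < 40
  | Bop o e1 e2 => [/\ safe e1 s, safe e2 s
                     & o = Minus -> eval e2 s <= eval e1 s]
  | Get a e1 e2 => [/\ safe e1 s, safe e2 s & a < 16]
  end.

Lemma safe_lt e s : safe e s -> eval e s < X.
Proof. by case: e => [k|x|o e1 e2|a e1 e2] []. Qed.

(** The registers from 40 on are free, and so is the memory outside the arrays. *)
Definition related (m : state) (s : store) : Prop :=
  [/\ reg m 1 = X, forall x, x < 40 -> reg m x = vr s x
    & forall a i j, a < 16 -> i < X -> j < X -> Defs.mem m (addr a i j) = ar s a i j].

Let lt_addr a i j : a < 16 -> i < X -> j < X -> addr a i j < 2 ^ w.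
Proof. by rewrite /addr => *; apply: leq_trans leXw; nia. Qed.

Let ltX_w x : x < X -> x < 2 ^ w.
Proof. by move=> ltx; apply: leq_trans leXw; nia. Qed.

Lemma addr_inj a i j a' i' j' : i < X -> j < X -> i' < X -> j' < X ->
  addr a i j = addr a' i' j' -> [/\ a = a', i = i' & j = j'].
Proof.
rewrite /addr => ltiX ltjX ltiX' ltjX' E.
have X0 : 0 < X by lia.
have Ej : j = j'.
  by have := congr1 (modn^~ X) E; rewrite /= !modnMDl !modn_small.
have E2 : a * X + i = a' * X + i'.
  by have := congr1 (divn^~ X) E; rewrite /= !divnMDl // !divn_small // !addn0.
have Ei : i = i'.
  by have := congr1 (modn^~ X) E2; rewrite /= !modnMDl !modn_small.
by have := congr1 (divn^~ X) E2; rewrite /= !divnMDl // !divn_small // !addn0.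
Qed.

Let binop_small o x y : x < X -> y < X -> arith_val o x y < X ->
  (o = Minus -> y <= x) -> binop_val w (opcode o) x y = arith_val o x y.
Proof.
move=> ltx lty ltv le_yx; have := ltX_w ltv.
case: o ltv le_yx => /= ltv le_yx; rewrite /binop_val /Defs.wrap => ltw;
  try by rewrite modn_small.
by rewrite -addnBAC ?le_yx // modnDr modn_small.
Qed.

(* The first five instructions of an access to memory leave the address in r. *)
Let exec_addr m d a i j : 40 <= d -> reg m 1 = X -> reg m d = i ->
  reg m d.+1 = j -> a < 16 -> i < X -> j < X -> forall r, r <> 1 -> r <> d ->
  r <> d.+1 -> forall c t m',
  exec w c (set_reg (set_reg (set_reg (set_reg (set_reg m r a) r (a * X)) r
    (a * X + i)) r ((a * X + i) * X)) r (addr a i j)) t m' ->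
  exec w (Seq (Const r a) (Seq (Binop Mul r r 1) (Seq (Binop Add r r d)
    (Seq (Binop Mul r r 1) (Seq (Binop Add r r d.+1) c))))) m (5 + t) m'.
Proof.
move=> d40 m1 md md1 lta lti ltj r r1 rd rd1 c t m' ex.
have E1 : Defs.wrap w a = a by rewrite /Defs.wrap modn_small // ltX_w //; lia.
have lt2 : a * X + i < 2 ^ w by apply: leq_trans leXw; nia.
have lt3 : (a * X + i) * X < 2 ^ w by apply: leq_trans leXw; nia.
have lt4 := lt_addr lta lti ltj.
move: r1 rd rd1 => /eqP/negPf r1 /eqP/negPf rd /eqP/negPf rd1.
rewrite -[5 + t]/(1 + (1 + (1 + (1 + (1 + t))))).
apply: ExecSeq (ExecConst _ _ _ _) _; rewrite E1.
apply: ExecSeq (ExecBinop _ _ _ _ _ _) _.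
apply: ExecSeq (ExecBinop _ _ _ _ _ _) _.
apply: ExecSeq (ExecBinop _ _ _ _ _ _) _.
apply: ExecSeq (ExecBinop _ _ _ _ _ _) _.
rewrite /binop_val /= !eqxx ![1 == _]eq_sym ![d == _]eq_sym ![d.+1 == _]eq_sym.
rewrite r1 rd rd1 m1 md md1 /Defs.wrap.
have -> : (a * X) %% 2 ^ w = a * X by rewrite modn_small //; lia.
by rewrite !modn_small // -?/(addr a i j).
Qed.

Lemma exec_comp e d m s : 40 <= d -> related m s -> safe e s ->
  exists m', [/\ exec w (comp e d) m (cost e) m', related m' s,
    reg m' d = eval e s, Defs.mem m' = Defs.mem m
    & forall r, r < d -> reg m' r = reg m r].
Proof.
elim: e d m => [k|x|o e1 IH1 e2 IH2|a e1 IH1 e2 IH2] d m d40 rel /=.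
- case=> ltk _; exists (set_reg m d k).
  have E : Defs.wrap w k = k by rewrite /Defs.wrap modn_small // ltX_w.
  split => //=; first by rewrite -{2}E; exact: ExecConst.
  + case: rel => m1 mv ma; split => //= [|y lty]; last rewrite -(mv y lty); case: eqP => //; lia.
  + by rewrite eqxx.
  + by move=> r ltr; case: eqP => //; lia.
- case=> ltx x40; exists (set_reg (set_reg m d 0) d (vr s x)).
  case: (rel) => m1 mv ma; split => //=.
  + rewrite -[2]/(1 + 1); apply: ExecSeq (ExecConst _ _ _ _) _.
    have -> : Defs.wrap w 0 = 0 by rewrite /Defs.wrap mod0n.
    have -> : set_reg (set_reg m d 0) d (vr s x) = set_reg (set_reg m d 0) d
        (binop_val w Add (reg (set_reg m d 0) d) (reg (set_reg m d 0) x)).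
      congr set_reg; rewrite /= eqxx; case: eqP => [|_]; first lia.
      by rewrite /binop_val /Defs.wrap modn_small mv // ltX_w.
    exact: ExecBinop.
  + by split => //= [|y lty]; [|rewrite -(mv y lty)]; case: eqP => //; lia.
  + by rewrite eqxx.
  + by move=> r ltr; case: eqP => //; lia.
- case=> ltv [safe1 safe2 le21].
  have [m1 [ex1 rel1 v1 mm1 r1]] := IH1 d m d40 rel safe1.
  have d40' : 40 <= d.+1 by lia.
  have [m2 [ex2 rel2 v2 mm2 r2]] := IH2 d.+1 m1 d40' rel1 safe2.
  exists (set_reg m2 d (arith_val o (eval e1 s) (eval e2 s))); split => /=.
  + rewrite -addnS -addn1; apply: ExecSeq ex1 _; rewrite addn1 -[(cost e2).+1]addn1.
    apply: ExecSeq ex2 _.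
    rewrite -(binop_small (safe_lt safe1) (safe_lt safe2) ltv le21).
    by rewrite -v1 -v2 -(r2 d) //; exact: ExecBinop.
  + case: rel2 => q1 qv qa; split => //= [|y lty]; [|rewrite -(qv y lty)]; case: eqP => //; lia.
  + by rewrite eqxx.
  + by rewrite mm2 mm1.
  + by move=> r ltr; case: eqP => [|_]; [lia|rewrite r2 ?r1 //; lia].
- case=> ltv [safe1 safe2 lta].
  have [m1 [ex1 rel1 v1 mm1 r1]] := IH1 d m d40 rel safe1.
  have d40' : 40 <= d.+1 by lia.
  have [m2 [ex2 rel2 v2 mm2 r2]] := IH2 d.+1 m1 d40' rel1 safe2.
  have lt1 := safe_lt safe1; have lt2 := safe_lt safe2.
  have vd : reg m2 d = eval e1 s by rewrite r2.
  case: (rel2) => q1 qv qa.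
  pose i := eval e1 s; pose j := eval e2 s.
  pose m3 := set_reg (set_reg (set_reg (set_reg (set_reg m2 d.+2 a) d.+2
    (a * X)) d.+2 (a * X + i)) d.+2 ((a * X + i) * X)) d.+2 (addr a i j).
  exists (set_reg m3 d (ar s a i j)); split => //=.
  + rewrite -addnA; apply: ExecSeq ex1 _; apply: ExecSeq ex2 _.
    rewrite -[6]/(5 + 1).
    apply: (exec_addr d40 q1 vd v2 lta lt1 lt2); try lia.
    rewrite -[set_reg (set_reg _ _ _) _ (addr _ _ _)]/m3 -(qa _ _ _ lta lt1 lt2).
    have -> : set_reg m3 d (Defs.mem m2 (addr a i j)) =
       set_reg m3 d (Defs.mem m3 (reg m3 d.+2)) by rewrite /= eqxx.
    exact: ExecRead.
  + split => //= [|y lty]; last rewrite -(qv y lty).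
      by do !(case: eqP => [|_]; first lia).
    by do !(case: eqP => [|_]; first lia).
  + by rewrite eqxx.
  + by rewrite mm2 mm1.
  + move=> r ltr; do !(case: eqP => [|_]; first lia).
    by rewrite r2 ?r1 //; lia.
Qed.

(** Timed total correctness: T bounds the number of machine steps. *)
Definition wp (c : cmd) (T : nat) (Q : store -> Prop) (s : store) : Prop :=
  forall m, related m s -> exists t m' s',
    [/\ exec w c m t m', related m' s', Q s' & t <= T].

Lemma wp_mono c T T' (Q Q' : store -> Prop) s :
  wp c T Q s -> T <= T' -> (forall s', Q s' -> Q' s') -> wp c T' Q' s.
Proof.
move=> H leT QQ m /H[t [m' [s' [ex rel q le]]]]; exists t, m', s'.
by split => //; [exact: QQ | exact: leq_trans leT].
Qed.

Lemma wp_seq c1 c2 T1 T Q s :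
  wp c1 T1 (wp c2 (T - T1) Q) s -> T1 <= T -> wp (Seq c1 c2) T Q s.
Proof.
move=> H leT m /H[t1 [m1 [s1 [ex1 rel1 q1 le1]]]].
have [t2 [m2 [s2 [ex2 rel2 q2 le2]]]] := q1 _ rel1.
by exists (t1 + t2), m2, s2; split => //; [exact: ExecSeq ex1 ex2 | lia].
Qed.

Lemma wp_skip T (Q : store -> Prop) s : 0 < T -> Q s -> wp Skip T Q s.
Proof. by move=> T0 Qs m rel; exists 1, m, s; split => //; exact: ExecSkip. Qed.

Lemma wp_asg x e T (Q : store -> Prop) s : 1 < x -> x < 40 -> safe e s ->
  cost e + 2 <= T -> Q (setv s x (eval e s)) -> wp (asg x e) T Q s.
Proof.
move=> x1 x40 sf leT Qs m rel.
have [m1 [ex1 rel1 v1 mm1 r1]] := exec_comp (leqnn 40) rel sf.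
exists (cost e + (1 + 1)), (set_reg (set_reg m1 x 0) x (eval e s)), (setv s x (eval e s)).
split => //.
- apply: ExecSeq ex1 _; apply: ExecSeq (ExecConst _ _ _ _) _.
  have -> : Defs.wrap w 0 = 0 by rewrite /Defs.wrap mod0n.
  have -> : set_reg (set_reg m1 x 0) x (eval e s) = set_reg (set_reg m1 x 0) x
      (binop_val w Add (reg (set_reg m1 x 0) x) (reg (set_reg m1 x 0) 40)).
    congr set_reg; rewrite /= eqxx; case: eqP => [|_]; first lia.
    by rewrite /binop_val /Defs.wrap modn_small v1 // ltX_w // safe_lt.
  exact: ExecBinop.
- case: rel1 => q1 qv qa; split => //=; first by case: eqP => //; lia.
  by move=> y lty; case: eqP => // _; rewrite qv.
Qed.

Lemma wp_put a e1 e2 e3 T (Q : store -> Prop) s :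
  a < 16 -> safe e1 s -> safe e2 s -> safe e3 s ->
  cost e1 + cost e2 + cost e3 + 6 <= T ->
  Q (seta s a (eval e1 s) (eval e2 s) (eval e3 s)) -> wp (put a e1 e2 e3) T Q s.
Proof.
move=> lta sf1 sf2 sf3 leT Qs m rel.
have [m1 [ex1 rel1 v1 mm1 r1]] := exec_comp (leqnn 40) rel sf1.
have [m2 [ex2 rel2 v2 mm2 r2]] := exec_comp (isT : 40 <= 41) rel1 sf2.
have [m3 [ex3 rel3 v3 mm3 r3]] := exec_comp (isT : 40 <= 42) rel2 sf3.
have lt1 := safe_lt sf1; have lt2 := safe_lt sf2.
have v1' : reg m3 40 = eval e1 s by rewrite r3 // r2.
have v2' : reg m3 41 = eval e2 s by rewrite r3.
case: (rel3) => q1 qv qa.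
set i := eval e1 s in v1' lt1 Qs *; set j := eval e2 s in v2' lt2 Qs *.
set v := eval e3 s in v3 Qs *.
pose m4 := set_reg (set_reg (set_reg (set_reg (set_reg m3 43 a) 43
    (a * X)) 43 (a * X + i)) 43 ((a * X + i) * X)) 43 (addr a i j).
exists (cost e1 + (cost e2 + (cost e3 + (5 + 1)))), (set_mem m4 (addr a i j) v),
  (seta s a i j v); split => //; last by lia.
- apply: ExecSeq ex1 _; apply: ExecSeq ex2 _; apply: ExecSeq ex3 _.
  apply: (exec_addr (leqnn 40) q1 v1' v2' lta lt1 lt2) => //.
  rewrite -[set_reg (set_reg _ _ _) _ (addr _ _ _)]/m4.
  have -> : set_mem m4 (addr a i j) v = set_mem m4 (reg m4 43) (reg m4 42).
    by rewrite -v3.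
  exact: ExecWrite.
- split => //= [y lty|a' i' j' lta' lti' ltj'].
    by do !(case: eqP => [|_]; first lia); rewrite qv.
  case: eqP => [/addr_inj[] // -> -> ->|ne]; first by rewrite /upd !eqxx.
  rewrite qa // /upd; case: ifP => // /eqP ea; case: ifP; last by rewrite ea.
  by move=> /andP[/eqP ei /eqP ej]; case: ne; rewrite ea ei ej.
Qed.

Lemma wp_asg_seq x e c T (Q : store -> Prop) s : 1 < x -> x < 40 ->
  safe e s -> cost e + 2 <= T ->
  wp c (T - (cost e + 2)) Q (setv s x (eval e s)) -> wp (Seq (asg x e) c) T Q s.
Proof. by move=> x1 x40 sf leT H; apply: wp_seq leT; exact: wp_asg. Qed.

Lemma wp_put_seq a e1 e2 e3 c T (Q : store -> Prop) s :
  a < 16 -> safe e1 s -> safe e2 s -> safe e3 s ->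
  cost e1 + cost e2 + cost e3 + 6 <= T ->
  wp c (T - (cost e1 + cost e2 + cost e3 + 6)) Q
    (seta s a (eval e1 s) (eval e2 s) (eval e3 s)) ->
  wp (Seq (put a e1 e2 e3) c) T Q s.
Proof. by move=> lta sf1 sf2 sf3 leT H; apply: wp_seq leT; exact: wp_put. Qed.

Lemma wp_if e c1 c2 T Q s : safe e s -> (cost e).+1 <= T ->
  (eval e s != 0 -> wp c1 (T - (cost e).+1) Q s) ->
  (eval e s = 0 -> wp c2 (T - (cost e).+1) Q s) -> wp (ifc e c1 c2) T Q s.
Proof.
move=> sf leT H1 H2 m rel.
have [m1 [ex1 rel1 v1 mm1 r1]] := exec_comp (leqnn 40) rel sf.
have [e0|ne0] := eqVneq (eval e s) 0.
  have [t [m2 [s2 [ex2 rel2 q2 le2]]]] := H2 e0 _ rel1.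
  exists (cost e + t.+1), m2, s2; split => //; last by lia.
  by apply: ExecSeq ex1 _; apply: ExecIfFalse ex2; rewrite v1 e0.
have [t [m2 [s2 [ex2 rel2 q2 le2]]]] := H1 ne0 _ rel1.
exists (cost e + t.+1), m2, s2; split => //; last by lia.
by apply: ExecSeq ex1 _; apply: ExecIfTrue ex2; rewrite v1.
Qed.

(** The invariant [I i] holds before the iteration number i, which takes at
    most [f i] steps. *)
Lemma wp_for x e c (n : nat) (f : nat -> nat) (I : nat -> store -> Prop)
    T (Q : store -> Prop) s :
  1 < x -> x < 40 -> n < X -> I 0 (setv s x 0) ->
  (forall i s, i <= n -> vr s x = i -> I i s -> safe e s /\ eval e s = n) ->
  (forall i s, i < n -> vr s x = i -> I i s ->
    wp c (f i) (fun s' => vr s' x = i /\ I i.+1 (setv s' x i.+1)) s) ->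
  (forall s, I n s -> Q s) ->
  \sum_(i < n) (f i + (cost e + 10)) + (cost e + 10) <= T ->
  wp (forc x e c) T Q s.
Proof.
move=> x1 x40 ltnX I0 bound step final leT.
pose test := Bop Less (Var x) e.
have test_ok i s' : i <= n -> vr s' x = i -> I i s' ->
    safe test s' /\ eval test s' = (i < n).
  move=> le_in xi Ii; have [sfe ee] := bound i s' le_in xi Ii.
  have lt1 (b : bool) : b < X by case: b; lia.
  by rewrite /= xi ee; do !split => //; rewrite ?xi //; lia.
pose body := Seq c (Seq (asg x (Bop Plus (Var x) (Num 1))) (comp test 40)).
have loop k : k <= n -> forall m s', related m s' -> vr s' x = n - k ->
   I (n - k) s' -> reg m 40 = (n - k < n) -> exists t m' s2,
   [/\ exec w (While 40 body) m t m', related m' s2, Q s2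
     & t <= \sum_(n - k <= i < n) (f i + (cost e + 10)) + 1].
  elim: k => [|k IH] lek m s' rel xk Ik m40.
    exists 1, m, s'; split; [|done| |lia].
      by apply: ExecWhileFalse; rewrite m40 subn0 ltnn.
    by apply: final; rewrite subn0 in Ik.
  have ltk : n - k.+1 < n by lia.
  have Sk : (n - k.+1).+1 = n - k by lia.
  have [t1 [m1 [s1 [ex1 rel1 [xs1 I1] le1]]]] := step _ _ ltk xk Ik _ rel.
  have sf1 : safe (Bop Plus (Var x) (Num 1)) s1.
    by rewrite /= xs1; do !split => //; lia.
  have := @wp_asg x (Bop Plus (Var x) (Num 1)) 6 (eq (setv s1 x (n - k))) s1 x1 x40 sf1 isT.
  rewrite /= xs1 addn1 Sk => /(_ erefl _ rel1)[t2 [m2 [s2 [ex2 rel2 es2 le2]]]].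
  subst s2; have xs2 : vr (setv s1 x (n - k)) x = n - k by rewrite /= eqxx.
  rewrite Sk in I1.
  have [sft et] := test_ok _ _ (leq_subr k n) xs2 I1.
  have [m3 [ex3 rel3 v3 _ _]] := exec_comp (leqnn 40) rel2 sft.
  have lek' : k <= n by lia.
  rewrite et in v3.
  have [t4 [m4 [s4 [ex4 rel4 q4 le4]]]] := IH lek' _ _ rel3 xs2 I1 v3.
  exists ((t1 + (t2 + cost test)) + t4).+1, m4, s4; split => //.
    apply: ExecWhileTrue ex4; first by rewrite m40 ltk.
    by apply: ExecSeq ex1 _; apply: ExecSeq ex2 _.
  by rewrite big_ltn // Sk /=; lia.
move=> m rel.
have sf0 : safe (Num 0) s by split => //=; lia.
have := @wp_asg x (Num 0) 3 (eq (setv s x 0)) s x1 x40 sf0 isT erefl.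
case/(_ _ rel) => t1 [m1 [s1 [ex1 rel1 es1 le1]]]; subst s1.
have xs1 : vr (setv s x 0) x = 0 by rewrite /= eqxx.
have [sft et] := test_ok _ _ (leq0n n) xs1 I0.
have [m2 [ex2 rel2 v2 _ _]] := exec_comp (leqnn 40) rel1 sft.
have := loop n (leqnn n) m2 _ rel2; rewrite subnn xs1 => /(_ erefl I0).
rewrite v2 et => /(_ erefl)[t3 [m3 [s3 [ex3 rel3 q3 le3]]]].
exists (t1 + (cost test + t3)), m3, s3; split => //.
  by apply: ExecSeq ex1 _; apply: ExecSeq ex2 _.
by move: leT le3; rewrite big_mkord /=; lia.
Qed.

End Semantics.

(** * The program *)

Declare Scope prog_scope.
Delimit Scope prog_scope with prog.

Notation "c1 ;; c2" := (Seq c1 c2)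
  (at level 90, right associativity) : prog_scope.
Notation "x <- e" := (asg x e%prog) (at level 80) : prog_scope.
Notation "# k" := (Num k) (at level 1, format "# k") : prog_scope.
Notation "$ x" := (Var x) (at level 1, format "$ x") : prog_scope.
Notation "e1 + e2" := (Bop Plus e1 e2) : prog_scope.
Notation "e1 - e2" := (Bop Minus e1 e2) : prog_scope.
Notation "e1 * e2" := (Bop Times e1 e2) : prog_scope.
Notation "e1 %/ e2" := (Bop Quot e1 e2) : prog_scope.
Notation "e1 < e2" := (Bop Less e1 e2) : prog_scope.

(* The variables are the registers from 2 on. *)
Notation xn := 2 (only parsing).     (* number of vertices *)
Notation xm := 3 (only parsing).     (* number of edges *)
Notation xN := 4 (only parsing).     (* number of pairs of vertices *)
Notation xlg := 5 (only parsing).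
Notation xpow := 6 (only parsing).
Notation xL := 7 (only parsing).
Notation xM := 8 (only parsing).
Notation xu := 9 (only parsing).
Notation xj := 10 (only parsing).
Notation xv := 11 (only parsing).
Notation xnode := 12 (only parsing).
Notation xlast := 13 (only parsing). (* last node of the trie *)
Notation xnew := 14 (only parsing).
Notation xi := 15 (only parsing).
Notation xk := 16 (only parsing).
Notation xpos := 17 (only parsing).  (* next free position of the output *)
Notation xcnt := 18 (only parsing).  (* number of bicliques written *)
Notation xr := 19 (only parsing).
Notation xid := 20 (only parsing).
Notation xoff := 21 (only parsing).
Notation xdeg := 22 (only parsing).
Notation xok := 23 (only parsing).

(* Arrays; those with one index use the column 0.  The nodes of a trie are
   numbered from the root 0 on, and stand for sets of vertices. *)
Notation aIN := 0 (only parsing).    (* the input, in the row 0 *)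
Notation aCHILD := 1 (only parsing). (* node and vertex to child, or 0 *)
Notation aPAR := 2 (only parsing).   (* node to parent *)
Notation aLAST := 3 (only parsing).  (* node to greatest element *)
Notation aDEP := 4 (only parsing).   (* node to depth *)
Notation aRC := 5 (only parsing).    (* node to number of vertices with it *)
Notation aROWS := 6 (only parsing).  (* node to list of these vertices *)
Notation aNODE := 7 (only parsing).  (* vertex to node of its current group *)
Notation aFST := 8 (only parsing).   (* node to smallest element *)
Notation aPAS := 9 (only parsing).   (* Pascal's triangle, capped at M + 1 *)
Notation aOUT := 10 (only parsing).  (* the output, in the row 0 *)

Definition load_size : cmd :=
  (Read xn 0 ;; Binop Mul 1 xn xn ;; Binop Mul 1 1 1 ;; Binop Mul 1 1 1)%prog.

Definition log_loop : cmd :=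
  (xpow <- #1 ;; xlg <- #0 ;;
   forc xi ($xn) (ifc ($xpow < $xn)
     (xpow <- $xpow * #2 ;; xlg <- $xlg + #1) Skip))%prog.

(** The difference of the first and the last address of the lists of neighbours
    is 2 m. *)
Definition set_parameters : cmd :=
  (xm <- (Get aIN #0 ($xn + #1) - Get aIN #0 #1) %/ #2 ;;
   xN <- ($xn * ($xn - #1)) %/ #2 ;;
   xL <- $xlg * $xlg * (($xN * $xN) %/ ($xm * ($xN - $xm)) + #1) ;;
   xM <- $xn %/ $xL %/ $xL %/ $xL %/ $xL ;;
   ifc ($xM) Skip (xM <- #1))%prog.

(** The binomial coefficients are only compared with M; the cap M + 1 keeps them
    small. *)
Definition pascal_row : cmd :=
  (put aPAS ($xi + #1) #0 #1 ;;
   forc xk ($xL)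
     (xr <- Get aPAS ($xi) ($xk) + Get aPAS ($xi) ($xk + #1) ;;
      ifc ($xM + #1 < $xr) (xr <- $xM + #1) Skip ;;
      put aPAS ($xi + #1) ($xk + #1) ($xr)))%prog.

Definition pascal : cmd :=
  (put aPAS #0 #0 #1 ;; forc xi ($xL) pascal_row)%prog.

Definition flush : cmd :=
  (put aROWS ($xnode) (Get aRC ($xnode) #0) ($xv) ;;
   put aRC ($xnode) #0 (Get aRC ($xnode) #0 + #1))%prog.

(** Prepares the insertion of u in the row v: xnode becomes the node of the group
    to which u is added, which is the root if u begins a new group. *)
Definition close_group : cmd :=
  (xnode <- Get aNODE ($xv) #0 ;;
   ifc ($xnode)
     (xr <- $xu - Get aFST ($xnode) #0 + #1 ;;
      xok <- #0 ;;
      ifc ($xL < $xr) Skip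
        (ifc ($xM < Get aPAS ($xr) (Get aDEP ($xnode) #0 + #1)) Skip
           (xok <- #1)) ;;
      ifc ($xok) Skip (flush ;; xnode <- #0))
     Skip)%prog.

Definition find_child : cmd :=
  (xnew <- Get aCHILD ($xnode) ($xu) ;;
   ifc ($xnew) Skip
     (xlast <- $xlast + #1 ;; xnew <- $xlast ;;
      put aCHILD ($xnode) ($xu) ($xnew) ;;
      put aPAR ($xnew) #0 ($xnode) ;;
      put aLAST ($xnew) #0 ($xu) ;;
      put aDEP ($xnew) #0 (Get aDEP ($xnode) #0 + #1) ;;
      ifc ($xnode) (put aFST ($xnew) #0 (Get aFST ($xnode) #0))
        (put aFST ($xnew) #0 ($xu))))%prog.

Definition add_edge : cmd :=
  (close_group ;; find_child ;; put aNODE ($xv) #0 ($xnew))%prog.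

(** With the smaller end in the outer loop, each row receives its elements in
    increasing order, whatever the order of the lists of neighbours. *)
Definition scan_edges : cmd :=
  (xlast <- #0 ;;
   forc xu ($xn)
     (xoff <- Get aIN #0 ($xu + #1) ;;
      xdeg <- Get aIN #0 ($xu + #2) - $xoff ;;
      forc xj ($xdeg)
        (xv <- Get aIN #0 ($xoff + $xj) ;; ifc ($xu < $xv) add_edge Skip)))%prog.

Definition flush_all : cmd :=
  (forc xv ($xn) (xnode <- Get aNODE ($xv) #0 ;; flush))%prog.

Definition emit (e : expr) : cmd :=
  (put aOUT #0 ($xpos) e ;; xpos <- $xpos + #1)%prog.

(** The first side is read from the node up to the root. *)
Definition write_biclique : cmd :=
  (xcnt <- $xcnt + #1 ;;
   emit (Get aDEP ($xid) #0) ;;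
   xnode <- $xid ;;
   forc xj (Get aDEP ($xid) #0)
     (emit (Get aLAST ($xnode) #0) ;; xnode <- Get aPAR ($xnode) #0) ;;
   emit ($xr) ;;
   forc xj ($xr) (emit (Get aROWS ($xid) ($xj))))%prog.

Definition write_output : cmd :=
  (xpos <- #1 ;; xcnt <- #0 ;;
   forc xi ($xlast)
     (xid <- $xi + #1 ;; xr <- Get aRC ($xid) #0 ;;
      ifc ($xr) write_biclique Skip) ;;
   put aOUT #0 #0 ($xcnt))%prog.

Definition main_part : cmd :=
  (log_loop ;; set_parameters ;; pascal ;; scan_edges ;; flush_all ;;
   write_output)%prog.

Definition output_address : cmd :=
  (Const 0 aOUT ;; Binop Mul 0 0 1 ;; Binop Mul 0 0 1)%prog.

(** The arrays have X rows and X columns, where X is the eighth power of n. *)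
Definition program : cmd := (load_size ;; main_part ;; output_address)%prog.

(** * The bounds on the groups and their computation *)

Ltac safe_tac :=
  rewrite /=;
  repeat match goal with
  | |- _ /\ _ => split
  | |- and3 _ _ _ => split
  | |- True => exact I
  | |- _ = _ -> _ => first [discriminate | intros _]
  end.

(* Arithmetic on the hypotheses about natural numbers only. *)
Ltac slia :=
  repeat match goal with x := _ : nat |- _ => clearbody x end;
  repeat match goal with
  | H : ?T |- _ =>
    lazymatch T with
    | is_true (leq _ _) => fail
    | @eq nat _ _ => fail
    | nat => fail
    | _ => clear H
    end
  end; lia.
Ltac do_asg := apply: wp_asg_seq; [assumption|assumption|
  by []|by []|safe_tac; try slia|by rewrite /=; slia|rewrite /=].
Ltac do_asg1 := apply: wp_asg; [assumption|assumption|
  by []|by []|safe_tac; try slia|by rewrite /=; slia|rewrite /=].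
Ltac do_put := apply: wp_put_seq; [assumption|assumption|
  by []|safe_tac; try slia|safe_tac; try slia|safe_tac; try slia
  |by rewrite /=; slia|rewrite /=].
Ltac do_put1 := apply: wp_put; [assumption|assumption|
  by []|safe_tac; try slia|safe_tac; try slia|safe_tac; try slia
  |by rewrite /=; slia|rewrite /=].
Ltac do_if := apply: wp_if; [assumption|assumption|
  safe_tac; try slia|by rewrite /=; slia|rewrite /= ?eqb0 ?negbK|rewrite /=].
Ltac do_skip := apply: wp_skip; [by rewrite /=; slia|].

Lemma lt_up_log k n : (2 ^ k < n) = (k < up_log 2 n).
Proof.
have [le|lt] := leqP (up_log 2 n) k.
  apply/negbTE; rewrite -leqNgt; apply: leq_trans (up_logP n (ltnSn 1)) _.
  by rewrite leq_exp2l.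
by rewrite ltnNge; apply: contraTN lt => le; rewrite -leqNgt up_log_min.
Qed.

(** The bound L on the width of a group is about lg^2 n / (g (1 - g)) for the
    density g, so that n^2 / L is of smaller order than the main term, and
    L = n^{o(1)}.  The bound M on the number of sets with the width and the size
    of a group is about n / L^4, so that M L^3 n <= n^2 / L, whereas
    lg M = (1 + o(1)) lg n. *)
Definition width_bound (n m : nat) : nat :=
  up_log 2 n * up_log 2 n * ('C(n, 2) * 'C(n, 2) %/ (m * ('C(n, 2) - m)) + 1).

Definition choice_bound (n m : nat) : nat :=
  maxn 1 (n %/ width_bound n m %/ width_bound n m %/ width_bound n m
            %/ width_bound n m).

Section Input.

Variables (n : nat) (A : nat -> seq nat).

Definition offset u := n.+2 + \sum_(i < u) size (A i).

Lemma offsetS u : offset u.+1 = offset u + size (A u).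
Proof. by rewrite /offset big_ord_recr addnA. Qed.

Lemma offset_n m : \sum_(u < n) size (A u) = 2 * m -> offset n = n.+2 + 2 * m.
Proof. by rewrite /offset => ->. Qed.

Lemma offset_le u v : u <= v -> offset u <= offset v.
Proof.
move=> leuv; rewrite -(subnKC leuv); elim: (v - u) => [|k IH]; first by rewrite addn0.
by rewrite addnS offsetS; lia.
Qed.

(** The list of the neighbours of u is A u. *)
Definition is_input (s : store) :=
  [/\ forall u, u <= n -> ar s aIN 0 u.+1 = offset u
    & forall u j, u < n -> j < size (A u) ->
        ar s aIN 0 (offset u + j) = nth 0 (A u) j].

End Input.

Lemma bin2E n : 'C(n, 2) = n * (n - 1) %/ 2.
Proof. by rewrite bin2 -divn2 subn1. Qed.

Lemma pairs_le n : 2 * 'C(n, 2) <= n * n.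
Proof. by rewrite bin2E; have := leq_trunc_div (n * (n - 1)) 2; nia. Qed.

Section Bounds.

Variable n : nat.
Hypothesis n_gt1 : 1 < n.

Let X := n ^ 8.

Lemma exp_lt_memory k : k <= 7 -> n ^ k < X.
Proof. by move=> lek; rewrite ltn_exp2l //; lia. Qed.

Lemma memory_bounds : [/\ 16 <= X, 8 * (n * n) + 8 * n < X & 'C(n, 2) * 'C(n, 2) < X].
Proof.
have h2 : 2 ^ 6 <= n ^ 6 by rewrite leq_exp2r.
have h3 : X = n ^ 6 * (n * n) by rewrite /X -[n * n]/(n ^ 2) -expnD.
have h4 : X = n ^ 4 * (n * n * (n * n)).
  by rewrite /X -[n * n]/(n ^ 2) -!expnD.
have h5 : 2 ^ 4 <= n ^ 4 by rewrite leq_exp2r.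
have h6 : 2 ^ 6 = 64 by [].
have h7 : 2 ^ 4 = 16 by [].
rewrite h6 in h2; rewrite h7 in h5.
have n2 : 2 * n <= n * n by nia.
have h8 : 64 * (n * n) <= X by rewrite h3 leq_mul2r h2 orbT.
split; [lia|lia|].
have : 'C(n, 2) * 'C(n, 2) <= (n * n) * (n * n) by apply: leq_mul; have := pairs_le n; lia.
have : 16 * (n * n * (n * n)) <= X by rewrite h4 leq_mul2r h5 orbT.
have : 0 < n * n * (n * n) by rewrite !muln_gt0; lia.
lia.
Qed.

Lemma up_log_le : up_log 2 n <= n.
Proof. by apply: up_log_min => //; exact: ltnW (ltn_expl n (ltnSn 1)). Qed.

Lemma up_log_gt0 : 0 < up_log 2 n.
Proof. by rewrite -lt_up_log. Qed.

Variable m : nat.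

Let L := width_bound n m.
Let M := choice_bound n m.

Lemma width_bound_gt0 : 0 < L.
Proof. by rewrite /L /width_bound addn1 !muln_gt0 up_log_gt0. Qed.

Lemma choice_bound_gt0 : 0 < M.
Proof. by rewrite leq_max. Qed.

Lemma choice_bound_le : M <= n.
Proof.
rewrite geq_max; apply/andP; split; first by lia.
by do !apply: leq_trans (leq_div _ _) _.
Qed.

Hypotheses (m_gt0 : 0 < m) (ltmN : m < 'C(n, 2)).

Lemma width_bound_le : L <= n ^ 6.
Proof.
have le1 : 'C(n, 2) * 'C(n, 2) %/ (m * ('C(n, 2) - m)) + 1 <= n ^ 4.
  apply: (@leq_trans ('C(n, 2) * 'C(n, 2) + 1)); first by rewrite leq_add2r leq_div.
  have h : n ^ 4 = n * n * (n * n) by rewrite -[n * n]/(n ^ 2) -expnD.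
  by rewrite h; move: (pairs_le n) m_gt0 ltmN; nia.
rewrite (_ : n ^ 6 = n * n * n ^ 4); last by rewrite -[n * n]/(n ^ 2) -expnD.
by apply: leq_mul le1; apply: leq_mul; exact: up_log_le.
Qed.

Lemma pairs_lt_width : 'C(n, 2) < m * L.
Proof.
have dm : 0 < m * ('C(n, 2) - m) by rewrite muln_gt0 m_gt0 subn_gt0.
have := ltn_ceil ('C(n, 2) * 'C(n, 2)) dm.
rewrite /L /width_bound addn1; set q := (_ %/ _).+1 => h.
have N_gt0 : 0 < 'C(n, 2) by exact: leq_ltn_trans ltmN.
rewrite -(ltn_pmul2r N_gt0); apply: leq_trans h _.
have q_le : q <= up_log 2 n * up_log 2 n * q by rewrite leq_pmull // muln_gt0 up_log_gt0.
apply: leq_trans (leq_mul q_le (leqnn _)) _.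
move: (up_log 2 n * up_log 2 n * q) => K.
by rewrite mulnA [K * m]mulnC leq_mul2l leq_subr orbT.
Qed.

Lemma width_bound_lt : L + 1 < X.
Proof.
have := width_bound_le; have := exp_lt_memory (leqnn 7).
have : n ^ 7 = n * n ^ 6 by rewrite expnS.
have : 0 < n ^ 6 by rewrite expn_gt0; lia.
by move: n_gt1; nia.
Qed.

End Bounds.

Section Correctness.

Variables w n m : nat.
Hypotheses (n_gt1 : 1 < n) (m_gt0 : 0 < m) (ltmN : m < 'C(n, 2)).

Let X := n ^ 8.
Hypothesis leXw : 16 * X * X <= 2 ^ w.

Let L := width_bound n m.
Let M := choice_bound n m.

Notation wp := (wp w X).

Variable A : nat -> seq nat.
Hypothesis A_sum : \sum_(u < n) size (A u) = 2 * m.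

Let X_bounds : [/\ 16 <= X, 8 * (n * n) + 8 * n < X & 'C(n, 2) * 'C(n, 2) < X].
Proof. exact: memory_bounds. Qed.

Let X_ge16 : 16 <= X. Proof. by case: X_bounds. Qed.

Let M_gt0 : 0 < M. Proof. exact: choice_bound_gt0. Qed.

Let M_le : M <= n. Proof. exact: choice_bound_le. Qed.

Let L_lt : L + 1 < X. Proof. exact: width_bound_lt. Qed.

Lemma wp_log_loop s : vr s xn = n ->
  wp log_loop (100 * n + 100)
    (fun s' => [/\ vr s' xn = n, vr s' xlg = up_log 2 n & ar s' = ar s]) s.
Proof.
move=> sn; have [X16 X2 XN] := X_bounds; rewrite /log_loop.
do_asg; do_asg.
pose I i s' := [/\ vr s' xn = n, vr s' xlg = minn i (up_log 2 n),
  vr s' xpow = 2 ^ minn i (up_log 2 n) & ar s' = ar s].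
have pow2 i : 2 ^ minn i (up_log 2 n) <= 2 * n.
  apply: (@leq_trans (2 ^ up_log 2 n)); first by rewrite leq_exp2l // geq_minr.
  case: (up_log 2 n) (up_log_gt0 n_gt1) (lt_up_log (up_log 2 n).-1 n) => // k _ /=.
  by rewrite ltnSn expnS; lia.
apply: (@wp_for _ _ X_ge16 leXw _ _ _ n (fun=> 60) I); try by []; try lia.
- by split => //=; rewrite min0n.
- by move=> i s' lei ei [s'n _ _ _]; split => //; safe_tac; lia.
- move=> i s' lti ei [s'n s'l s'p s'a].
  have p2 := pow2 i; rewrite -s'p in p2.
  do_if; rewrite s'p s'n lt_up_log gtn_min ltnn orbF.
  + case: ltnP => // lt' _.
    have mi : minn i (up_log 2 n) = i by rewrite (minn_idPl _) // ltnW.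
    have mi' : minn i.+1 (up_log 2 n) = i.+1 by rewrite (minn_idPl _).
    have := pow2 i.+1.
    rewrite /I mi' mi in s'l s'p *; rewrite expnSr -s'p => p3.
    do_asg; do_asg1.
    by rewrite s'l s'p addn1.
  + case: ltnP => // le _; do_skip.
    split => //=; split => //=; rewrite ?s'l ?s'p !(minn_idPr _) //; lia.
- by move=> s' [s'n s'l _ s'a]; rewrite (minn_idPr (up_log_le n)) in s'l.
- by rewrite sum_nat_const card_ord /=; lia.
Qed.

Lemma wp_set_parameters s : vr s xn = n -> vr s xlg = up_log 2 n -> is_input n A s ->
  wp set_parameters 200
    (fun s' => [/\ vr s' xn = n, vr s' xL = L, vr s' xM = M & ar s' = ar s]) s.
Proof.
move=> sn slg [s_off _]; have [X16 X2 XN] := X_bounds.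
have in1 : ar s aIN 0 1 = n + 2 by rewrite s_off // /offset big_ord0; lia.
have inn : ar s aIN 0 (n + 1) = n + 2 + 2 * m by rewrite addn1 s_off // (offset_n A_sum); lia.
have NE := bin2E n; have N2 := pairs_le n.
rewrite /set_parameters.
do_asg; rewrite ?sn ?in1 ?inn; try lia.
have -> : (n + 2 + 2 * m - (n + 2)) %/ 2 = m by rewrite addKn mulKn.
do_asg; rewrite ?sn -?bin2E.
have mN : m * ('C(n, 2) - m) <= 'C(n, 2) * 'C(n, 2) by apply: leq_mul; lia.
have dle := leq_div ('C(n, 2) * 'C(n, 2)) (m * ('C(n, 2) - m)).
have lgn : up_log 2 n * up_log 2 n <= n * n by apply: leq_mul; exact: up_log_le.
have Lle := L_lt; have lgn1 := up_log_le n.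
do_asg; rewrite ?slg.
- by rewrite -/(width_bound n m) -/L; lia.
- have : 'C(n, 2) * 'C(n, 2) + 1 < X; last lia.
  have := exp_lt_memory n_gt1 (isT : 4 <= 7); rewrite -[4]/(2 + 2) expnD.
  have -> : n ^ 2 = n * n by [].
  have := leq_mul (pairs_le n) (pairs_le n).
  have : 0 < 'C(n, 2) * 'C(n, 2) by rewrite muln_gt0; lia.
  by lia.
rewrite -/(width_bound n m) -/L.
have L1 : L < X by lia.
have nX : n < X by lia.
have le1 : n %/ L <= n by apply: leq_div.
have le2 : n %/ L %/ L <= n by apply: leq_trans (leq_div _ _) le1.
have le3 : n %/ L %/ L %/ L <= n by apply: leq_trans (leq_div _ _) le2.
have le4 : n %/ L %/ L %/ L %/ L <= n by apply: leq_trans (leq_div _ _) le3.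
apply: (wp_asg_seq X_ge16 leXw) => //; rewrite ?[eval _ _]/= ?sn.
  safe_tac; rewrite ?sn //.
  - exact: leq_ltn_trans le4 nX.
  - exact: leq_ltn_trans le3 nX.
  - exact: leq_ltn_trans le2 nX.
  - exact: leq_ltn_trans le1 nX.
apply: (wp_if X_ge16 leXw) => [||/= M0|/= M0].
- by safe_tac => //; exact: leq_ltn_trans le4 nX.
- by rewrite /=; clear; lia.
- apply: wp_skip; first by rewrite /=; clear; lia.
  split => //=.
  by rewrite /M /choice_bound -/L; apply/esym/maxn_idPr; rewrite lt0n.
- apply: (wp_asg X_ge16 leXw) => //=.
    by safe_tac; exact: leq_trans X_ge16.
  by split => //=; rewrite /M /choice_bound -/L M0.
Qed.

Lemma wp_pascal s : vr s xn = n -> vr s xL = L -> vr s xM = M ->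
  (forall i j, ar s aPAS i j = 0) ->
  wp pascal (200 * (L * L + 2 * L + 1))
    (fun s' => [/\ vr s' xn = n, vr s' xL = L, vr s' xM = M,
       forall l k, l <= L -> ar s' aPAS l k = minn 'C(l, k) M.+1
       & forall a, a != aPAS -> ar s' a = ar s a]) s.
Proof.
move=> sn sL sM s0; have [X16 X2 XN] := X_bounds.
have M1 := M_le; have L1 := L_lt.
have M0 := M_gt0.
rewrite /pascal; do_put.
pose base s' := [/\ vr s' xn = n, vr s' xL = L, vr s' xM = M
  & forall a, a != aPAS -> ar s' a = ar s a].
pose I i s' := [/\ base s',
  forall l k, l <= i -> ar s' aPAS l k = minn 'C(l, k) M.+1
  & forall l k, i < l -> ar s' aPAS l k = 0].
apply: (@wp_for _ _ X_ge16 leXw _ _ _ L (fun=> 100 * L + 80) I); try by []; try lia.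
- split.
  + split => //= a; rewrite /upd; case: eqP => // -> //.
  + move=> l k; rewrite leqn0 => /eqP->; case: k => [|k]; rewrite /= /upd /=.
      by rewrite bin0 (minn_idPl _).
    by rewrite s0 bin0n min0n.
  + by move=> l k l0; rewrite /= /upd /= eqn0Ngt l0 s0.
- by move=> i s' lei ei [[_ s'L _ _] _ _]; split => //; safe_tac; lia.
- move=> i s' lti ei [[s'n s'L s'M s'a] s'p s'0].
  rewrite /pascal_row; do_put.
  pose J k s2 := [/\ base s2, vr s2 xi = i,
    forall l j, l <= i -> ar s2 aPAS l j = minn 'C(l, j) M.+1,
    forall l j, i.+1 < l -> ar s2 aPAS l j = 0
    & forall j, ar s2 aPAS i.+1 j = if j <= k then minn 'C(i.+1, j) M.+1 else 0].
  apply: (@wp_for _ _ X_ge16 leXw _ _ _ L (fun=> 80) J); try by []; try lia.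
  + rewrite ei addn1; split => //=.
    * by split => //= a /negPf ane; rewrite /upd ane s'a ?ane.
    * move=> l j lei; rewrite /upd /= s'p //; case: eqP => // ?; lia.
    * move=> l j ltl; rewrite /upd /= s'0 //; last by lia.
      by case: eqP => // ?; lia.
    * move=> j; rewrite /upd /= eqxx /= leqn0; case: eqP => [->|_].
        by rewrite bin0 (minn_idPl _).
      by rewrite s'0.
  + by move=> k s2 lek ek [[_ s2L _ _] _ _ _ _]; split => //; safe_tac; lia.
  + move=> k s2 ltk ek [[s2n s2L s2M s2a] s2i s2p s20 s2r].
    have v1 : ar s2 9 i k <= M.+1 by rewrite s2p // geq_minr.
    have v2 : ar s2 9 i (k + 1) <= M.+1 by rewrite s2p // geq_minr.
    do_asg; rewrite ?s2i ?ek; try lia.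
    apply: (wp_seq X_ge16 leXw (T1 := 30)); last by rewrite /=; lia.
    have [val Ev] : exists val, val = minn (ar s2 9 i k + ar s2 9 i (k + 1)) M.+1 by eexists.
    have val_le : val <= M.+1 by rewrite Ev geq_minr.
    have fin s3 : (forall y, y != xr -> vr s3 y = vr s2 y) -> ar s3 = ar s2 ->
      vr s3 xr = val -> wp (put aPAS ($xi + #1) ($xk + #1) ($xr))%prog 25
      (fun s' => vr s' xk = k /\ J k.+1 (setv s' xk k.+1)) s3.
      move=> s3v s3a s3r.
      do_put1; rewrite ?s3r ?s3v // ?s2i ?ek; try lia.
      split => //.
      rewrite !addn1; split; rewrite ?[vr _ _]/= ?[ar _]/= ?s3a ?s3v //.
      * by split => //= [|||a /negPf ane]; rewrite ?s3v // s3a /upd ane s2a ?ane.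
      * move=> l j lei; rewrite /upd /= s2p //.
        by case: eqP => // ?; lia.
      * move=> l j lei; rewrite /upd /= s20 //.
        by case: eqP => // ?; lia.
      * move=> j; rewrite /upd /= eqxx /=; case: eqP => [->|ne].
          rewrite leqnn Ev !s2p ?addn1 // binS.
          by move: 'C(i, k) 'C(i, k.+1) M.+1 => a b c; clear; lia.
        by rewrite s2r [j <= k.+1]leq_eqVlt; move/eqP/negPf: ne => ->.
    do_if.
    * move=> big; do_asg1; apply: fin => //=.
        by move=> y /negPf->.
      by move: big; rewrite Ev s2M !addn1; case: ltnP.
    * move=> small; do_skip; apply: fin => //=.
        by move=> y /negPf->.
      by move: small; rewrite Ev s2M !addn1; case: ltnP.
  + move=> s2 [[s2n s2L s2M s2a] s2i s2p s20 s2r]; split => //; split => //=.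
      move=> l k; rewrite leq_eqVlt => /orP[/eqP->|lel]; last exact: s2p.
      rewrite s2r; case: leqP => // ltk; rewrite bin_small ?min0n //.
      exact: leq_trans ltk.
  + by rewrite sum_nat_const card_ord /=; lia.
- by move=> s' [[s'n s'L s'M s'a] s'p s'0].
- by rewrite sum_nat_const card_ord /=; nia.
Qed.

End Correctness.

(** * The trie of the groups *)

Notation arrays := (nat -> nat -> nat -> nat).

Section Trie.

Variables w X n L M : nat.
Hypotheses (X_ge16 : 16 <= X) (leXw : 16 * X * X <= 2 ^ w).
Hypotheses (n_gt0 : 0 < n) (leX : 8 * (n * n) + 8 * n < X).
Hypotheses (ltLX : L + 1 < X) (leMn : M <= n).

Notation wp := (wp w X).

Section Pure.

Variable keys : seq (seq nat).

Local Notation key := (nth [::] keys).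

(** The root is no child, so that 0 can mean that there is none. *)
Definition child_index (g : seq nat) : nat :=
  if g \in keys then index g keys else 0.

Definition node_ok (h : arrays) (i : nat) : Prop :=
  [/\ size (key i) <= i, all (ltn^~ n) (key i), h aDEP i 0 = size (key i),
      0 < i -> h aFST i 0 = last 0 (key i)
    & 0 < i -> h aPAR i 0 < i /\ key i = h aLAST i 0 :: key (h aPAR i 0)].

(** The node i of the trie stands for the group [key i]; its ancestors stand
    for the groups obtained by removing the last elements added, and the root 0
    for the empty group. *)
Definition trie (h : arrays) : Prop :=
  [/\ uniq keys, 0 < size keys /\ key 0 = [::],
      forall i u, i < size keys -> u < n ->
        h aCHILD i u = child_index (u :: key i),
      forall i u, size keys <= i -> h aCHILD i u = 0
    & forall i, i < size keys -> node_ok h i].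

Definition cursor (cur : nat -> seq nat) (h : arrays) : Prop :=
  forall v, v < n -> cur v \in keys /\ h aNODE v 0 = index (cur v) keys.

Definition lists (rows : nat -> seq nat) (h : arrays) : Prop :=
  forall i, [/\ h aRC i 0 = size (rows i),
      forall j, j < size (rows i) -> h aROWS i j = nth 0 (rows i) j,
      uniq (rows i), all (ltn^~ n) (rows i)
    & size keys <= i -> rows i = [::]].

Definition rep rows cur (s : store) : Prop :=
  [/\ trie (ar s), cursor cur (ar s), lists rows (ar s)
    & vr s xlast = (size keys).-1].

Lemma trie_closed h u g : trie h -> u :: g \in keys -> g \in keys.
Proof.
case=> _ [_ k0] _ _ ok gk; have lti : index (u :: g) keys < size keys.
  by rewrite index_mem.
have Ei := nth_index [::] gk.
have i0 : 0 < index (u :: g) keys.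
  by rewrite lt0n; apply: contra_eq_neq Ei => ->; rewrite k0.
have [_ _ _ _ /(_ i0)[ltp E]] := ok _ lti.
move: E; rewrite Ei => -[_ ->]; apply: mem_nth.
exact: ltn_trans ltp lti.
Qed.

End Pure.

Definition add_key (keys : seq (seq nat)) (g : seq nat) :=
  if g \in keys then keys else rcons keys g.

Lemma mem_add_key keys g h : (h \in add_key keys g) = (h == g) || (h \in keys).
Proof.
rewrite /add_key; case: ifP => gk; last by rewrite mem_rcons inE.
by case: eqP => // ->.
Qed.

Lemma index_rcons_mem (keys : seq (seq nat)) g h :
  h \in keys -> index h (rcons keys g) = index h keys.
Proof. by move=> hk; rewrite -cats1 index_cat hk. Qed.

(** As every ancestor of a key is a key, a new node has no child, which agrees
    with the zeros of its row of the table of children. *)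
Lemma trie_insert keys h i u :
  trie keys h -> i < size keys -> u < n -> u :: nth [::] keys i \notin keys ->
  let S := size keys in
  trie (rcons keys (u :: nth [::] keys i))
    (upd (upd (upd (upd (upd h aCHILD i u S) aPAR S 0 i) aLAST S 0 u)
      aDEP S 0 (h aDEP i 0 + 1)) aFST S 0 (if i == 0 then u else h aFST i 0)).
Proof.
move=> T; have closed := trie_closed T; case: T => U [S0 k0] ch ch0 ok.
set g := u :: nth [::] keys i => lti ltu gN S.
have nthk k : k < S -> nth [::] (rcons keys g) k = nth [::] keys k.
  by move=> ltk; rewrite nth_rcons ltk.
have nthS : nth [::] (rcons keys g) S = g by rewrite nth_rcons ltnn eqxx.
have sz : size (rcons keys g) = S.+1 by rewrite size_rcons.
split; rewrite ?sz.
- by rewrite rcons_uniq gN.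
- by rewrite nthk.
- move=> k x; rewrite ltnS leq_eqVlt => /orP[/eqP->|ltk] ltx; rewrite /upd /=.
    rewrite nthS [S == i]gtn_eqF //= ch0 // /child_index mem_rcons inE.
    case: eqP => [E|_] /=; first by have := congr1 size E; rewrite /=; lia.
    case: ifP => // /closed gk; by rewrite gk in gN.
  rewrite nthk // ch //; case: ifP => [/andP[/eqP-> /eqP->]|ne].
    rewrite /child_index mem_rcons mem_head -cats1 index_cat (negPf gN).
    by rewrite /= eqxx addn0.
  rewrite /child_index mem_rcons inE.
  case: eqP => [[xu E]|_] /=.
    move/negP: ne; case; rewrite xu eqxx andbT.
    by rewrite -(nth_uniq [::] ltk lti U) E.
  by case: ifP => // gk; rewrite index_rcons_mem.
- move=> k x ltk; rewrite /upd /= [k == i]gtn_eqF /= ?ch0 //; lia.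
- move=> k; rewrite ltnS leq_eqVlt => /orP[/eqP->|ltk].
    have [si ai di fi pi] := ok i lti.
    rewrite /node_ok nthS /upd /= !eqxx /= ltu ai di addn1; split => //.
    + by apply: leq_ltn_trans lti.
    + case: (posnP i) fi => [->|i0 fi] _; rewrite ?k0 ?eqxx //.
      rewrite fi //; have [_] := pi i0.
      by case: (nth [::] keys i).
    + by rewrite lti nthk.
  have [si ai di fi pi] := ok k ltk.
  rewrite /node_ok nthk // /upd /= [k == S]ltn_eqF //=; split => //.
  by move=> k0'; have [ltp E] := pi k0'; rewrite nthk //; exact: ltn_trans ltp ltk.
Qed.

Definition add_row (rows : nat -> seq nat) (i v : nat) :=
  fun k => if k == i then rcons (rows i) v else rows k.

Lemma lists_flush keys rows h i v : lists keys rows h -> i < size keys ->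
  v < n -> v \notin rows i ->
  lists keys (add_row rows i v)
    (upd (upd h aROWS i (size (rows i)) v) aRC i 0 (size (rows i)).+1).
Proof.
move=> H lti ltv vN k; have [c r U al z] := H k; rewrite /add_row /upd /= andbT.
case: eqP => [->|_] //; have [{}c {}r {}U {}al {}z] := H i.
rewrite size_rcons rcons_uniq all_rcons vN ltv; split => // [j|lei]; last by lia.
rewrite nth_rcons ltnS leq_eqVlt => /orP[/eqP->|ltj].
  by rewrite ltnn !eqxx.
by rewrite ltj andTb ltn_eqF //= r.
Qed.

(** What the insertion of an element leaves unchanged. *)
Definition fvals (s : store) :=
  (vr s xn, vr s xL, vr s xM, vr s xu, vr s xj, vr s xv, vr s xoff, vr s xdeg,
   ar s aIN, ar s aPAS).

Lemma size_rows_le keys rows h i : lists keys rows h -> size (rows i) <= n.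
Proof.
case/(_ i) => _ _ U /allP al _; rewrite -(size_iota 0 n).
by apply: uniq_leq_size => // x /al; rewrite mem_iota.
Qed.

Lemma wp_flush keys rows cur s i v : rep keys rows cur s -> size keys < X ->
  i < size keys -> v < n -> v \notin rows i -> vr s xnode = i -> vr s xv = v ->
  wp flush 50 (fun s' => [/\ fvals s' = fvals s, vr s' = vr s
    & rep keys (add_row rows i v) cur s']) s.
Proof.
move=> [T C R K] ltkX lti ltv vN si sv; have [c _ _ _ _] := R i.
have szr := size_rows_le i R.
rewrite /flush; do_put; rewrite ?si ?sv ?c; try lia.
do_put1; rewrite /upd /= ?si ?sv ?c; try lia.
split => //; split => //.
have := lists_flush R lti ltv vN.
by rewrite addn1.
Qed.

Definition pascal_ok (s : store) : Prop :=
  [/\ vr s xn = n, vr s xL = L, vr s xM = M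
    & forall l k, l <= L -> ar s aPAS l k = minn 'C(l, k) M.+1].

Lemma wp_close_group keys rows cur s u v : rep keys rows cur s ->
  size keys < X -> pascal_ok s -> u < n -> v < n -> last 0 (cur v) <= u ->
  v \notin rows (index (cur v) keys) -> vr s xu = u -> vr s xv = v ->
  let stay := (cur v == [::]) || fits L M (cur v) u in
  wp close_group 200 (fun s' => [/\ fvals s' = fvals s,
    vr s' xnode = if stay then index (cur v) keys else 0
    & rep keys (if stay then rows else add_row rows (index (cur v) keys) v)
        cur s']) s.
Proof.
move=> R ltkX [sn sL sM sP] ltu ltv le_u vN su sv stay.
have [T C Li K] := R; have [cvk cvi] := C v ltv.
have [U [S0 k0] _ _ ok] := T.
have lti : index (cur v) keys < size keys by rewrite index_mem.
have Ei := nth_index [::] cvk.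
rewrite /close_group; do_asg; rewrite ?sv ?cvi; try lia.
apply: wp_if; [assumption|assumption| | by rewrite /=; lia| |].
- by safe_tac; rewrite ?cvi; lia.
- rewrite /= => i0.
  have [si ai di fi pi] := ok _ lti.
  have c0 : cur v != [::].
    by apply: contraNneq i0 => c0; rewrite c0 -k0 index_uniq.
  have {}fi : ar s 8 (index (cur v) keys) 0 = last 0 (cur v).
    by rewrite fi ?Ei // lt0n.
  rewrite Ei in si di.
  do_asg; rewrite ?su ?fi; try lia.
  do_asg.
  have wE : u - last 0 (cur v) + 1 = width (u :: cur v).
    by rewrite /width addn1 /=; case: (cur v) c0.
  rewrite wE; set W := width _ in wE *.
  apply: (wp_seq X_ge16 leXw (T1 := 60)); last by rewrite /=; lia.
  pose s1 := setv (setv (setv s 12 (index (cur v) keys)) 19 W) 23 0.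
  rewrite -[setv (setv _ _ _) _ _]/s1.
  have fin ok' T' s2 : 70 <= T' -> ok' = fits L M (cur v) u :> nat -> fvals s2 = fvals s ->
    ar s2 = ar s -> vr s2 xlast = vr s xlast ->
    vr s2 xnode = index (cur v) keys -> vr s2 xok = ok' ->
    wp (ifc ($xok) Skip (flush ;; xnode <- #0))%prog T'
      (fun s' => [/\ fvals s' = fvals s,
        vr s' xnode = if stay then index (cur v) keys else 0
      & rep keys (if stay then rows else add_row rows (index (cur v) keys) v)
        cur s']) s2.
    move=> leT' Eok fE aE lE nE kE; rewrite /stay (negPf c0) /= {}Eok in kE *.
    have R2 : rep keys rows cur s2 by split; rewrite ?aE ?lE.
    have vE : vr s2 xv = v by rewrite -sv; move: fE; rewrite /fvals => -[].
    do_if; rewrite ?kE.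
    + by case: fits => // _; do_skip.
    + case: fits => // _.
      apply: (wp_seq X_ge16 leXw (T1 := 50)); last by rewrite /=; lia.
      apply: wp_mono (wp_flush R2 ltkX lti ltv vN nE vE) _ _ => //.
      move=> s3 [f3 v3 R3]; do_asg1; split; [|by []|exact: R3].
      by rewrite -fE -f3.
  rewrite /fits -/W in fin.
  do_if; rewrite ?sL.
  + move=> LW; do_skip; apply: (fin 0) => //.
    by rewrite leqNgt LW.
  + case: ltnP => // WL _.
    have vP : ar s 9 W (size (cur v) + 1) = minn 'C(W, (size (cur v)).+1) M.+1.
      by rewrite sP // addn1.
    have vP1 : ar s 9 W (size (cur v) + 1) <= M.+1 by rewrite vP geq_minr.
    have {}vP1 : ar s 9 W (size (cur v) + 1) < X.
      by apply: leq_ltn_trans vP1 _; clear -leMn leX n_gt0; lia.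
    have ltW : W < X by apply: leq_ltn_trans WL _; clear -ltLX; lia.
    have lti' : index (cur v) keys < X by exact: ltn_trans lti ltkX.
    have lts' : size (cur v) + 1 < X.
      by apply: leq_ltn_trans (leq_trans _ lti) ltkX; rewrite addn1 ltnS.
    have ltM : M < X by apply: leq_ltn_trans leMn _; clear -leX n_gt0; lia.
    have X0 : 1 < X by clear -X_ge16; lia.
    apply: wp_if; [assumption|assumption| |by rewrite /=; clear; lia| |];
      rewrite /= ?eqb0 ?negbK ?sM ?di.
    * do !split => //; rewrite ?sM ?di //; try exact: ltnW.
      + by case: (M < _) => //; exact: ltnW.
      + by apply: ltn_trans lts'; rewrite addn1.
    * move=> MW; do_skip; apply: (fin 0) => //.
      move: MW; rewrite WL vP leq_min ltnS leqnn andbT.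
      by rewrite ltnNge => /negPf->.
    * case: ltnP => // MW _; do_asg1; apply: (fin 1) => //.
      by move: MW; rewrite WL vP geq_min ltnn orbF => ->.
- rewrite /= => i0; have c0 : cur v = [::] by rewrite -Ei i0.
  do_skip; have -> : stay by rewrite /stay c0 eqxx.
  by split.
Qed.

Lemma wp_find_child keys rows cur s i u : rep keys rows cur s ->
  size keys < X -> i < size keys -> u < n -> vr s xnode = i -> vr s xu = u ->
  let g := u :: nth [::] keys i in
  wp find_child 200 (fun s' => [/\ fvals s' = fvals s,
    vr s' xnew = index g (add_key keys g)
    & rep (add_key keys g) rows cur s']) s.
Proof.
move=> R ltkX lti ltu si su g.
have [T C Li K] := R; have [U [S0 k0] ch ch0 ok] := T.
have [sz_i _ d_i f_i _] := ok i lti.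
rewrite /find_child; have chE := ch i u lti ltu.
have chX : ar s aCHILD i u < X.
  rewrite chE /child_index; case: ifP => [gk|_]; last exact: leq_trans X_ge16.
  by apply: ltn_trans ltkX; rewrite index_mem.
do_asg; rewrite ?si ?su; try slia.
have ltuX : u < X by slia.
apply: wp_if; [assumption|assumption|by safe_tac|by rewrite /=; slia| |];
  rewrite /= chE /child_index -/g /add_key.
- by case: ifP => // gk _; do_skip.
- case: ifP => gk.
    move=> g0; suff : g = [::] by [].
    by rewrite -(nth_index [::] gk) g0 k0.
  move=> _; do_asg; rewrite ?K; try slia.
  do_asg; rewrite ?K; try slia.
  have -> : (size keys).-1 + 1 = size keys by slia.
  do_put; rewrite ?si ?su; try slia.
  do_put; rewrite ?si ?su; try slia.
  do_put; rewrite ?si ?su; try slia.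
  rewrite /upd /=.
  do_put; rewrite /upd /= ?si ?d_i; try slia.
  have ltf : (if i == 0 then u else ar s aFST i 0) < X.
    case: (posnP i) f_i => [//|i0 -> //].
    have [_ al _ _ pi] := ok i lti; have [_ E] := pi i0.
    have : last 0 (nth [::] keys i) \in nth [::] keys i.
      by rewrite E; exact: mem_last.
    by move/(allP al) => /= h; apply: ltn_trans h _; slia.
  have gk' : g \notin keys by rewrite gk.
  have := trie_insert T lti ltu gk'.
  have Ck : cursor (rcons keys g) cur (ar s).
    by move=> x /C[xk ->]; rewrite mem_rcons inE xk orbT index_rcons_mem.
  have Lk : lists (rcons keys g) rows (ar s).
    move=> k; have [c r rU al z] := Li k; split => //.
    by rewrite size_rcons => /ltnW.
  have Eg : index g (rcons keys g) = size keys.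
    by rewrite -cats1 index_cat gk /= eqxx addn0.
  have szr : size (rcons keys g) = (size keys).+1 by rewrite size_rcons.
  rewrite /= d_i => TI.
  do_if.
  + rewrite si => i0; do_put1; rewrite /upd /= ?si ?su; try slia.
    all: rewrite ?(negPf i0) // in ltf.
    rewrite (negPf i0) in TI.
    by split; rewrite ?Eg //; split => //=; rewrite szr.
  + rewrite si => i0; do_put1; rewrite /upd /= ?si ?su; try slia.
    have i0b : i == 0 by rewrite i0.
    rewrite i0b in TI.
    by split; rewrite ?Eg //; split => //=; rewrite szr.
Qed.

(** A pair (u, v) adds u to the row of v. *)
Definition row_of (E : seq (nat * nat)) (v : nat) : seq nat :=
  [seq e.1 | e <- E & e.2 == v].

Lemma row_of_rcons E u v x :
  row_of (rcons E (u, v)) x =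
    if v == x then rcons (row_of E x) u else row_of E x.
Proof. by rewrite /row_of filter_rcons /=; case: ifP; rewrite ?map_rcons. Qed.

Lemma row_of_cat E E' v : row_of (E ++ E') v = row_of E v ++ row_of E' v.
Proof. by rewrite /row_of filter_cat map_cat. Qed.

(** The keys, the lists of rows and the current groups are those obtained
    after the insertion of the pairs of E. *)
Definition linked E (keys : seq (seq nat)) (rows : nat -> seq nat)
    (cur : nat -> seq nat) : Prop :=
  [/\ forall v, cur v = (cut L M (row_of E v)).2,
      forall v g, v < n -> g \in (cut L M (row_of E v)).1 -> g \in keys,
      forall i v, i < size keys -> (v \in rows i) =
        (v < n) && (nth [::] keys i \in (cut L M (row_of E v)).1),
      size keys <= (size E).+1
    & forall v, sorted ltn (row_of E v)].

Definition scanned E (s : store) : Prop :=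
  exists keys rows cur, rep keys rows cur s /\ linked E keys rows cur.

(** The insertion of the pair (u, v) acts on the groups of the row v as [place]. *)
Lemma linked_add E keys rows cur u v h : linked E keys rows cur ->
  u < n -> v < n -> all (ltn^~ u) (row_of E v) ->
  uniq keys -> [::] \in keys -> cursor keys cur h -> lists keys rows h ->
  let stay := (cur v == [::]) || fits L M (cur v) u in
  let g := u :: if stay then cur v else [::] in
  linked (rcons E (u, v)) (add_key keys g)
    (if stay then rows else add_row rows (index (cur v) keys) v)
    (fun x => if x == v then g else cur x).
Proof.
move=> [Hc Hk Hr Hs Ho] ltu ltv al U k0 C Li stay g.
have [cvk _] := C v ltv.
have Ecut : cut L M (rcons (row_of E v) u) =
    (if stay then (cut L M (row_of E v)).1
     else cur v :: (cut L M (row_of E v)).1, g).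
  by rewrite cut_rcons /place /g -Hc -/stay; case: (stay).
have in_old x h' : x < n ->
    h' \in (cut L M (row_of (rcons E (u, v)) x)).1 -> h' \in keys.
  rewrite row_of_rcons; case: (v =P x) => [<-|_] ltx; last exact: Hk.
  rewrite Ecut /=; case: (stay); first exact: Hk.
  by rewrite inE => /orP[/eqP->//|]; exact: Hk.
split.
- move=> x; rewrite row_of_rcons eq_sym; case: (v =P x) => [<-|_] //.
  by rewrite Ecut.
- by move=> x h' ltx /(in_old _ _ ltx) hk; rewrite mem_add_key hk orbT.
- move=> i x; rewrite /add_key; case: (boolP (g \in keys)) => gk lti.
    have : i < size keys by [].
    move=> {}lti; rewrite row_of_rcons.
    case: (v =P x) => [<-|/eqP nvx]; last first.
      rewrite -(Hr _ _ lti); case: (stay) => //; rewrite /add_row.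
      by case: eqP => [->|_] //; rewrite mem_rcons inE eq_sym (negPf nvx).
    rewrite Ecut ltv /=; case: (stay); first by rewrite Hr // ltv.
    rewrite inE /add_row; case: eqP => [->|ne].
      by rewrite mem_rcons mem_head nth_index // eqxx.
    rewrite Hr // ltv; case: eqP => // E1; case: ne.
    by rewrite -E1 index_uniq.
  move: lti; rewrite size_rcons ltnS leq_eqVlt => /orP[/eqP Ei|lti].
    have -> : (if stay then rows else add_row rows (index (cur v) keys) v) i = [::].
      have z : rows i = [::] by have [_ _ _ _] := Li i; apply; rewrite Ei.
      case: (stay) => //; rewrite /add_row; case: eqP => // E1.
      by move: cvk; rewrite -index_mem -E1 Ei ltnn.
    rewrite Ei nth_rcons ltnn eqxx in_nil; apply/esym/negbTE/negP => /andP[ltx].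
    by move/(in_old _ _ ltx); rewrite (negPf gk).
  rewrite nth_rcons lti row_of_rcons.
  case: (v =P x) => [<-|/eqP nvx]; last first.
    rewrite -(Hr _ _ lti); case: (stay) => //; rewrite /add_row.
    by case: eqP => [->|_] //; rewrite mem_rcons inE eq_sym (negPf nvx).
  rewrite Ecut ltv /=; case: (stay); first by rewrite Hr // ltv.
  rewrite inE /add_row; case: eqP => [->|ne].
    by rewrite mem_rcons mem_head nth_index // eqxx.
  rewrite Hr // ltv; case: eqP => // E1; case: ne.
  by rewrite -E1 index_uniq.
- by rewrite /add_key size_rcons; case: ifP; rewrite ?size_rcons; slia.
- move=> x; rewrite row_of_rcons; case: eqP => // <-.
  by rewrite sorted_ltn_rcons al Ho.
Qed.

Lemma wp_add_edge E s u v : scanned E s -> pascal_ok s -> u < n -> v < n ->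
  all (ltn^~ u) (row_of E v) -> (size E).+2 < X -> vr s xu = u -> vr s xv = v ->
  wp add_edge 450 (fun s' => fvals s' = fvals s /\ scanned (rcons E (u, v)) s') s.
Proof.
move=> [keys [rows [cur [R H]]]] P ltu ltv al szE su sv.
have [Hc Hk Hr Hs Ho] := H; have [T C Li K] := R; have [U [S0 k0] _ _ _] := T.
have [cvk cvi] := C v ltv.
have ltkX : size keys < X by apply: leq_ltn_trans Hs _; slia.
have nilk : [::] \in keys by rewrite -k0 mem_nth.
have lti : index (cur v) keys < size keys by rewrite index_mem.
have le_u : last 0 (cur v) <= u.
  have cv_in x : x \in cur v -> x \in row_of E v.
    move=> xc; rewrite -mem_rev -(flatten_groups L M) /groups /= mem_cat -Hc.
    by rewrite xc.
  case Ec : (cur v) => [//|y t]; apply/ltnW/(allP al)/cv_in.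
  by rewrite Ec; exact: mem_last.
have vN : v \notin rows (index (cur v) keys).
  rewrite Hr // ltv nth_index //= Hc.
  have := uniq_groups L M (sorted_uniq ltn_trans ltnn (Ho v)).
  by case/andP.
have LA := linked_add H ltu ltv al U nilk C Li.
rewrite /add_edge; apply: (wp_seq X_ge16 leXw (T1 := 200)); last by rewrite /=; slia.
apply: wp_mono (wp_close_group R ltkX P ltu ltv le_u vN su sv) _ _ => //.
move: LA; set stay := _ || _; set g := if stay then cur v else [::] => LA.
set rows' := if stay then rows else _ in LA *.
move=> s1 [f1 x1 R1].
have gk : g \in keys by rewrite /g; case: (stay).
have {}x1 : vr s1 xnode = index g keys.
  by rewrite x1 /g; case: (stay) => //; rewrite -k0 index_uniq.
have ltig : index g keys < size keys by rewrite index_mem.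
have u1 : vr s1 xu = u by rewrite -su; move: f1; rewrite /fvals => -[].
apply: (wp_seq X_ge16 leXw (T1 := 200)); last by rewrite /=; slia.
apply: wp_mono (wp_find_child R1 ltkX ltig ltu x1 u1) _ _ => //.
rewrite nth_index // => s2 [f2 x2 R2].
have v2 : vr s2 xv = v.
  by rewrite -sv; move: f2; rewrite f1 /fvals => -[].
have newk : u :: g \in add_key keys (u :: g) by rewrite mem_add_key eqxx.
have lt_new : index (u :: g) (add_key keys (u :: g)) < X.
  have : index (u :: g) (add_key keys (u :: g)) < size (add_key keys (u :: g)).
    by rewrite index_mem.
  move=> h; apply: leq_trans h _; rewrite /add_key.
  by case: ifP; rewrite ?size_rcons; slia.
do_put1; rewrite ?v2 ?x2 //; try slia.
split; first by rewrite -f1 -f2.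
exists (add_key keys (u :: g)), rows', (fun x => if x == v then u :: g else cur x).
split; last exact: LA.
have [T2 C2 L2 K2] := R2; split => //=.
move=> x ltx; rewrite /upd /= andbT; case: eqP => [_|_] //.
exact: C2.
Qed.

Variable m : nat.
Hypothesis le_m : 2 * m <= n * n.

Variable A : nat -> seq nat.
Hypothesis A_sum : \sum_(u < n) size (A u) = 2 * m.
Hypothesis A_lt : forall u x, u < n -> x \in A u -> x < n.
Hypothesis A_uniq : forall u, u < n -> uniq (A u).

Definition row_pairs u k := [seq (u, v) | v <- take k (A u) & u < v].

Definition pairs u := flatten [seq row_pairs i (size (A i)) | i <- iota 0 u].

Let prefix u := \sum_(i < u) size (A i).

Let size_row_pairs u k : size (row_pairs u k) <= k.
Proof.
rewrite size_map size_filter; apply: leq_trans (count_size _ _) _.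
by rewrite size_take; case: ltnP.
Qed.

Lemma pairsS u : pairs u.+1 = pairs u ++ row_pairs u (size (A u)).
Proof. by rewrite /pairs -addn1 iotaD map_cat flatten_cat /= cats0. Qed.

Lemma size_pairs u : size (pairs u) <= prefix u.
Proof.
elim: u => [|u IH]; first by [].
rewrite pairsS size_cat /prefix big_ord_recr /=; apply: leq_add => //.
Qed.

Let prefix_le u : u <= n -> prefix u <= 2 * m.
Proof.
move=> leun; rewrite -A_sum /prefix -(subnKC leun) big_split_ord /=.
by rewrite leq_addr.
Qed.

Lemma row_pairsS u j : j < size (A u) -> let v := nth 0 (A u) j in
  row_pairs u j.+1 =
    if u < v then rcons (row_pairs u j) (u, v) else row_pairs u j.
Proof.
move=> ltj v; rewrite /row_pairs (take_nth 0) // filter_rcons -/v.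
by case: ifP; rewrite ?map_rcons.
Qed.

Let row_of_pairs u v : all (ltn^~ u) (row_of (pairs u) v).
Proof.
elim: u => [|u IH] //; rewrite pairsS row_of_cat all_cat; apply/andP; split.
  by apply: sub_all IH => x /= /ltnW.
apply/allP => x /mapP[[a b]]; rewrite mem_filter => /andP[_ /mapP[y _ [-> _]]] ->.
exact: ltnSn.
Qed.

Let row_of_row_pairs u j : u < n -> j < size (A u) ->
  row_of (row_pairs u j) (nth 0 (A u) j) = [::].
Proof.
move=> ltu ltj; apply/nilP; rewrite /nilp size_map size_filter -leqn0 leqNgt -has_count.
apply/hasPn => -[a b] /mapP[y]; rewrite mem_filter => /andP[_ yj] [_ ->] /=.
apply: contraTneq yj => ->; have := A_uniq ltu.
rewrite -{1}(cat_take_drop j (A u)) cat_uniq => /and3P[_ /hasPn dis _].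
by apply: dis; rewrite (drop_nth 0) // mem_head.
Qed.

Lemma pascal_ok_fvals s s' : fvals s' = fvals s -> pascal_ok s -> pascal_ok s'.
Proof. by rewrite /fvals /pascal_ok => -[-> -> -> _ _ _ _ _ _ ->]. Qed.

Lemma is_input_fvals s s' : fvals s' = fvals s -> is_input n A s -> is_input n A s'.
Proof. by rewrite /fvals /is_input => -[_ _ _ _ _ _ _ _ -> _]. Qed.

Lemma wp_scan_edges s : pascal_ok s -> is_input n A s ->
  (forall a i j, 0 < a < 9 -> ar s a i j = 0) ->
  wp scan_edges (1000 * (2 * m + n + 1)) (fun s' => vr s' xn = n /\ scanned (pairs n) s') s.
Proof.
move=> P In Z; rewrite /scan_edges; do_asg.
pose I u s' := [/\ pascal_ok s', is_input n A s' & scanned (pairs u) s'].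
apply: (@wp_for _ _ X_ge16 leXw _ _ _ n (fun u => 800 * size (A u) + 200) I);
  try by []; try slia.
- split => //; exists [:: [::]], (fun=> [::]), (fun=> [::]); split.
    split => //=.
    + split => //.
      - by move=> [|i] u // _ _; rewrite /= Z.
      - by move=> i u _; rewrite /= Z.
      - by move=> [|i] // _; split; rewrite //= ?Z.
    + by move=> v ltv; rewrite mem_head /= Z.
    + by move=> i; split; rewrite //= Z.
  by split => // [[|i]] v //=; rewrite andbF.
- by move=> i s' lei ei [[sn _ _ _] _ _]; split => //; safe_tac; slia.
- move=> u s' ltu eu [P' In' Sc'].
  have [in1 in2] := In'; have [sn sL sM _] := P'.
  have Eoff := offset_n A_sum.
  have le_off : offset n A u.+1 <= n + 2 + 2 * m.
    have -> : n + 2 + 2 * m = offset n A n by rewrite Eoff; slia.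
    exact: offset_le.
  have i1 : ar s' aIN 0 (u + 1) = offset n A u by rewrite addn1 in1 // ltnW.
  have i2 : ar s' aIN 0 (u + 2) = offset n A u.+1 by rewrite addn2 in1.
  have offS := offsetS n A u.
  do_asg; rewrite ?eu ?i1; try slia.
  do_asg; rewrite ?eu ?i2; try slia.
  have -> : offset n A u.+1 - offset n A u = size (A u) by rewrite offS addKn.
  pose J j s2 := [/\ pascal_ok s2, is_input n A s2,
    [/\ vr s2 xu = u, vr s2 xoff = offset n A u & vr s2 xdeg = size (A u)]
    & scanned (pairs u ++ row_pairs u j) s2].
  have le_pre : prefix u.+1 <= 2 * m by exact: prefix_le.
  have preS : prefix u.+1 = prefix u + size (A u) by rewrite /prefix big_ord_recr.
  have szP := size_pairs u.
  apply: (@wp_for _ _ X_ge16 leXw _ _ _ (size (A u)) (fun=> 700) J); try by []; try slia.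
  + by split => //; rewrite /row_pairs take0 cats0.
  + by move=> j s2 lej ej [_ _ [s2u s2o s2d] _]; split => //; safe_tac; slia.
  + move=> j s2 ltj ej [P2 In2 [s2u s2o s2d] Sc2].
    have iv : ar s2 aIN 0 (offset n A u + j) = nth 0 (A u) j by case: In2 => _ ->.
    pose v := nth 0 (A u) j.
    have ltv : v < n by apply: (A_lt ltu); exact: mem_nth.
    have szR := size_row_pairs u j.
    do_asg; rewrite ?s2o ?ej ?iv -/v; try slia.
    do_if; rewrite ?s2u.
    * move=> ltuv.
      have al : all (ltn^~ u) (row_of (pairs u ++ row_pairs u j) v).
        by rewrite row_of_cat row_of_row_pairs // cats0.
      have szE : (size (pairs u ++ row_pairs u j)).+2 < X.
        by rewrite size_cat; slia.
      have W := @wp_add_edge _ (setv s2 xv v) u v Sc2 P2 ltu ltv al szE s2u erefl.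
      apply: wp_mono W _ _; first by rewrite /=; slia.
      move=> s3 [f3 Sc3].
      have Sc3' : scanned (pairs u ++ row_pairs u j.+1) s3.
        by rewrite row_pairsS // -/v ltuv -rcons_cat.
      have [s3u s3j s3o s3d] : [/\ vr s3 xu = u, vr s3 xj = j,
          vr s3 xoff = offset n A u & vr s3 xdeg = size (A u)].
        by move: f3; rewrite /fvals /= => -[_ _ _ -> -> _ -> -> _ _]; split.
      split => //; split => //=.
      - exact: (@pascal_ok_fvals (setv s2 xv v) s3 f3 P2).
      - exact: (@is_input_fvals (setv s2 xv v) s3 f3 In2).
    * move=> nlt; do_skip.
      have {}nlt : (u < v) = false by move: nlt; case: (u < v).
      split => //; split => //=.
      by rewrite row_pairsS // -/v nlt.
  + move=> s2 [P2 In2 [s2u s2o s2d] Sc2]; split => //; split => //.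
    by rewrite pairsS.
  + by rewrite sum_nat_const card_ord /=; slia.
- by move=> s' [[sn _ _ _] _ Sc].
- rewrite big_split /= big_split /= -big_distrr /= A_sum !sum_nat_const card_ord.
  by slia.
Qed.

End Trie.

(** * The output *)

Section Output.

Variables w X n L M : nat.
Hypotheses (X_ge16 : 16 <= X) (leXw : 16 * X * X <= 2 ^ w).
Hypotheses (n_gt0 : 0 < n) (leX : 8 * (n * n) + 8 * n < X).
Hypotheses (ltLX : L + 1 < X) (leMn : M <= n).

Notation wp := (wp w X).

Lemma rep_ext keys rows cur s s' : (forall a, a != aOUT -> ar s' a = ar s a) ->
  vr s' xlast = vr s xlast -> rep n keys rows cur s -> rep n keys rows cur s'.
Proof.
move=> E K [T C R lE]; split; last by rewrite K.
- move: T; rewrite /trie /node_ok.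
  by rewrite !(E aCHILD, E aPAR, E aLAST, E aDEP, E aFST).
- by move: C; rewrite /cursor (E aNODE).
- by move: R; rewrite /lists !(E aRC, E aROWS).
Qed.

(** This closes the group of each vertex that was current at the end of the
    scan.  For a vertex without smaller neighbour it is the empty group, whose node, the root,
    is skipped by the output. *)
Lemma wp_flush_all E s : vr s xn = n -> scanned n L M E s -> size E + 2 < X ->
  wp flush_all (200 * n + 50) (fun s' => exists keys rows cur,
    [/\ rep n keys rows cur s',
      forall v g, v < n -> g \in groups L M (row_of E v) -> g \in keys,
      forall i v, i < size keys -> (v \in rows i) =
        (v < n) && (nth [::] keys i \in groups L M (row_of E v))
      & size keys <= (size E).+1]) s.
Proof.
move=> sn [keys [rows0 [cur [R0 [Hc Hk Hr Hs Ho]]]]] szE.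
have ltkX : size keys < X by apply: leq_ltn_trans Hs _; slia.
have [[U [S0 k0] _ _ _] C0 _ _] := R0.
rewrite /flush_all.
pose I v s' := vr s' xn = n /\ exists rows, rep n keys rows cur s' /\
  forall i x, i < size keys -> (x \in rows i) = (x < n) &&
   ((nth [::] keys i \in (cut L M (row_of E x)).1)
    || (x < v) && (nth [::] keys i == cur x)).
apply: (@wp_for _ _ X_ge16 leXw _ _ _ n (fun=> 100) I); try by []; try slia.
- split => //; exists rows0; split => // i x lti.
  by rewrite Hr // ltn0 andFb orbF.
- by move=> i s' lei ei [s'n _]; split => //; safe_tac; slia.
- move=> v s' ltv ev [s'n [rows [R Hrows]]].
  have [T C Li K] := R; have [cvk cvi] := C v ltv.
  have lti : index (cur v) keys < size keys by rewrite index_mem.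
  do_asg; rewrite ?ev ?cvi; try slia.
  have vN : v \notin rows (index (cur v) keys).
    rewrite Hrows // ltv nth_index // ltnn orbF /= Hc.
    have := uniq_groups L M (sorted_uniq ltn_trans ltnn (Ho v)).
    by case/andP.
  have W := @wp_flush w X n L M X_ge16 leXw n_gt0 leX ltLX leMn keys rows cur
    (setv s' xnode (index (cur v) keys)) _ v R ltkX lti ltv vN erefl ev.
  apply: wp_mono W _ _; first by rewrite /=; slia.
  move=> s2 [f2 v2 R2]; split; first by rewrite v2.
  split; first by rewrite /= v2.
  exists (add_row rows (index (cur v) keys) v); split; first exact: R2.
  move=> i x ltik; rewrite /add_row ltnS [x <= v]leq_eqVlt.
  have Ei : (i == index (cur v) keys) = (nth [::] keys i == cur v).
    apply/eqP/eqP => [->|<-]; first by rewrite nth_index.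
    by rewrite index_uniq.
  case: (x =P v) => [->|/eqP nxv] /=.
    rewrite ltv /= Ei; case: eqP => [_|_].
      by rewrite mem_rcons mem_head orbT.
    by rewrite Hrows // ltv ltnn !orbF.
  rewrite -(Hrows _ _ ltik); case: eqP => // ->.
  by rewrite mem_rcons inE (negPf nxv).
- move=> s' [_ [rows [R Hrows]]]; exists keys, rows, cur; split => //.
    move=> v g ltv; rewrite /groups inE => /orP[/eqP->|]; last exact: Hk.
    by rewrite -Hc; case: (C0 v ltv).
  move=> i v lti; rewrite Hrows // /groups inE orbC -Hc.
  by case: ltnP.
- by rewrite sum_nat_const card_ord /=; slia.
Qed.

(** The cell 0 of the output is reserved for the number of bicliques. *)
Definition written (l : seq nat) (s : store) : Prop :=
  vr s xpos = (size l).+1 /\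
  forall k, k < size l -> ar s aOUT 0 k.+1 = nth 0 l k.

Definition only_emits (s s' : store) : Prop :=
  (forall y, y != xpos -> vr s' y = vr s y) /\
  (forall a, a != aOUT -> ar s' a = ar s a).

Lemma wp_emit e l x s : safe X e s -> eval e s = x -> written l s ->
  (size l).+2 < X ->
  wp (emit e) (cost e + 30)
    (fun s' => only_emits s s' /\ written (rcons l x) s') s.
Proof.
move=> sf ee [sp sl] ltX; rewrite /emit.
apply: wp_put_seq; [assumption|assumption|by []|safe_tac; slia|safe_tac; rewrite ?sp; slia
  |by []|by rewrite /=; slia|].
rewrite /= ee sp.
do_asg1; rewrite ?sp; try slia.
split.
  split => [y /negPf ny|a /negPf na] /=; first by rewrite ny.
  by rewrite /upd na.
split; first by rewrite /= size_rcons addn1.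
move=> k; rewrite size_rcons ltnS nth_rcons /= /upd /= eqSS leq_eqVlt.
by case: eqP => [->|_] //=; [rewrite ltnn|move=> ltk; rewrite ltk sl].
Qed.

Lemma iota1S i : iota 1 i.+1 = rcons (iota 1 i) i.+1.
Proof. by rewrite -cats1 -[in LHS](addn1 i) iotaD add1n. Qed.

Section Write.

Variables (keys : seq (seq nat)) (rows : nat -> seq nat) (cur : nat -> seq nat).

Local Notation key := (nth [::] keys).

Definition block (i : nat) : seq nat :=
  size (key i) :: key i ++ size (rows i) :: rows i.

Definition out (i : nat) : seq nat :=
  flatten [seq block k | k <- iota 1 i & rows k != [::]].

Lemma outS i : out i.+1 = if rows i.+1 != [::] then out i ++ block i.+1 else out i.
Proof.
rewrite /out iota1S filter_rcons; case: ifP => // _.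
by rewrite map_rcons flatten_rcons.
Qed.

Lemma size_out_le i k : i <= k -> size (out i) <= size (out k).
Proof.
move=> leik; rewrite -(subnKC leik); elim: (k - i) => [|j IH]; first by rewrite addn0.
by rewrite addnS outS; case: ifP => // _; rewrite size_cat; apply: leq_trans IH (leq_addr _ _).
Qed.

Hypothesis ltkX : size keys < X.

Lemma wp_write_biclique i l s : rep n keys rows cur s -> 0 < i < size keys ->
  vr s xid = i -> vr s xr = size (rows i) -> written l s ->
  size l + size (block i) + 3 < X -> vr s xcnt + 1 < X ->
  wp write_biclique (100 * size (block i) + 300)
    (fun s' => [/\ rep n keys rows cur s', vr s' xcnt = vr s xcnt + 1,
      vr s' xi = vr s xi & written (l ++ block i) s']) s.
Proof.
move=> R /andP[i0 lti] sid sr wl ltX cX.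
have [[U [S0 k0] _ _ ok] _ Li _] := R.
have [sz_i al d_i _ _] := ok i lti.
have [c_i r_i _ alr _] := Li i.
have szb : size (block i) = (size (key i) + size (rows i)).+2.
  by rewrite /block /= size_cat /= addnS.
rewrite szb in ltX *.
rewrite /write_biclique; do_asg.
set s0 := setv s xcnt _.
have wl0 : written l s0 by exact: wl.
have [id0 r0 c0 xi0 l0] : [/\ vr s0 xid = i, vr s0 xr = size (rows i),
    vr s0 xcnt = vr s xcnt + 1, vr s0 xi = vr s xi & vr s0 xlast = vr s xlast].
  by split.
have a0 : ar s0 = ar s by [].
apply: (wp_seq X_ge16 leXw (T1 := 60)); last by rewrite /=; slia.
have sf : safe X (Get aDEP ($xid) #0)%prog s0.
  by safe_tac; rewrite ?sid ?d_i; slia.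
apply: wp_mono (wp_emit sf erefl wl0 _) _ _ => //; first by slia.
rewrite /= sid d_i => s1 [[v1 a1] w1].
do_asg; rewrite ?v1 ?id0 //; try slia.
apply: (wp_seq X_ge16 leXw (T1 := 100 * size (key i) + 50)); last by rewrite /=; slia.
pose J j s' := [/\ forall a, a != aOUT -> ar s' a = ar s a,
   [/\ vr s' xid = i, vr s' xr = size (rows i), vr s' xcnt = vr s xcnt + 1,
       vr s' xi = vr s xi & vr s' xlast = vr s xlast],
   written (l ++ size (key i) :: take j (key i)) s'
   & exists2 k, vr s' xnode = k /\ k < size keys & key k = drop j (key i)].
have szk : size (key i) < X by slia.
apply: (@wp_for _ _ X_ge16 leXw _ _ _ (size (key i)) (fun=> 70) J); try by []; try slia.
- split.
  + by move=> a na; rewrite /= a1.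
  + by rewrite /= !v1 ?id0 ?r0 ?c0 ?xi0 ?l0.
  + by rewrite take0 cats1.
  + by exists i; rewrite ?drop0.
- move=> j s' lej ej [a' [id' _ _ _ _] _ _].
  by safe_tac; rewrite ?a' ?id' ?d_i; try slia.
- move=> j s' ltj ej [a' [id' r' c' xi' l'] w' [k [nk ltk] kE]].
  have k_gt0 : 0 < k.
    rewrite lt0n; apply: contraTneq ltj => k00; rewrite -leqNgt.
    by rewrite -(subn_eq0 (size _)) -size_drop -kE k00 k0.
  have [_ _ _ _ pk] := ok k ltk; have {pk} [ltp pE] := pk k_gt0.
  have [eL eP] : ar s aLAST k 0 = nth 0 (key i) j /\ key (ar s aPAR k 0) = drop j.+1 (key i).
    by move: kE; rewrite pE (drop_nth 0) // => -[-> ->].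
  have ltL : ar s aLAST k 0 < n by rewrite eL; apply: (allP al); exact: mem_nth.
  apply: (wp_seq X_ge16 leXw (T1 := 40)); last by rewrite /=; slia.
  have sf' : safe X (Get aLAST ($xnode) #0)%prog s'.
    by safe_tac; rewrite ?a' ?nk; try slia.
  have ee : eval (Get aLAST ($xnode) #0)%prog s' = nth 0 (key i) j.
    by rewrite /= a' // nk eL.
  have szt : size (take j (key i)) <= size (key i) by rewrite size_take; case: ltnP => // /ltnW.
  apply: wp_mono (wp_emit sf' ee w' _) _ _ => //.
    by rewrite size_cat /=; slia.
  move=> s2 [[v2 a2] w2].
  do_asg1; rewrite ?v2 ?a2 ?a' ?nk //; try slia.
  split; first by rewrite ?v2.
  split.
  + by move=> a na /=; rewrite a2 // a'.
  + by rewrite /= !v2.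
  + by rewrite (take_nth 0) // -rcons_cons -rcons_cat.
  + exists (ar s aPAR k 0) => //.
    by split; [|exact: ltn_trans ltp ltk].
- move=> s2 [a2 [id2 r2 c2 xi2 l2] w2 _].
  rewrite take_size in w2.
  have sf2 : safe X ($xr)%prog s2 by safe_tac; rewrite ?r2; slia.
  apply: (wp_seq X_ge16 leXw (T1 := 40)); last by rewrite /=; slia.
  apply: wp_mono (wp_emit sf2 r2 w2 _) _ _ => //.
    by rewrite size_cat /=; slia.
  move=> s3 [[v3 a3] w3].
  pose J' j s' := [/\ forall a, a != aOUT -> ar s' a = ar s a,
   [/\ vr s' xid = i, vr s' xr = size (rows i), vr s' xcnt = vr s xcnt + 1,
       vr s' xi = vr s xi & vr s' xlast = vr s xlast]
   & written (l ++ size (key i) :: key i ++ size (rows i) :: take j (rows i)) s'].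
  apply: (@wp_for _ _ X_ge16 leXw _ _ _ (size (rows i)) (fun=> 50) J'); try by []; try slia.
  + split.
    * by move=> a na; rewrite /= a3 // a2.
    * by rewrite /= !v3.
    * by rewrite take0 cats1 -rcons_cons -rcons_cat.
  + move=> j s' lej ej [a' [id' r' _ _ _] _].
    by safe_tac; rewrite ?r'; try slia.
  + move=> j s' ltj ej [a' [id' r' c' xi' l'] w'].
    have ltr : nth 0 (rows i) j < n by apply: (allP alr); exact: mem_nth.
    have eR : ar s aROWS i j = nth 0 (rows i) j by rewrite r_i.
    have szr : size (rows i) < X by slia.
    have sf' : safe X (Get aROWS ($xid) ($xj))%prog s'.
      by safe_tac; rewrite ?a' ?id' ?ej ?eR; try slia.
    have ee : eval (Get aROWS ($xid) ($xj))%prog s' = nth 0 (rows i) j.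
      by rewrite /= a' // id' ej eR.
    have szt : size (take j (rows i)) <= size (rows i) by rewrite size_take; case: ltnP => // /ltnW.
    apply: wp_mono (wp_emit sf' ee w' _) _ _ => //.
      by rewrite size_cat /= size_cat /=; slia.
    move=> s4 [[v4 a4] w4]; split; first by rewrite v4.
    split.
    * by move=> a na /=; rewrite a4 // a'.
    * by rewrite /= !v4.
    * by rewrite (take_nth 0) // -!rcons_cons -rcons_cat -rcons_cons -rcons_cat.
  + move=> s4 [a4 [id4 r4 c4 xi4 l4] w4]; split => //.
      by apply: rep_ext R.
    by rewrite take_size in w4.
  + by rewrite sum_nat_const card_ord /=; slia.
- by rewrite sum_nat_const card_ord /=; slia.
Qed.

Definition used_nodes (i : nat) : nat := count (fun k => rows k != [::]) (iota 1 i).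

Lemma wp_write_output s : rep n keys rows cur s ->
  size (out (size keys).-1) + 3 < X ->
  wp write_output (500 * (size keys + size (out (size keys).-1)))
    (fun s' => [/\ ar s' aOUT 0 0 = used_nodes (size keys).-1
       & forall k, k < size (out (size keys).-1) ->
          ar s' aOUT 0 k.+1 = nth 0 (out (size keys).-1) k]) s.
Proof.
move=> R ltX; have [[U [S0 k0] _ _ ok] _ Li lastE] := R.
rewrite /write_output; do_asg; do_asg.
set K := (size keys).-1 in lastE ltX *.
have EK : K.+1 = size keys by rewrite /K prednK.
apply: (wp_seq X_ge16 leXw (T1 := 500 * (K + size (out K)) + 50)); last by rewrite /=; slia.
pose I i s' := [/\ rep n keys rows cur s', vr s' xcnt = used_nodes i
  & written (out i) s'].
have count_le i : used_nodes i <= i.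
  by rewrite /used_nodes; apply: leq_trans (count_size _ _) _; rewrite size_iota.
have countS i : used_nodes i.+1 = used_nodes i + (rows i.+1 != [::]).
  by rewrite /used_nodes iota1S -cats1 count_cat /= addn0.
apply: (@wp_for _ _ X_ge16 leXw _ _ _ K
  (fun i => if rows i.+1 != [::] then 100 * size (block i.+1) + 400 else 100) I);
  try by []; try slia.
- move=> i s' lei ei [[_ _ _ l'] _ _].
  by safe_tac; rewrite ?l'; try slia.
- move=> i s' lti ei [R' c' w'].
  have [_ _ Li' l'] := R'.
  have ltiK : i.+1 < size keys by rewrite /K in lti; slia.
  have [c_i _ _ _ _] := Li' i.+1.
  have szr := size_rows_le i.+1 Li'.
  have ltC := count_le i.
  have [T [ET T100 Tr]] : exists T, [/\ T = if rows i.+1 != [::] then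
      100 * size (block i.+1) + 400 else 100, 100 <= T
      & rows i.+1 != [::] -> 100 * size (block i.+1) + 400 <= T].
    exists (if rows i.+1 != [::] then 100 * size (block i.+1) + 400 else 100).
    by split => [//||->//]; case: ifP => _ //; slia.
  rewrite -ET; do_asg; rewrite ?ei; try slia.
  rewrite (addn1 i).
  do_asg; rewrite ?c_i; try slia.
  have szO : size (out i.+1) <= size (out K) by exact: size_out_le.
  rewrite outS in szO.
  do_if; rewrite ?size_eq0.
  + move=> r0; have {}Tr := Tr r0; rewrite r0 size_cat in szO.
    set s2 := setv (setv _ _ _) _ _.
    have b1 : 0 < i.+1 < size keys by [].
    have b2 : size (out i) + size (block i.+1) + 3 < X by slia.
    have b3 : vr s2 xcnt + 1 < X by rewrite /= c'; slia.
    have W := @wp_write_biclique i.+1 (out i) s2 R' b1 erefl erefl w' b2 b3.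
    apply: wp_mono W _ _; first by slia.
    move=> s3 [R3 c3 i3 w3]; split; first by rewrite i3 /= ei.
    split => //=.
    * by rewrite c3 /= c' countS r0.
    * by rewrite outS r0.
  + move/eqP; rewrite size_eq0 => r0; do_skip; rewrite ?r0; try slia.
    split => //; split => //=.
    * by rewrite c' countS r0 addn0.
    * by rewrite outS r0.
- move=> s' [R' c' [p' w']].
  have ltC := count_le K.
  do_put1; rewrite ?c'; try slia.
  by split => //=; rewrite /upd /= c'.
- have : \sum_(i < K) (if rows i.+1 != [::] then 100 * size (block i.+1) + 400 else 100)
     <= 300 * size (out K) + 100 * K.
    elim: (K) => [|k IH]; first by rewrite big_ord0.
    rewrite big_ord_recr outS; move: (\sum_(_ < k) _) IH => S IH /=.
    case: ifP => _; last by slia.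
    by rewrite ?size_cat /block /= ?size_cat /= ?size_cat /=; slia.
  by rewrite big_split /= sum_nat_const card_ord /=; slia.
Qed.

End Write.

End Output.

(** * The program on adjacency lists *)

Section Adjacency.

Variables (n : nat) (G : sgraph n) (adj : 'I_n -> seq 'I_n).
Hypothesis adjP : adjacency_list G adj.

Definition nat_adj (u : nat) : seq nat :=
  if insub u is Some v then map val (adj v) else [::].

Lemma nat_adjE (v : 'I_n) : nat_adj v = map val (adj v).
Proof. by rewrite /nat_adj insubT // => h; congr (map _ (adj _)); exact: val_inj. Qed.

Lemma nat_adj_ord u (ltu : u < n) : nat_adj u = map val (adj (Ordinal ltu)).
Proof. by rewrite -nat_adjE. Qed.

Lemma nat_adj_lt u x : u < n -> x \in nat_adj u -> x < n.
Proof. by move=> ltu; rewrite nat_adj_ord => /mapP[y _ ->]; exact: ltn_ord. Qed.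

Lemma nat_adj_uniq u : u < n -> uniq (nat_adj u).
Proof.
move=> ltu; rewrite nat_adj_ord map_inj_uniq; last exact: val_inj.
by case: (adjP (Ordinal ltu)).
Qed.

Lemma nat_adj_sum : \sum_(u < n) size (nat_adj u) = 2 * #|edges G|.
Proof.
have E (v : 'I_n) : size (nat_adj v) =
    \sum_(u < n) (u < v) * ([set u; v] \in edges G) +
    \sum_(u < n) (v < u) * ([set v; u] \in edges G).
  have [U M] := adjP v; rewrite nat_adjE size_map -big_split /=.
  rewrite -(card_uniqP U) (eq_card M) -sum1_card big_mkcond /=.
  apply: eq_bigr => u _; rewrite !inE [[set u; v]]setUC.
  have [uv|vu|/val_inj uv] := ltngtP u v; rewrite /= ?mul1n ?mul0n ?addn0 //.
  have /negPf -> // : [set v; u] \notin edges G.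
  rewrite uv; apply/negP => /edge2P[x [y [nxy E]]].
  by have := cards2 x y; rewrite -E setUid cards1 nxy.
rewrite (eq_bigr _ (fun v _ => E v)) big_split /= [X in _ + X]exchange_big /=.
rewrite addnn -mul2n; congr (2 * _); rewrite -sum_size_nbrs.
apply: eq_bigr => v _; rewrite size_map size_filter -sum1_count big_enum_cond.
rewrite [RHS]big_mkcond; apply: eq_bigr => u _ /=.
by case: (u < v); case: (_ \in _).
Qed.

Let nthS (x i : nat) s : nth 0 (x :: s) i.+1 = nth 0 s i. Proof. by []. Qed.

Lemma nth_adj_words_offset u : u <= n ->
  nth 0 (adj_words adj) u.+1 = offset n nat_adj u.
Proof.
move=> leu; rewrite /adj_words nthS nth_cat size_map size_iota ltnS leu.
rewrite (nth_map 0) ?size_iota // nth_iota // add0n /offset; congr (_ + _).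
rewrite (big_ord_widen n (fun i => size (nat_adj i))) //.
by apply: eq_bigr => v _; rewrite nat_adjE size_map.
Qed.

Lemma flatten_adj :
  flatten [seq map val (adj v) | v <- enum 'I_n] = flatten [seq nat_adj u | u <- iota 0 n].
Proof.
congr flatten; rewrite -val_enum_ord -map_comp; apply: eq_map => v /=.
by rewrite nat_adjE.
Qed.

Lemma size_flatten_adj k :
  size (flatten [seq nat_adj u | u <- iota 0 k]) = \sum_(u < k) size (nat_adj u).
Proof.
by rewrite size_flatten /shape -map_comp sumnE big_map /= -(big_mkord xpredT (fun u => size (nat_adj u))) /index_iota subn0.
Qed.

Lemma nth_adj_words_list u j : u < n -> j < size (nat_adj u) ->
  nth 0 (adj_words adj) (offset n nat_adj u + j) = nth 0 (nat_adj u) j.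
Proof.
move=> ltu ltj; rewrite /offset /adj_words !addSn nthS nth_cat size_map size_iota.
rewrite ifN; last by rewrite -leqNgt -!addnA leq_addr.
rewrite subSS -addnA addKn flatten_adj.
have -> : iota 0 n = iota 0 u ++ u :: iota u.+1 (n - u.+1).
  by rewrite -(subnKC ltu) addKn -{1}[u.+1]addn1 iotaD iotaD /= -catA add0n addn1.
rewrite map_cat flatten_cat nth_cat size_flatten_adj ifN; last by rewrite -leqNgt leq_addr.
by rewrite addKn /= nth_cat ltj.
Qed.

Lemma size_adj_words : size (adj_words adj) = n.+2 + 2 * #|edges G|.
Proof.
rewrite /adj_words -cat1s !size_cat size_map size_iota flatten_adj size_flatten_adj nat_adj_sum.
by rewrite addnA add1n.
Qed.

Lemma adj_words_lt i : nth 0 (adj_words adj) i <= n.+2 + 2 * #|edges G|.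
Proof.
case: i => [|i]; first by rewrite /=; lia.
have [lti|lti] := leqP i n.
  rewrite nth_adj_words_offset //.
  by rewrite -(offset_n nat_adj_sum); apply: offset_le.
rewrite /adj_words nthS nth_cat size_map size_iota.
have -> : (i < n.+1) = false by rewrite ltnS leqNgt lti.
have [{}lti|lei] := ltnP (i - n.+1) (size (flatten [seq map val (adj v) | v <- enum 'I_n])).
  have /flattenP[s /mapP[v _ ->] /mapP[x _ ->]] := mem_nth 0 lti.
  by have := ltn_ord x; rewrite /=; lia.
by rewrite nth_default.
Qed.

(** The scan produces the neighbours in increasing order, hence the same list as
    [nbrs]. *)
Lemma row_of_pairs_nbrs (v : 'I_n) :
  sorted ltn (row_of (pairs nat_adj n) v) -> row_of (pairs nat_adj n) v = nbrs G v.
Proof.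
move=> so; apply: (irr_sorted_eq ltn_trans ltnn so (nbrs_sorted G v)) => x.
apply/mapP/idP => [[[a b]]|].
  rewrite mem_filter /= => /andP[/eqP-> /flattenP[s /mapP[u]]].
  rewrite mem_iota add0n => /= ltu -> /mapP[y]; rewrite mem_filter take_size.
  move=> /andP[uy yA] [Ea Ey] ->; move: uy yA; rewrite -Ey Ea (nat_adj_ord ltu).
  move=> uv /mapP[z zA /val_inj vz].
  have [_ M] := adjP (Ordinal ltu); move: zA; rewrite M inE -vz => e.
  by rewrite -[u]/(val (Ordinal ltu)) mem_nbrs uv e.
move=> xn; have ltx : x < n by exact: ltn_trans (nbrs_lt xn) (ltn_ord v).
have xv := nbrs_lt xn.
exists (x, val v) => //; rewrite mem_filter eqxx /=; apply/flattenP.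
exists (row_pairs nat_adj x (size (nat_adj x))).
  by apply/mapP; exists x; rewrite // mem_iota.
apply/mapP; exists (val v) => //; rewrite mem_filter xv take_size (nat_adj_ord ltx).
apply: map_f; have [_ ->] := adjP (Ordinal ltx); rewrite inE.
by move: xn; rewrite -[x]/(val (Ordinal ltx)) mem_nbrs => /andP[].
Qed.

End Adjacency.

Lemma used_map (keys : seq (seq nat)) (rows : nat -> seq nat) : uniq keys ->
  0 < size keys -> nth [::] keys 0 = [::] ->
  used keys (fun g => rows (index g keys)) =
    [seq nth [::] keys k | k <- iota 1 (size keys).-1 & rows k != [::]].
Proof.
move=> U S0 k0.
have E : keys = [::] :: [seq nth [::] keys k | k <- iota 1 (size keys).-1].
  rewrite -{1}(mkseq_nth [::] keys) /mkseq.
  by case: (size keys) S0 => // K _ /=; rewrite k0.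
rewrite /used [X in filter _ X]E /= filter_map; congr map; apply: eq_in_filter => k.
rewrite mem_iota add1n prednK // => /andP[k_gt0 ltk] /=.
rewrite index_uniq //.
have : nth [::] keys k != nth [::] keys 0 by rewrite nth_uniq // -lt0n.
by rewrite k0 => ->.
Qed.

Section Family.

Variables (n : nat) (G : sgraph n) (L M : nat).

(** The trie and the lists of rows after the last flush. *)
Definition final_family (keys : seq (seq nat)) (rows : nat -> seq nat) : Prop :=
  [/\ uniq keys, 0 < size keys /\ nth [::] keys 0 = [::],
    forall v g, g \in groups L M (nbrs G v) -> g \in keys
    & forall i, i < size keys -> uniq (rows i) /\
      forall x, x \in rows i <-> exists2 v : 'I_n, x = v :> nat &
        nth [::] keys i \in groups L M (nbrs G v)].

Variables (keys : seq (seq nat)) (rows : nat -> seq nat).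
Hypothesis fam : final_family keys rows.

Definition key_rows (g : seq nat) : seq nat := rows (index g keys).

Let keys_uniq : uniq keys. Proof. by case: fam. Qed.

Let keys_groups v g : g \in groups L M (nbrs G v) -> g \in keys.
Proof. by case: fam => _ _ H _; exact: H. Qed.

Let rows_uniq g : g \in keys -> uniq (key_rows g).
Proof. by rewrite -index_mem => lti; case: fam => _ _ _ /(_ _ lti)[]. Qed.

Let mem_rows g x : g \in keys ->
  reflect (exists2 v : 'I_n, x = v :> nat & g \in groups L M (nbrs G v))
    (x \in key_rows g).
Proof.
move=> gk; have lti : index g keys < size keys by rewrite index_mem.
have [_ _ _ /(_ _ lti)[_ /(_ x)]] := fam; rewrite nth_index // => -[h1 h2].
by apply: (iffP idP).
Qed.

Definition family_sides : side_lists n := blist n keys key_rows.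

Lemma family_partition : biclique_partition G (decode family_sides).
Proof. exact: blist_partition keys_uniq keys_groups mem_rows. Qed.

Lemma family_uniq : uniq_sides family_sides.
Proof. exact: blist_uniq_sides rows_uniq mem_rows. Qed.

Let wordsE g : g \in used keys key_rows ->
  (size (ords n g) :: map val (ords n g)) ++
  (size (ords n (key_rows g)) :: map val (ords n (key_rows g))) =
  size g :: g ++ size (key_rows g) :: key_rows g.
Proof.
move=> gu; have gk : g \in keys by move: gu; rewrite mem_filter => /andP[].
have E1 := val_ords (used_lt mem_rows gu).
have E2 := val_ords (rows_lt mem_rows gk).
have S1 : size (ords n g) = size g by rewrite -[in RHS]E1 size_map.
have S2 : size (ords n (key_rows g)) = size (key_rows g) by rewrite -[in RHS]E2 size_map.
by rewrite E1 E2 S1 S2.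
Qed.

Let outE : out keys rows (size keys).-1 =
  flatten [seq size g :: g ++ size (key_rows g) :: key_rows g
          | g <- used keys key_rows].
Proof.
have [U [S0 k0] _ _] := fam; rewrite used_map // -map_comp /out; congr flatten.
apply/eq_in_map => k; rewrite mem_filter mem_iota => /andP[_ /andP[k1 ltk]].
by rewrite /= /block /key_rows index_uniq // -(prednK S0).
Qed.

Lemma side_words_family :
  side_words family_sides = used_nodes rows (size keys).-1 :: out keys rows (size keys).-1.
Proof.
have [U [S0 k0] _ _] := fam; rewrite /side_words; congr cons.
  by rewrite size_map used_map // size_map size_filter.
rewrite outE -map_comp; congr flatten; apply/eq_in_map => g gu.
exact: wordsE.
Qed.

Lemma size_out_family : size (out keys rows (size keys).-1) <= 4 * #|edges G|.
Proof.
rewrite outE size_flatten /shape -map_comp sumnE big_map.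
apply: (@leq_trans (2 * weight (decode family_sides))); last first.
  by have := weight_le family_partition; lia.
rewrite (weight_blist rows_uniq mem_rows) big_distrr /=.
rewrite big_seq [X in _ <= X]big_seq; apply: leq_sum => g gu.
have : 0 < size g /\ 0 < size (key_rows g).
  by move: gu; rewrite mem_filter -!size_eq0 -!lt0n => /andP[/andP[]].
by rewrite /= size_cat /=; lia.
Qed.

Hypotheses (L_gt0 : 0 < L) (M_gt0 : 0 < M).

Lemma family_weight : exists a b : nat,
  [/\ weight (decode family_sides) <= n + (a + b) + L * (n * (L * (L * M))),
      a * L <= 'C(n, 2) & M ^ b <= L ^ b * 'C('C(n, 2), #|edges G|)].
Proof.
exact: (weight_bound L_gt0 M_gt0 keys_uniq rows_uniq mem_rows).
Qed.

End Family.

Section Program.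

Variables (n : nat) (G : sgraph n) (adj : 'I_n -> seq 'I_n).
Hypotheses (adjP : adjacency_list G adj) (n_gt1 : 1 < n).

Let m := #|edges G|.

Hypotheses (m_gt0 : 0 < m) (ltmN : m < 'C(n, 2)).

Let L := width_bound n m.
Let M := choice_bound n m.
Let w := 20 * up_log 2 n.
Let X := n ^ 8.
Let A := nat_adj adj.

Let leXw : 16 * X * X <= 2 ^ w.
Proof.
rewrite /w [20 * _]mulnC expnM; apply: (@leq_trans (n ^ 4 * n ^ 8 * n ^ 8)); last first.
  by rewrite -!expnD -[4 + 8 + 8]/20 leq_exp2r // up_logP.
apply: leq_mul => //; apply: leq_mul => //.
by apply: (@leq_trans (2 ^ 4)) => //; rewrite leq_exp2r.
Qed.

Let X_bounds' : [/\ 16 <= X, 8 * (n * n) + 8 * n < X, L + 1 < X, M <= n & 2 * m <= n * n].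
Proof.
have [b1 b2 _] := memory_bounds n_gt1; split => //.
- exact: width_bound_lt.
- exact: choice_bound_le.
- by have := pairs_le n; move: ltmN; rewrite -/m; lia.
Qed.

Definition output_spec (s : store) : Prop := exists keys rows,
  [/\ final_family G L M keys rows,
    ar s aOUT 0 0 = used_nodes rows (size keys).-1
    & forall k, k < size (out keys rows (size keys).-1) ->
          ar s aOUT 0 k.+1 = nth 0 (out keys rows (size keys).-1) k].

Lemma wp_main_part s : vr s xn = n -> is_input n A s ->
  (forall a i j, 0 < a < 10 -> ar s a i j = 0) ->
  wp w X main_part (5000 * (n + L * L + m)) output_spec s.
Proof.
move=> sn In Z; have [X16 X2 LX Mn m2] := X_bounds'.
have L0 : 0 < L by exact: width_bound_gt0.
have LL : L <= L * L by rewrite leq_pmulr.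
have n0 : 0 < n by slia.
have A_sum : \sum_(u < n) size (A u) = 2 * m by exact: nat_adj_sum.
have A_lt u x : u < n -> x \in A u -> x < n by exact: nat_adj_lt.
have A_uniq u : u < n -> uniq (A u) by move=> ltu; exact: nat_adj_uniq adjP _ ltu.
rewrite /main_part.
apply: (wp_seq X16 leXw (T1 := 100 * n + 100)); last by slia.
apply: wp_mono (wp_log_loop n_gt1 m_gt0 ltmN leXw A_sum sn) _ _ => // s1 [s1n s1l s1a].
have In1 : is_input n A s1 by move: In; rewrite /is_input s1a.
apply: (wp_seq X16 leXw (T1 := 200)); last by slia.
apply: wp_mono (wp_set_parameters n_gt1 m_gt0 ltmN leXw A_sum s1n s1l In1) _ _ => //.
move=> s2 [s2n s2L s2M s2a].
have Z2 a i j : 0 < a < 10 -> ar s2 a i j = 0 by rewrite s2a s1a; exact: Z.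
apply: (wp_seq X16 leXw (T1 := 200 * (L * L + 2 * L + 1))); last by slia.
have Z9 i j : ar s2 aPAS i j = 0 by exact: Z2.
apply: wp_mono (wp_pascal n_gt1 m_gt0 ltmN leXw A_sum s2n s2L s2M Z9) _ _ => //.
move=> s3 [s3n s3L s3M s3P s3a].
have P3 : pascal_ok n L M s3 by [].
have In3 : is_input n A s3 by move: In; rewrite /is_input s3a // s2a s1a.
have Z3 a i j : 0 < a < 9 -> ar s3 a i j = 0.
  case/andP=> a0 a9; rewrite s3a; last by rewrite neq_ltn a9.
  by apply: Z2; rewrite a0 (ltn_trans a9).
apply: (wp_seq X16 leXw (T1 := 1000 * (2 * m + n + 1))); last by slia.
apply: wp_mono (wp_scan_edges X16 leXw n0 X2 LX Mn m2 A_sum A_lt A_uniq P3 In3 Z3) _ _ => //.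
move=> s4 [s4n Sc4].
have sorted4 v : sorted ltn (row_of (pairs A n) v).
  by have [? [? [? [_ [_ _ _ _]]]]] := Sc4; apply.
have rowE (v : 'I_n) : row_of (pairs A n) v = nbrs G v.
  by apply: row_of_pairs_nbrs adjP _ _; exact: sorted4.
have szP : size (pairs A n) <= 2 * m by rewrite -A_sum; exact: size_pairs.
apply: (wp_seq X16 leXw (T1 := 200 * n + 50)); last by slia.
have szP2 : size (pairs A n) + 2 < X by slia.
apply: wp_mono (wp_flush_all X16 leXw n0 X2 LX Mn s4n Sc4 szP2) _ _ => //.
move=> s5 [keys [rows [cur [R5 Hk Hr Hs]]]].
have [[U [S0 k0] _ _ _] _ Li5 _] := R5.
have fam : final_family G L M keys rows.
  split => // [v g|i lti]; first by rewrite -rowE; exact: Hk.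
  split; first by case: (Li5 i).
  move=> x; rewrite Hr //; split => [/andP[ltx xg]|[v -> vg]].
    by exists (Ordinal ltx); rewrite // -rowE.
  by rewrite ltn_ord rowE.
have szO := size_out_family fam.
have ltkX : size keys < X by slia.
have ltO : size (out keys rows (size keys).-1) + 3 < X.
  by move: szO; rewrite -/m; slia.
apply: wp_mono (wp_write_output X16 leXw n0 X2 LX Mn ltkX R5 ltO) _ _.
  by move: szO; rewrite -/m; slia.
by move=> s6 [c6 o6]; exists keys, rows.
Qed.

Let wrap_small x : x < X -> Defs.wrap w x = x.
Proof.
have [X16 _ _ _ _] := X_bounds'.
by move=> ltx; rewrite /Defs.wrap modn_small //; apply: leq_trans leXw; nia.
Qed.

Let input := adj_words adj.

Let size_input : size input < X.
Proof.
have [X16 X2 _ _ m2] := X_bounds'.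
by rewrite (size_adj_words adjP) -/m; slia.
Qed.

Let mem_init i : Defs.mem (init_state w input) i = nth 0 input i.
Proof.
have [X16 X2 _ _ m2] := X_bounds'.
rewrite /= wrap_small //; apply: leq_ltn_trans (adj_words_lt adjP i) _.
by rewrite -/m; slia.
Qed.

Lemma exec_load_size : exists s,
  [/\ exec w load_size (init_state w input) 4 s, reg s 1 = X, reg s xn = n
    & Defs.mem s = Defs.mem (init_state w input)].
Proof.
have [X16 X2 _ _ _] := X_bounds'.
have lt2 : n * n < X by slia.
have lt4 : n * n * (n * n) < X.
  by rewrite -[n * n]/(n ^ 2) -expnD; apply: exp_lt_memory.
have EX : n * n * (n * n) * (n * n * (n * n)) = X.
  by rewrite -[n * n]/(n ^ 2) -!expnD.
have ltXw : X < 2 ^ w by apply: leq_trans leXw; nia.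
pose s1 := set_reg (init_state w input) xn n.
pose s2 := set_reg s1 1 (n * n).
pose s3 := set_reg s2 1 (n * n * (n * n)).
exists (set_reg s3 1 X); split => //.
rewrite -[4]/(1 + (1 + (1 + 1))).
have E1 : s1 = set_reg (init_state w input) xn
    (Defs.mem (init_state w input) (reg (init_state w input) 0)).
  by rewrite mem_init.
apply: (@ExecSeq _ _ _ _ s1); first by rewrite E1; exact: ExecRead.
have E2 : s2 = set_reg s1 1 (binop_val w Mul (reg s1 xn) (reg s1 xn)).
  by rewrite /binop_val /= wrap_small.
apply: (@ExecSeq _ _ _ _ s2); first by rewrite E2; exact: ExecBinop.
have E3 : s3 = set_reg s2 1 (binop_val w Mul (reg s2 1) (reg s2 1)).
  by rewrite /binop_val /= wrap_small.
apply: (@ExecSeq _ _ _ _ s3); first by rewrite E3; exact: ExecBinop.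
have E4 : set_reg s3 1 X = set_reg s3 1 (binop_val w Mul (reg s3 1) (reg s3 1)).
  by rewrite /binop_val /= EX /Defs.wrap modn_small.
by rewrite E4; exact: ExecBinop.
Qed.

Lemma exec_output_address s : reg s 1 = X -> exists s',
  [/\ exec w output_address s 3 s', reg s' 0 = addr X aOUT 0 0
    & Defs.mem s' = Defs.mem s].
Proof.
move=> s1; have [X16 X2 _ _ _] := X_bounds'.
have lt1 : aOUT * X < 2 ^ w by apply: leq_trans leXw; nia.
have lt2 : aOUT * X * X < 2 ^ w by apply: leq_trans leXw; nia.
pose t1 := set_reg s 0 aOUT; pose t2 := set_reg t1 0 (aOUT * X).
exists (set_reg t2 0 (aOUT * X * X)); split => //.
  rewrite -[3]/(1 + (1 + 1)).
  have E1 : t1 = set_reg s 0 (Defs.wrap w aOUT) by rewrite wrap_small //; slia.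
  apply: (@ExecSeq _ _ _ _ t1); first by rewrite E1; exact: ExecConst.
  have E2 : t2 = set_reg t1 0 (binop_val w Mul (reg t1 0) (reg t1 1)).
    by rewrite /binop_val /= s1 /Defs.wrap modn_small.
  apply: (@ExecSeq _ _ _ _ t2); first by rewrite E2; exact: ExecBinop.
  have E3 : set_reg t2 0 (aOUT * X * X) =
      set_reg t2 0 (binop_val w Mul (reg t2 0) (reg t2 1)).
    by rewrite /binop_val /= s1 /Defs.wrap modn_small.
  by rewrite E3; exact: ExecBinop.
by rewrite /= /addr !addn0.
Qed.

Lemma program_correct : exists t P,
  [/\ computes_partition program w G adj t P, t <= 5000 * (n + L * L + m) + 10
    & exists a b : nat,
      [/\ weight P <= n + (a + b) + L * (n * (L * (L * M))),
          a * L <= 'C(n, 2) & M ^ b <= L ^ b * 'C('C(n, 2), m)]].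
Proof.
have [X16 X2 LX Mn m2] := X_bounds'.
have [s1 [ex1 r1X r1n m1]] := exec_load_size.
pose s := Store (reg s1) (fun a i j => Defs.mem s1 (addr X a i j)).
have rel : related X s1 s by split.
have In : is_input n A s.
  split => [u leu|u j ltu ltj]; rewrite /= m1 mem_init /addr /= ?mul0n ?add0n.
    exact: nth_adj_words_offset.
  exact: nth_adj_words_list.
have Z a i j : 0 < a < 10 -> ar s a i j = 0.
  move=> /andP[a0 _]; rewrite /= m1 mem_init nth_default //.
  apply: leq_trans (ltnW size_input) _; rewrite /addr.
  apply: (@leq_trans (a * X)); first by rewrite leq_pmull.
  apply: leq_trans (leq_addr i _) _; apply: leq_trans (leq_addr j _).
  by rewrite leq_pmulr; slia.
have sn : vr s xn = n by [].
have [t2 [s2 [s' [ex2 rel2 spec le2]]]] := wp_main_part sn In Z rel.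
have [q1 _ qm] := rel2; have [s3 [ex3 r3 m3]] := exec_output_address q1.
have [keys [rows [fam o0 o1]]] := spec.
exists (4 + (t2 + 3)), (decode (family_sides n keys rows)); split.
- exists s3, (family_sides n keys rows); split => //.
  + by apply: ExecSeq ex1 _; apply: ExecSeq ex2 _.
  + exact: family_uniq fam.
  + have := size_out_family fam; rewrite -/m => szO.
    rewrite (side_words_family fam) /stored r3 /=; split.
      by apply: leq_trans leXw; rewrite /addr; nia.
    move=> i lti; have ltiX : i < X by slia.
    have -> : addr X 10 0 0 + i = addr X 10 0 i by rewrite /addr !addn0.
    rewrite m3 qm //; last by slia.
    by case: i lti ltiX => [|i] lti _ //=; rewrite o1.
  + exact: family_partition fam.
- by move: le2; slia.
- exact: (family_weight fam (width_bound_gt0 n_gt1 m) (choice_bound_gt0 n m)).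
Qed.

End Program.

From mathcomp Require Import all_classical all_reals all_analysis.
From mathcomp Require Import ring lra.

Import numFieldNormedType.Exports.

Local Open Scope classical_set_scope.
Local Open Scope ring_scope.

(** * Asymptotics *)

Section Asymptotics.

Variable R : realType.

Implicit Types (x y g eps : R) (n m : nat).

Let ln2_gt0 : 0 < ln 2 :> R.
Proof. by apply: ln_gt0; rewrite ltr1n. Qed.

Let ln2_le1 : ln 2 <= 1 :> R.
Proof. by have := @le_ln1Dx R 1; rewrite -[1 + 1]/(2%:R); apply; lra. Qed.

Lemma h2_ln2 g : h2 g * ln 2 = - g * ln g - (1 - g) * ln (1 - g).
Proof. by rewrite /h2 /lg; field; rewrite gt_eqF. Qed.

(** From ln x <= x - 1. *)
Lemma h2_ge g : 0 < g < 1 -> 2 * (g * (1 - g)) <= h2 g * ln 2.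
Proof.
move=> /andP[g0 g1]; rewrite h2_ln2.
have lnle x : 0 < x -> ln x <= x - 1.
  move=> x0; rewrite -{1}(subrKC 1 x); apply: le_ln1Dx; lra.
have h1 := lnle _ g0; have h2 : ln (1 - g) <= (1 - g) - 1 by apply: lnle; lra.
have : g * ln g <= g * (g - 1) by rewrite ler_pM2l.
have : (1 - g) * ln (1 - g) <= (1 - g) * ((1 - g) - 1) by rewrite ler_pM2l //; lra.
lra.
Qed.

Lemma h2_gt0 g : 0 < g < 1 -> 0 < h2 g.
Proof.
move=> g01; rewrite -(pmulr_lgt0 _ ln2_gt0); apply: lt_le_trans (h2_ge g01).
by case/andP: g01 => g0 g1; rewrite mulr_gt0 // mulr_gt0 // subr_gt0.
Qed.

Section Entropy.

Variables (N m : nat) (g : R).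
Hypotheses (m_gt0 : (0 < m)%N) (ltmN : (m < N)%N) (mE : m%:R = g * N%:R).

Let N_gt0 : (0 < N)%N. Proof. exact: leq_ltn_trans ltmN. Qed.

Let NR : 0 < N%:R :> R. Proof. by rewrite ltr0n. Qed.

Let entropyE : N%:R * (h2 g * ln 2) =
  N%:R * ln N%:R - m%:R * ln m%:R - (N - m)%:R * ln (N - m)%:R.
Proof.
have gE : g = m%:R / N%:R by rewrite mE mulfK // gt_eqF.
have g'E : 1 - g = (N - m)%:R / N%:R.
  by rewrite gE natrB ?(ltnW ltmN) //; field; rewrite gt_eqF.
have lng : ln g = ln m%:R - ln N%:R.
  by rewrite gE ln_div // posrE ltr0n.
have lng' : ln (1 - g) = ln (N - m)%:R - ln N%:R.
  by rewrite g'E ln_div // posrE ltr0n // subn_gt0.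
rewrite h2_ln2 lng lng'.
have -> : (N - m)%:R = N%:R - m%:R :> R by rewrite natrB // ltnW.
rewrite mE; ring.
Qed.

Let lnE : ln ('C(N, m) * (m ^ m * (N - m) ^ (N - m)))%:R =
  ln 'C(N, m)%:R + m%:R * ln m%:R + (N - m)%:R * ln (N - m)%:R :> R.
Proof.
have h1 : (0 < 'C(N, m))%N by rewrite bin_gt0 ltnW.
have h2 : (0 < N - m)%N by rewrite subn_gt0.
rewrite !natrM !natrX !lnM ?posrE ?mulr_gt0 ?exprn_gt0 ?ltr0n //.
by rewrite !lnXn ?ltr0n // addrA 2!mulr_natl.
Qed.

Let lnNN : ln (N ^ N)%:R = N%:R * ln N%:R :> R.
Proof. by rewrite natrX lnXn // mulr_natl. Qed.

Let prod_gt0 : (0 < 'C(N, m) * (m ^ m * (N - m) ^ (N - m)))%N.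
Proof. by rewrite !muln_gt0 bin_gt0 !expn_gt0 subn_gt0 ltmN m_gt0 ltnW. Qed.

Lemma ln_bin_le : ln 'C(N, m)%:R <= N%:R * (h2 g * ln 2).
Proof.
have : ln ('C(N, m) * (m ^ m * (N - m) ^ (N - m)))%:R <= ln (N ^ N)%:R :> R.
  by rewrite ler_ln ?posrE ?ltr0n ?expn_gt0 ?N_gt0 ?ler_nat //; exact: bin_type_le.
by rewrite lnE lnNN entropyE; lra.
Qed.

Lemma ln_bin_ge : N%:R * (h2 g * ln 2) <= ln N.+1%:R + ln 'C(N, m)%:R.
Proof.
have : ln (N ^ N)%:R <=
    ln (N.+1 * ('C(N, m) * (m ^ m * (N - m) ^ (N - m))))%:R :> R.
  rewrite ler_ln ?posrE ?ltr0n ?muln_gt0 ?expn_gt0 ?N_gt0 ?ler_nat //.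
    exact: bin_type_ge.
  by rewrite bin_gt0 subn_gt0 ltmN m_gt0 (ltnW ltmN).
rewrite natrM lnM ?posrE ?ltr0n // lnE lnNN entropyE; lra.
Qed.

End Entropy.

Definition main_term n g : R := h2 g / 2 * (n%:R ^+ 2 / lg n%:R).

Section FixedSize.

Variables (n m : nat) (g : R).
Hypotheses (n_gt1 : (1 < n)%N) (g01 : 0 < g < 1).
Hypothesis mE : m%:R = g * 'C(n, 2)%:R.

Let nR : 1 < n%:R :> R. Proof. by rewrite ltr1n. Qed.

Let lnn_gt0 : 0 < ln n%:R :> R. Proof. exact: ln_gt0. Qed.

Let N_gt0 : (0 < 'C(n, 2))%N. Proof. by rewrite bin_gt0. Qed.

Lemma edges_gt0 : (0 < m)%N.
Proof. by rewrite -(ltr0n R) mE; case/andP: g01 => g0 _; rewrite mulr_gt0 // ltr0n. Qed.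

Lemma edges_lt : (m < 'C(n, 2))%N.
Proof.
rewrite -(ltr_nat R) mE; case/andP: g01 => _ g1.
by rewrite gtr_pMl // ltr0n.
Qed.

Let binR : 'C(n, 2)%:R = n%:R * (n%:R - 1) / 2 :> R.
Proof.
have h : (2 * 'C(n, 2) = n * (n - 1))%N by rewrite -mul_bin_diag bin1 subn1.
have : (2 * 'C(n, 2))%:R = (n * (n - 1))%:R :> R by rewrite h.
by rewrite !natrM natrB ?(ltnW n_gt1) //; lra.
Qed.

Lemma lg_n_gt0 : 0 < lg n%:R :> R. Proof. by rewrite divr_gt0. Qed.

Lemma main_term_gt0 : 0 < main_term n g.
Proof.
by rewrite mulr_gt0 ?divr_gt0 ?h2_gt0 ?exprn_gt0 ?lg_n_gt0 //; apply: lt_trans nR.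
Qed.

(** Both bounds on bp are this entropy divided by ln n, up to a factor that
    tends to 1. *)
Lemma entropy_main_term :
  'C(n, 2)%:R * (h2 g * ln 2) = main_term n g * ln n%:R * (1 - n%:R^-1).
Proof.
have n0 : 0 < n%:R :> R by apply: lt_trans nR.
by rewrite binR /main_term /lg; field; rewrite !gt_eqF.
Qed.

Local Notation L := (width_bound n m).

Let q_lt : ('C(n, 2) * 'C(n, 2) < (m * ('C(n, 2) - m)) *
  ('C(n, 2) * 'C(n, 2) %/ (m * ('C(n, 2) - m)) + 1))%N.
Proof.
rewrite addn1 mulnC; apply: ltn_ceil.
by rewrite muln_gt0 edges_gt0 subn_gt0 edges_lt.
Qed.

Let LR_gt0 : 0 < L%:R :> R. Proof. by rewrite ltr0n width_bound_gt0. Qed.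

Let diffR : ('C(n, 2) - m)%:R = (1 - g) * 'C(n, 2)%:R :> R.
Proof. by rewrite natrB ?(ltnW edges_lt) // mE; ring. Qed.

Let g2_gt0 : 0 < g * (1 - g).
Proof. by case/andP: g01 => g0 g1; rewrite mulr_gt0 // subr_gt0. Qed.

Let NR : 0 < 'C(n, 2)%:R :> R. Proof. by rewrite ltr0n. Qed.

Lemma up_log_ge : lg n%:R <= (up_log 2 n)%:R :> R.
Proof.
rewrite /lg ler_pdivrMr // mulr_natl.
have := up_logP n (ltnSn 1); rewrite -(ler_nat R) natrX => h.
have n0 : 0 < n%:R :> R by apply: lt_trans nR.
by move: h; rewrite -ler_ln ?posrE ?exprn_gt0 // lnXn.
Qed.

Lemma up_log_le_ln : (up_log 2 n)%:R <= 2 * ln n%:R / ln 2 :> R.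
Proof.
have ul0 : (0 < up_log 2 n)%N by exact: up_log_gt0.
have : (2 ^ (up_log 2 n).-1 < n)%N by rewrite lt_up_log prednK.
rewrite -(ltr_nat R) natrX => h.
have n0 : 0 < n%:R :> R by apply: lt_trans nR.
move: h; rewrite -ltr_ln ?posrE ?exprn_gt0 // lnXn // -[ln 2 *+ _]mulr_natr.
have -> : (up_log 2 n).-1%:R = (up_log 2 n)%:R - 1 :> R.
  by rewrite -subn1 natrB.
have : ln 2 <= ln n%:R :> R by rewrite ler_ln ?posrE // ler_nat.
by rewrite ler_pdivlMr // => h1 h2; lra.
Qed.

Lemma width_bound_ge : lg n%:R ^+ 2 <= L%:R * (g * (1 - g)).
Proof.
have uR := up_log_ge; have l0 := lg_n_gt0.
have qR : 1 <= ('C(n, 2) * 'C(n, 2) %/ (m * ('C(n, 2) - m)) + 1)%:R * (g * (1 - g)) :> R.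
  move: q_lt; rewrite -(ltr_nat R) !natrM diffR mE => h.
  rewrite -(ler_pM2r (mulr_gt0 NR NR)); apply/ltW; lra.
rewrite /width_bound 2!natrM -mulrA; apply: (@le_trans _ _ ((up_log 2 n)%:R ^+ 2 * 1)).
  by rewrite mulr1 ler_sqr ?nnegrE //; apply: ltW.
by rewrite expr2 ler_pM2l // mulr_gt0 // ltr0n up_log_gt0.
Qed.

Lemma width_bound_le_real :
  L%:R * (g * (1 - g)) <= 2 * (up_log 2 n)%:R ^+ 2.
Proof.
have qR : ('C(n, 2) * 'C(n, 2) %/ (m * ('C(n, 2) - m)))%:R * (g * (1 - g)) <= 1 :> R.
  have := leq_trunc_div ('C(n, 2) * 'C(n, 2)) (m * ('C(n, 2) - m)).
  rewrite -(ler_nat R) !natrM diffR mE => h.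
  rewrite -(ler_pM2r (mulr_gt0 NR NR)); lra.
have g4 : g * (1 - g) <= 1 by case/andP: g01 => g0 g1; nra.
have : 0 <= (up_log 2 n)%:R ^+ 2 :> R by rewrite exprn_ge0.
rewrite /width_bound 2!natrM -mulrA natrD => u0.
rewrite -expr2 [2 * _]mulrC; apply: ler_wpM2l => //; lra.
Qed.

(** The error terms n^2/L are of smaller order than the main term. *)
Lemma width_bound_main_term : n%:R ^+ 2 / L%:R <= main_term n g / lg n%:R.
Proof.
have hl := width_bound_ge; have l0 := lg_n_gt0.
have hh : g * (1 - g) <= h2 g / 2.
  have h := h2_ge g01; have h0 := h2_gt0 g01.
  have : h2 g * ln 2 <= h2 g by rewrite ger_pMr.
  lra.
rewrite ler_pdivrMr // /main_term.
have -> : h2 g / 2 * (n%:R ^+ 2 / lg n%:R) / lg n%:R * L%:R =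
   n%:R ^+ 2 * (L%:R * (h2 g / 2) / lg n%:R ^+ 2).
  by field; rewrite gt_eqF.
rewrite ler_peMr ?exprn_ge0 // ler_pdivlMr ?exprn_gt0 // mul1r.
by apply: le_trans hl _; rewrite ler_pM2l.
Qed.

Let L_gt0 : (0 < L)%N. Proof. exact: width_bound_gt0. Qed.

Let n_gt0 : 0 < n%:R :> R. Proof. exact: lt_trans nR. Qed.

Let lnL_ge0 : 0 <= ln L%:R :> R. Proof. by apply: ln_ge0; rewrite ler1n. Qed.

Let choiceE :
  choice_bound n m = maxn 1 (n %/ (L * L * L * L))%N.
Proof. by rewrite /choice_bound -!divnMA !mulnA. Qed.

Let N_le : 'C(n, 2)%:R <= n%:R ^+ 2 / 2 :> R.
Proof. by rewrite binR expr2; have := n_gt0; lra. Qed.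

(** The number b of groups closed because of M is at most
    lg C(C(n, 2), m) / (lg M - lg L), which is the main term up to 1 + o(1); the
    three other terms of the weight are at most n^2 / L. *)
Lemma upper_bound eps (W a b : nat) : 0 < eps <= 1 / 2 ->
  10 * ln L%:R <= eps * ln n%:R -> 10 * ln 2 <= eps * ln n%:R ->
  3 <= eps * lg n%:R ->
  (W <= n + (a + b) + L * (n * (L * (L * choice_bound n m))))%N ->
  (a * L <= 'C(n, 2))%N ->
  (choice_bound n m ^ b <= L ^ b * 'C('C(n, 2), m))%N ->
  W%:R <= (1 + 3 * eps) * main_term n g.
Proof.
move=> /andP[e0 e1] + h2' hlg.
have := width_bound_main_term; have := choice_bound_gt0 n m; have := choiceE.
have := lnL_ge0; have := L_gt0.
(* only these properties of the two bounds matter *)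
move: L (choice_bound n m) => K M K_gt0 l0 choiceK M_gt0 hE hL hW ha hb.
set MT := main_term n g.
have MT0 : 0 < MT by exact: main_term_gt0.
have x0 := lnn_gt0; have c0 := ln2_gt0.
set x := ln n%:R in hL h2' x0; set l := ln K%:R in hL l0.
have ex : eps * x <= x by rewrite ger_pMl //; lra.
have L4 : (K * K * K * K <= n)%N.
  rewrite -(ler_nat R) -ler_ln ?posrE ?ltr0n ?muln_gt0 ?K_gt0 ?(ltnW n_gt1) //.
  rewrite !natrM !lnM ?posrE ?mulr_gt0 ?ltr0n // -/l -/x; lra.
have ML4 : (M * (K * K * K * K) <= n)%N.
  rewrite choiceK (maxn_idPr _) ?leq_trunc_div //.
  by rewrite divn_gt0 // !muln_gt0 K_gt0.
have nML : (n <= 2 * M * (K * K * K * K))%N.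
  have K0 : (0 < K * K * K * K)%N by rewrite !muln_gt0 K_gt0.
  apply/ltnW/(leq_trans (ltn_ceil n K0)); rewrite leq_mul2r; apply/orP; right.
  have : (n %/ (K * K * K * K) <= M)%N by rewrite choiceK leq_maxr.
  by move=> h; rewrite mul2n -addnn -addn1 leq_add.
have lnM_ge : (1 - eps) * x <= ln M%:R - l.
  have MR : 0 < M%:R :> R by rewrite ltr0n.
  have KR : 0 < K%:R :> R by rewrite ltr0n.
  have : x <= ln ((2 * M * (K * K * K * K))%:R : R).
    by rewrite ler_ln ?posrE ?ltr0n ?ler_nat // ?(ltnW n_gt1) ?muln_gt0 ?K_gt0 ?M_gt0.
  rewrite !natrM !lnM ?posrE ?mulr_gt0 // -/l; lra.
have MTx : 'C(n, 2)%:R * (h2 g * ln 2) <= MT * x.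
  have : 0 < MT * x * n%:R^-1 by apply: mulr_gt0; [exact: mulr_gt0|rewrite invr_gt0].
  rewrite entropy_main_term -/MT -/x; lra.
have b_le : b%:R * (1 - eps) <= MT.
  have C0 : (0 < 'C('C(n, 2), m))%N by rewrite bin_gt0 ltnW // edges_lt.
  have hb' : b%:R * ln M%:R <= b%:R * l + ln 'C('C(n, 2), m)%:R.
    rewrite !mulr_natl -!lnXn ?ltr0n // -lnM ?posrE ?exprn_gt0 ?ltr0n //.
    rewrite ler_ln ?posrE ?mulr_gt0 ?exprn_gt0 ?ltr0n //.
    by rewrite -!natrX -natrM ler_nat.
  have hC : ln 'C('C(n, 2), m)%:R <= MT * x.
    by apply: le_trans MTx; apply: ln_bin_le mE; [exact: edges_gt0|exact: edges_lt].
  rewrite -(ler_pM2r x0) -mulrA.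
  apply: (@le_trans _ _ (b%:R * (ln M%:R - l))); first by rewrite ler_wpM2l.
  lra.
have b_le' : b%:R <= (1 + 2 * eps) * MT.
  have : b%:R * (1 - eps) * (1 + 2 * eps) <= MT * (1 + 2 * eps).
    by rewrite ler_wpM2r //; lra.
  have b0 : 0 <= b%:R :> R by [].
  have : 0 <= b%:R * (eps * (1 - 2 * eps)) by rewrite mulr_ge0 // mulr_ge0; lra.
  lra.
pose E : R := n%:R ^+ 2 / K%:R; have KR : 0 < K%:R :> R by rewrite ltr0n.
have E_le : E <= MT / lg n%:R by exact: hE.
have a_le : a%:R <= E.
  rewrite ler_pdivlMr // -natrM; apply: (@le_trans _ _ 'C(n, 2)%:R).
    by rewrite ler_nat.
  have := N_le; have : 0 <= n%:R ^+ 2 :> R by rewrite exprn_ge0.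
  lra.
have n_le : n%:R <= E.
  rewrite ler_pdivlMr // expr2 ler_pM2l // ler_nat.
  apply: leq_trans L4; rewrite -!mulnA leq_pmulr // !muln_gt0 K_gt0 //.
have d_le : (K * (n * (K * (K * M))))%:R <= E.
  rewrite ler_pdivlMr // -natrM -natrX ler_nat.
  have -> : (K * (n * (K * (K * M))) * K = n * (M * (K * K * K * K)))%N by ring.
  by rewrite -[(n ^ 2)%N]/(n * n)%N leq_mul2l ML4 orbT.
have E3 : 3 * E <= eps * MT.
  have lg0 := lg_n_gt0.
  apply: (@le_trans _ _ (3 * (MT / lg n%:R))); first by rewrite ler_pM2l.
  rewrite mulrA ler_pdivrMr //; have := ler_wpM2l (ltW MT0) hlg; lra.
have : W%:R <= (n + (a + b) + K * (n * (K * (K * M))))%:R :> R by rewrite ler_nat.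
rewrite !natrD in d_le *; lra.
Qed.

(** Logarithms turn the counting of words into W (lg n + 2) >= lg C(C(n, 2), m). *)
Lemma lower_bound eps (W : nat) : 0 < eps ->
  ln L%:R <= ln n%:R :> R -> ln 4 <= eps * ln n%:R -> 3 <= eps * n%:R ->
  ln 2 <= ln n%:R :> R ->
  ('C('C(n, 2), m) <= (4 * n) ^ W)%N ->
  (1 - 2 * eps) * main_term n g <= W%:R.
Proof.
move=> e0 hL h4 h3 h2' hC.
set MT := main_term n g; have MT0 : 0 < MT by exact: main_term_gt0.
have x0 := lnn_gt0; set x := ln n%:R in hL h4 h2' x0.
have C0 : (0 < 'C('C(n, 2), m))%N by rewrite bin_gt0 ltnW // edges_lt.
have lnC : ln 'C('C(n, 2), m)%:R <= W%:R * (ln 4 + x).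
  have F0 : (0 < 4 * n)%N by rewrite muln_gt0 (ltnW n_gt1).
  have : ln 'C('C(n, 2), m)%:R <= ln ((4 * n) ^ W)%:R :> R.
    by rewrite ler_ln ?posrE ?ltr0n ?expn_gt0 ?F0 // ler_nat.
  by rewrite natrX lnXn ?ltr0n // natrM lnM ?posrE // mulr_natl.
have lnN : ln ('C(n, 2).+1)%:R <= 2 * x.
  have le_nn : ('C(n, 2).+1 <= n ^ 2)%N.
    move: (pairs_le n) (leq_mul n_gt1 n_gt1); rewrite -[(n ^ 2)%N]/(n * n)%N.
    by move: 'C(n, 2) (n * n)%N => c d; clear; lia.
  have n2 : (0 < n ^ 2)%N by rewrite expn_gt0 (ltnW n_gt1).
  have : ln ('C(n, 2).+1)%:R <= ln (n ^ 2)%:R :> R.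
    by rewrite ler_ln ?posrE ?ltr0n ?n2 // ler_nat.
  by rewrite natrX lnXn // mulr_natl.
have lower := ln_bin_ge edges_gt0 edges_lt mE.
rewrite entropy_main_term -/MT -/x in lower.
have n_le : n%:R <= MT.
  have lg1 : 1 <= lg n%:R :> R by rewrite /lg ler_pdivlMr ?mul1r.
  have h := width_bound_main_term.
  apply: (@le_trans _ _ (n%:R ^+ 2 / L%:R)).
    rewrite ler_pdivlMr // expr2 ler_pM2l //.
    by rewrite -ler_ln ?posrE.
  apply: le_trans h _; rewrite ler_pdivrMr ?lg_n_gt0 // ler_peMr //.
  exact: ltW.
have W0 : 0 <= W%:R :> R by [].
have nV : n%:R * n%:R^-1 = 1 :> R by rewrite divff // gt_eqF.
have nV0 : 0 < n%:R^-1 :> R by rewrite invr_gt0.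
(* the two error terms of the counting bound are at most 3 MT / n *)
have MTn : 1 <= MT * n%:R^-1 by rewrite ler_pdivlMr ?mul1r.
have e_n : 3 * n%:R^-1 <= eps by rewrite ler_pdivrMr.
have step : (MT * (1 - 3 * n%:R^-1)) * x <= (W%:R * (1 + eps)) * x.
  have : W%:R * (ln 4 + x) <= W%:R * (eps * x + x) by rewrite ler_wpM2l //; lra.
  have : x <= MT * n%:R^-1 * x by rewrite ler_peMl // ltW.
  lra.
rewrite (ler_pM2r x0) in step.
have step2 : MT * (1 - eps) <= W%:R * (1 + eps).
  by apply: le_trans step; rewrite ler_pM2l //; lra.
rewrite -(@ler_pM2r _ (1 + eps)); last by lra.
apply: le_trans step2; rewrite -mulrA mulrCA.
rewrite ler_pM2l //.
have : 0 <= eps * eps by rewrite mulr_ge0 // ltW.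
lra.
Qed.

End FixedSize.

End Asymptotics.

(** * Bounds for large n *)

Section Eventually.

Variables (R : realType) (gamma : nat -> R).
Hypothesis gamma01 : forall n : nat, 0 < gamma n < 1.
Hypothesis gamma_subpoly : exists2 e : nat -> R, e n @[n --> \oo] --> (0 : R) &
  \forall n \near \oo, Num.max (gamma n)^-1 (1 - gamma n)^-1 = n%:R `^ e n.

Lemma near_ln_ge (x : R) : \forall n \near \oo, x <= ln n%:R.
Proof.
near=> n; have : expR x <= n%:R by near: n; exact: nbhs_infty_ger.
move=> h; rewrite -[x]expRK ler_ln // posrE ?expR_gt0 //.
exact: lt_le_trans (expR_gt0 x) h.
Unshelve. all: by end_near. Qed.

Lemma ln_le_linear (d y : R) : 0 < d -> 0 < y -> ln y <= d * y - ln d.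
Proof.
move=> d0 y0; have : ln (d * y) <= d * y by apply/ltW/ln_sublinear/mulr_gt0.
by rewrite lnM ?posrE //; lra.
Qed.

Let is_size n m := m%:R = gamma n * 'C(n, 2)%:R :> R.

(** The hypothesis on the density gives 1 / (g (1 - g)) = n^{o(1)}, and lg^2 n
    is n^{o(1)} too. *)
Lemma near_width_bound (eps : R) : 0 < eps -> \forall n \near \oo,
  forall m, is_size n m -> ln (width_bound n m)%:R <= eps * ln n%:R :> R.
Proof.
move=> e0; have [e cvg_e ge] := gamma_subpoly.
have ln2_gt0 : 0 < ln 2 :> R by apply: ln_gt0; rewrite ltr1n.
pose d := eps / 8; have d0 : 0 < d by rewrite divr_gt0.
pose K := ln 2 + 2 * (ln (2 / ln 2) - ln d) : R.
near=> n => m mE.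
have n_gt1 : (1 < n)%N by near: n; exact: nbhs_infty_gt.
have x0 : 0 < ln n%:R :> R by apply: ln_gt0; rewrite ltr1n.
have hK : 2 * K / eps <= ln n%:R by near: n; exact: near_ln_ge.
have he : `|e n| <= d by near: n; apply: (cvgr0_norm_le _ cvg_e).
have hg : Num.max (gamma n)^-1 (1 - gamma n)^-1 = n%:R `^ e n by near: n.
have /andP[g0 g1] := gamma01 n; have g1' : 0 < 1 - gamma n by rewrite subr_gt0.
have le_e : e n * ln n%:R <= d * ln n%:R.
  by rewrite ler_pM2r //; apply: le_trans he; exact: ler_norm.
have hinv y : 0 < y -> y^-1 <= n%:R `^ e n -> - ln y <= d * ln n%:R.
  move=> y0 h; apply: le_trans le_e; rewrite -ln_powR -lnV ?posrE //.
  rewrite ler_ln ?posrE ?invr_gt0 //.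
  by apply: lt_le_trans h; rewrite invr_gt0.
have h1 : - ln (gamma n) <= d * ln n%:R.
  by apply: hinv => //; rewrite -hg le_max lexx.
have h2 : - ln (1 - gamma n) <= d * ln n%:R.
  by apply: hinv => //; rewrite -hg le_max lexx orbT.
have u0 : 0 < (up_log 2 n)%:R :> R by rewrite ltr0n up_log_gt0.
have LR : 0 < (width_bound n m)%:R :> R by rewrite ltr0n width_bound_gt0.
have hu : ln (up_log 2 n)%:R <= ln (2 / ln 2) + (d * ln n%:R - ln d) :> R.
  have c0 : 0 < 2 / ln 2 :> R by rewrite divr_gt0.
  apply: (@le_trans _ _ (ln (2 / ln 2 * ln n%:R))).
    rewrite ler_ln ?posrE ?(mulr_gt0 c0 x0) //.
    by rewrite mulrAC; exact: up_log_le_ln.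
  by rewrite lnM ?posrE // lerD2l; exact: ln_le_linear.
have := width_bound_le_real n_gt1 (gamma01 n) mE.
have g2 : 0 < gamma n * (1 - gamma n) by exact: mulr_gt0.
have u2 : 0 < (up_log 2 n)%:R ^+ 2 :> R by exact: exprn_gt0.
have u3 : 0 < 2 * (up_log 2 n)%:R ^+ 2 :> R by exact: mulr_gt0.
rewrite -ler_ln ?posrE ?(mulr_gt0 LR g2) //.
rewrite expr2 !lnM ?posrE ?mulr_gt0 //.
move: hK; rewrite ler_pdivrMr // /K /d in h1 h2 hu *; lra.
Unshelve. all: by end_near. Qed.

Local Notation MT n := (main_term n (gamma n)).

(** What the program guarantees for the weight W of the partition that it
    computes for a graph with n vertices and m edges. *)
Definition light n m W : Prop := exists a b : nat,
  [/\ (W <= n + (a + b) + width_bound n m *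
        (n * (width_bound n m * (width_bound n m * choice_bound n m))))%N,
      (a * width_bound n m <= 'C(n, 2))%N
    & (choice_bound n m ^ b <= width_bound n m ^ b * 'C('C(n, 2), m))%N].

Lemma near_upper_bound (eps : R) : 0 < eps -> \forall n \near \oo,
  forall m W, is_size n m -> light n m W -> W%:R <= (1 + eps) * MT n.
Proof.
move=> e0; pose d := Num.min (eps / 3) (1 / 2).
have d0 : 0 < d by rewrite lt_min !divr_gt0.
have d_half : d <= 1 / 2 by rewrite ge_min lexx orbT.
have d_eps : 3 * d <= eps.
  have : d <= eps / 3 by rewrite ge_min lexx.
  lra.
have ln2_gt0 : 0 < ln 2 :> R by apply: ln_gt0; rewrite ltr1n.
have d10 : 0 < d / 10 by rewrite divr_gt0.
near=> n => m W mE [a [b [hW ha hb]]].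
have n_gt1 : (1 < n)%N by near: n; exact: nbhs_infty_gt.
have hL : ln (width_bound n m)%:R <= d / 10 * ln n%:R :> R.
  by move: m mE {W hW a ha b hb}; near: n; exact: near_width_bound.
have h2 : 10 * ln 2 / d <= ln n%:R by near: n; exact: near_ln_ge.
have h3 : 3 * ln 2 / d <= ln n%:R by near: n; exact: near_ln_ge.
have MT0 := main_term_gt0 n_gt1 (gamma01 n).
apply: (@le_trans _ _ ((1 + 3 * d) * MT n)); last by rewrite ler_wpM2r ?(ltW MT0) // lerD2l.
apply: (upper_bound n_gt1 (gamma01 n) mE _ _ _ _ hW ha hb).
- by rewrite d0.
- lra.
- by move: h2; rewrite ler_pdivrMr // [_ * d]mulrC.
- by move: h3; rewrite ler_pdivrMr // /lg mulrA ler_pdivlMr // [_ * d]mulrC.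
Unshelve. all: by end_near. Qed.

Lemma near_lower_bound (eps : R) : 0 < eps -> \forall n \near \oo,
  forall m W, is_size n m -> ('C('C(n, 2), m) <= (4 * n) ^ W)%N ->
  (1 - eps) * MT n <= W%:R.
Proof.
move=> e0; pose d := eps / 2; have d0 : 0 < d by rewrite divr_gt0.
near=> n => m W mE hC.
have n_gt1 : (1 < n)%N by near: n; exact: nbhs_infty_gt.
have hL : ln (width_bound n m)%:R <= 1 * ln n%:R :> R.
  by move: m mE {W hC}; near: n; exact: near_width_bound.
have h4 : ln 4 / d <= ln n%:R by near: n; exact: near_ln_ge.
have h2 : ln 2 <= ln n%:R :> R by near: n; exact: near_ln_ge.
have h3 : 3 / d <= n%:R by near: n; exact: nbhs_infty_ger.
have -> : 1 - eps = 1 - 2 * d by rewrite /d; lra.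
apply: (lower_bound n_gt1 (gamma01 n) mE d0 _ _ _ h2 hC).
- by rewrite mul1r in hL.
- by move: h4; rewrite ler_pdivrMr // [_ * d]mulrC.
- by move: h3; rewrite ler_pdivrMr // [_ * d]mulrC.
Unshelve. all: by end_near. Qed.

Let sizeE n (G : sgraph n) : has_density (gamma n) G -> is_size n #|edges G|.
Proof. by move=> /eqP. Qed.

Lemma program_light n (G : sgraph n) adj : (1 < n)%N ->
  has_density (gamma n) G -> adjacency_list G adj ->
  exists t P, [/\ computes_partition program (20 * up_log 2 n) G adj t P,
    (t <= 5000 * (n + width_bound n #|edges G| * width_bound n #|edges G|
       + #|edges G|) + 10)%N & light n #|edges G| (weight P)].
Proof.
move=> n_gt1 dG adjP; have mE := sizeE dG.
have m0 := edges_gt0 n_gt1 (gamma01 n) mE; have mN := edges_lt n_gt1 (gamma01 n) mE.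
exact: program_correct.
Qed.

Lemma adjacency_list_exists n (G : sgraph n) : exists adj, adjacency_list G adj.
Proof.
exists (fun v : 'I_n => enum [pred u : 'I_n | [set v; u]%SET \in edges G]) => v; split.
  exact: enum_uniq.
by move=> u; rewrite mem_enum.
Qed.

Lemma bp_light n (G : sgraph n) : (1 < n)%N -> has_density (gamma n) G ->
  exists2 W, light n #|edges G| W & (bp G <= W)%N.
Proof.
move=> n_gt1 dG; have [adj adjP] := adjacency_list_exists G.
have [t [P [[s [S [_ _ _ _ PG]]] _ lP]]] := program_light n_gt1 dG adjP.
by exists (weight P) => //; exact: bp_le.
Qed.

Lemma near_bp_max (eps : R) : 0 < eps -> \forall n \near \oo,
  (exists G : sgraph n, has_density (gamma n) G) ->
  (1 - eps) * MT n <= (bp_max n (gamma n))%:R <= (1 + eps) * MT n.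
Proof.
move=> e0; near=> n => -[G dG].
have n_gt1 : (1 < n)%N by near: n; exact: nbhs_infty_gt.
have MT0 := main_term_gt0 n_gt1 (gamma01 n).
apply/andP; split.
  have hC : ('C('C(n, 2), #|edges G|) <= (4 * n) ^ bp_max n (gamma n))%N.
    apply: bin_le_bp => [|H EH]; first exact: ltnW.
    have dH : has_density (gamma n) H by rewrite /has_density EH.
    exact: leq_bigmax_cond dH.
  move: (#|edges G|) (bp_max n (gamma n)) (sizeE dG) hC.
  by near: n; exact: near_lower_bound.
rewrite /bp_max; apply: (big_ind (fun k : nat => k%:R <= (1 + eps) * MT n)).
- by rewrite mulr_ge0 ?addr_ge0 ?(ltW MT0) ?(ltW e0).
- by move=> x y; rewrite /maxn; case: ifP.
move=> H dH; have [W lW leW] := bp_light n_gt1 dH.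
apply: (@le_trans _ _ W%:R); first by rewrite ler_nat.
move: #|edges H| W (sizeE dH) lW {leW}.
by near: n; exact: near_upper_bound.
Unshelve. all: by end_near. Qed.

(** The relative excess over the main term of the largest weight that the
    guarantee allows.  The weights are bounded by n^2. *)
Definition excess (n : nat) : R :=
  \big[Num.max/0]_(W < (n * n).+1 |
      `[< exists2 G : sgraph n, has_density (gamma n) G & light n #|edges G| W >])
    (W%:R / MT n - 1).

Lemma excess_cvg0 : excess n @[n --> \oo] --> (0 : R).
Proof.
apply/cvgr0Pnorm_le => eps e0; near=> n.
have n_gt1 : (1 < n)%N by near: n; exact: nbhs_infty_gt.
have MT0 := main_term_gt0 n_gt1 (gamma01 n).
have ex0 : 0 <= excess n by exact: bigmax_ge_id.
rewrite ger0_norm //; apply: bigmax_le => [|W /asboolP[G dG lW]]; first exact: ltW.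
rewrite lerBlDl ler_pdivrMr //.
move: #|edges G| (nat_of_ord W) (sizeE dG) lW.
by near: n; exact: near_upper_bound.
Unshelve. all: by end_near. Qed.

Lemma excess_ge n (G : sgraph n) W : (1 < n)%N -> has_density (gamma n) G ->
  light n #|edges G| W -> (W <= n * n)%N -> W%:R <= (1 + excess n) * MT n.
Proof.
move=> n_gt1 dG lW leW; have MT0 := main_term_gt0 n_gt1 (gamma01 n).
rewrite -ler_pdivrMr // -lerBlDl.
have ltW : (W < (n * n).+1)%N by [].
apply: (@le_bigmax_cond _ _ _ _ (Ordinal ltW)).
by apply/asboolP; exists G.
Qed.

Lemma near_width_sqrt : \forall n \near \oo, forall m, is_size n m ->
  (width_bound n m * width_bound n m <= n)%N.
Proof.
near=> n => m mE; have n_gt1 : (1 < n)%N by near: n; exact: nbhs_infty_gt.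
have L0 := width_bound_gt0 n_gt1 m.
have : ln (width_bound n m)%:R <= 1 / 2 * ln n%:R :> R.
  by move: m mE {L0}; near: n; apply: near_width_bound; rewrite divr_gt0.
move: (width_bound n m) L0 => K K0 hK.
rewrite -(ler_nat R) -ler_ln ?posrE ?ltr0n ?muln_gt0 ?K0 ?(ltnW n_gt1) //.
rewrite natrM lnM ?posrE ?ltr0n //; lra.
Unshelve. all: by end_near. Qed.

(** For n large, L^2 <= n <= 4 m, because C(n, 2) < m L <= m n.  For the finitely
    many other n, the polynomial bound on L suffices. *)
Lemma linear_time : exists C, forall n (G : sgraph n), (1 < n)%N ->
  has_density (gamma n) G ->
  (5000 * (n + width_bound n #|edges G| * width_bound n #|edges G|
     + #|edges G|) + 10 <= C * #|edges G|)%N.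
Proof.
have [n0 _ big] := near_width_sqrt.
exists (5000 * (n0 + n0 ^ 6 * n0 ^ 6 + 9) + 10)%N => n G n_gt1 dG.
have mE := sizeE dG; have m0 := edges_gt0 n_gt1 (gamma01 n) mE.
have mN := edges_lt n_gt1 (gamma01 n) mE.
have [le_n0|lt_n] := leqP n0 n; last first.
  have : (width_bound n #|edges G| <= n0 ^ 6)%N.
    by apply: leq_trans (width_bound_le n_gt1 m0 mN) _; rewrite leq_exp2r // ltnW.
  move: (width_bound n #|edges G|) (n0 ^ 6)%N => K c leK.
  move: #|edges G| m0 {mE mN} => m m0.
  have : (K * K <= c * c)%N by apply: leq_mul.
  by move: (K * K)%N (c * c)%N => x y lexy; nia.
have LL := big n le_n0 _ mE.
have := pairs_lt_width n_gt1 m0 mN.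
move: (width_bound n #|edges G|) LL (width_bound_gt0 n_gt1 #|edges G|) => K LL K0 ltN.
have bigN : (n * n <= 4 * 'C(n, 2))%N.
  have : (2 * 'C(n, 2) = n * (n - 1))%N by rewrite -mul_bin_diag bin1 subn1.
  by move: n_gt1; nia.
have leKn : (K <= n)%N by apply: leq_trans LL; rewrite leq_pmulr.
have le_n : (n <= 4 * #|edges G|)%N.
  have n0' : (0 < n)%N by exact: ltnW.
  rewrite -(leq_pmul2l n0'); apply: leq_trans bigN _.
  have : (#|edges G| * K <= #|edges G| * n)%N by rewrite leq_mul2l leKn orbT.
  by move: ltN; lia.
move: (K * K)%N #|edges G| m0 LL le_n {ltN mE mN} => x m m0 LL le_n.
have : (9 * m <= (n0 + n0 ^ 6 * n0 ^ 6 + 9) * m)%N by rewrite leq_mul2r leq_addl orbT.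
by move: (_ + 9)%N => c; nia.
Qed.

End Eventually.

Theorem mainTheorem3 (R : realType) (gamma : nat -> R)
  (gamma01 : forall n : nat, 0 < gamma n < 1)
  (gamma_subpoly : exists2 e : nat -> R, e n @[n --> \oo] --> (0 : R) &
     \forall n \near \oo,
       Num.max (gamma n)^-1 (1 - gamma n)^-1 = n%:R `^ e n) :
  (* n ranges over the integers for which gamma n is the density of a graph *)
  ((bp_max n (gamma n))%:R / (h2 (gamma n) / 2 * (n%:R ^+ 2 / lg n%:R))
     @[n --> within [set n | exists G : sgraph n, has_density (gamma n) G] \oo]
     --> (1 : R))
  /\
  exists (p : cmd) (c C : nat) (delta : nat -> R),
    delta n @[n --> \oo] --> (0 : R) /\
    forall (n : nat) (G : sgraph n) (adj : 'I_n -> seq 'I_n),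
      (1 < n)%N -> has_density (gamma n) G -> adjacency_list G adj ->
      exists (t : nat) (P : seq (sides n)),
        [/\ computes_partition p (c * up_log 2 n) G adj t P,
            (t <= C * #|edges G|)%N
          & (weight P)%:R <=
              (1 + delta n) * (h2 (gamma n) / 2 * (n%:R ^+ 2 / lg n%:R))].
Proof.
split.
  apply/cvgrPdist_le => eps e0.
  suff: \forall n \near \oo, (exists G : sgraph n, has_density (gamma n) G) ->
      `|1 - (bp_max n (gamma n))%:R / main_term n (gamma n)| <= eps by [].
  near=> n => exG.
  have n_gt1 : (1 < n)%N by near: n; exact: nbhs_infty_gt.
  have MT0 := main_term_gt0 n_gt1 (gamma01 n).
  have /andP[lo hi] : (1 - eps) * main_term n (gamma n) <= (bp_max n (gamma n))%:R
      <= (1 + eps) * main_term n (gamma n).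
    by move: exG; near: n; exact: near_bp_max.
  rewrite -ler_pdivlMr // in lo; rewrite -ler_pdivrMr // in hi.
  by rewrite ler_norml; apply/andP; split; lra.
have [C timeC] := linear_time gamma01 gamma_subpoly.
exists program, 20%N, C, (excess gamma); split; first exact: excess_cvg0.
move=> n G adj n_gt1 dG adjP.
have [t [P [comp le_t lP]]] := program_light gamma01 n_gt1 dG adjP.
exists t, P; split => //; first exact: leq_trans le_t (timeC _ _ n_gt1 dG).
have [s [S [_ _ _ _ PG]]] := comp.
have leW : (weight P <= n * n)%N.
  apply: leq_trans (weight_le PG) _; apply: leq_trans (pairs_le n).
  by rewrite leq_mul2l /= ltnW // (edges_lt n_gt1 (gamma01 n)) //; exact/eqP.
exact: (excess_ge gamma01 n_gt1 dG lP leW).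
Unshelve. all: by end_near. Qed.
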